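(* Let $d\ge 2$ be a natural number, $T_1,\dots,T_d>0$, and $[0,\mathbb{T}]_d:=[0,T_1]\times\dots\times[0,T_d]$. Let $W=(W(\underline{x}),\ \underline{x}\in\mathbb{R}_+^d)$ be a zero-mean continuous Gaussian random field for which there is a constant $\sigma>0$ such that $$\mathbb{E}(\exp(i\xi W(\underline{x})))=\exp\Big(-\tfrac12\sigma^2\xi^2(x_1+\dots+x_d)\Big)$$ for every $\xi\in\mathbb{R}$ and every $\underline{x}=(x_1,\dots,x_d)\in\mathbb{R}_+^d$. Let $l_k=(l_k(x),\ x\in[0,T_k])$, $k=1,\dots,d$, be independent Lévy subordinators with triplets $(\gamma_k,0,\nu_k)$ which are independent of $W$, and define $L:\Omega\times[0,\mathbb{T}]_d\to\mathbb{R}$ by $L(\underline{x}):=W(l_1(x_1),\dots,l_d(x_d))$ for $\underline{x}=(x_1,\dots,x_d)\in[0,\mathbb{T}]_d$. Further, let $\tilde l_k$ on $[0,T_k]$, $k=1,\dots,d$, be independent Lévy processes with Lévy triplets $(0,\sigma^2\gamma_k/2,\nu_k^\#)$ in the sense of the one-dimensional Lévy-Khinchin formula, where the Lévy measure $\nu_k^\#$ is defined by $$\nu_k^\#([a,b]):=\int_0^\infty\int_a^b\frac{1}{\sqrt{2\pi\sigma^2t}}\exp\Big(-\frac{x^2}{2\sigma^2t}\Big)\,dx\,\nu_k(dt),\qquad a,b\in\mathbb{R},\ k=1,\dots,d.$$ Then the pointwise marginal distribution of the subordinated Gaussian random field $L$ satisfies $$L(\underline{x})\stackrel{\mathcal{D}}{=}\tilde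 l_1(x_1)+\dots+\tilde l_d(x_d)$$ for every $\underline{x}=(x_1,\dots,x_d)\in[0,\mathbb{T}]_d$, where $\stackrel{\mathcal{D}}{=}$ denotes equality in distribution.
   Context: $(\Omega,\mathcal{F},\mathbb{P})$ is a complete probability space and $\mathbb{R}_+:=[0,+\infty)$. A Gaussian random field on $\mathbb{R}_+^d$ is a family of real random variables all of whose finite-dimensional marginals are multivariate Gaussian; ''continuous'' means that its paths are $\mathbb{P}$-almost surely continuous. $W$ is jointly measurable, i.e. $\mathcal{F}\otimes\mathcal{B}(\mathbb{R}_+^d)$-$\mathcal{B}(\mathbb{R})$-measurable. A Lévy process $l$ is a real-valued process with $l(0)=0$ a.s., independent and stationary increments, and stochastic continuity. A Lévy process has triplet $(b,\sigma_N^2,\nu)$ in the sense of the one-dimensional Lévy-Khinchin formula if $$\mathbb{E}(\exp(i\xi l(t)))=\exp\Big(t\Big(ib\xi-\frac{\sigma_N^2}{2}\xi^2+\int_{\mathbb{R}\setminus\{0\}}\big(e^{i\xi y}-1-i\xi y\,\mathbf{1}_{\{|y|\le1\}}(y)\big)\,\nu(dy)\Big)\Big),\quad\xi\in\mathbb{R}.$$ A Lévy subordinator is a Lévy process that is $\mathbb{P}$-almost surely non-decreasing (so it takes values in $\mathbb{R}_+$). The triplet $(\gamma,0,\nu)$ of a subordinator $l$ refers instead to the representation $$\mathbb{E}(\exp(i\xi l(t)))=\exp\Big(t\Big(i\gamma\xi+\int_0^\infty (e^{i\xi y}-1)\,\nu(dy)\Big)\Big),\quad\xi\in\mathbb{R},$$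 where $\nu$ is the Lévy measure of $l$, which satisfies $\nu(-\infty,0)=0$ and $\int_0^\infty\min(y,1)\,\nu(dy)<\infty$ (as a Lévy measure it puts no mass at $0$; integrals $\int_0^\infty$ against $\nu$ are over $(0,\infty)$).
   Formalization: The Gaussian entry of the triplet of l̃_k is σ²γ_k instead of the printed σ²γ_k/2: with the stated Lévy-Khinchin convention (−σ_N²ξ²/2) the printed value fails, e.g. for ν_k=0, γ_k=1, l_k(x)=x. *)

(* Defs.v *)
From HB Require Import structures.
From mathcomp Require Import all_boot all_order all_algebra.
From mathcomp Require Import complex.
From mathcomp Require Import all_classical all_reals all_analysis.

Set Implicit Arguments.
Unset Strict Implicit.
Unset Printing Implicit Defensive.

Import Order.TTheory GRing.Theory Num.Theory.
Import numFieldNormedType.Exports.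

Local Open Scope classical_set_scope.
Local Open Scope complex_scope.
Local Open Scope ring_scope.

Section complex_exponential.
Context {R : realType}.

Definition cexp (z : R[i]) : R[i] :=
  (expR (complex.Re z))%:C *
  (cos (complex.Im z) +i* sin (complex.Im z)).

Definition cintegral d (T : measurableType d) (mu : {measure set T -> \bar R})
    (D : set T) (f : T -> R[i]) : R[i] :=
  Rintegral mu D (fun x => complex.Re (f x)) +i*
  Rintegral mu D (fun x => complex.Im (f x)).

End complex_exponential.

Section random_variables.
Context {d : measure_display} {Omega : measurableType d} {R : realType}.
Variable P : probability Omega R.

Definition charfun (X : Omega -> R) (xi : R) : R[i] :=
  cintegral P setT (fun w => cexp ('i%C * (xi * X w)%:C)).

Definition eq_in_law (X Y : Omega -> R) : Prop :=
  [/\ measurable_fun setT X, measurable_fun setT Y &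
      forall B : set R, measurable B -> P (X @^-1` B) = P (Y @^-1` B)].

(* Every F i is meant to be a sigma-algebra: since it then contains setT, the
   product rule for the whole family gives it for all subfamilies. *)
Definition independent (I : finType) (F : I -> set (set Omega)) : Prop :=
  forall A : I -> set Omega, (forall i, F i (A i)) ->
    P (\bigcap_(i in [set: I]) A i) = (\prod_(i : I) P (A i))%E.

Definition sigma_gen (I : Type) (D : set I) (X : I -> Omega -> R)
    : set (set Omega) :=
  <<s \bigcup_(t in D) preimage_set_system setT (X t) measurable >>.

(* The library's normal_prob m 0 is not the Dirac mass at m, hence the case
   distinction; constants count as (degenerate) Gaussian variables. *)
Definition gaussian_rv (X : Omega -> R) : Prop :=
  measurable_fun setT X /\
  exists m s : R, 0 <= s /\
    forall B : set R, measurable B ->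
      P (X @^-1` B) = if s == 0 then \d_m B else normal_prob m s B.

Definition gaussian_vector (q : nat) (X : 'I_q -> Omega -> R) : Prop :=
  forall c : 'I_q -> R, gaussian_rv (fun w => \sum_(j < q) c j * X j w).

Definition gaussian_field (I : Type) (D : set I) (X : I -> Omega -> R) : Prop :=
  forall (q : nat) (x : 'I_q -> I), (forall j, D (x j)) ->
    gaussian_vector (fun j => X (x j)).

End random_variables.

Section levy_processes.
Context {d : measure_display} {Omega : measurableType d} {R : realType}.
Variable P : probability Omega R.

Definition levy_process (T : R) (X : R -> Omega -> R) : Prop :=
  [/\ forall t : R, t \in `[0, T] -> measurable_fun setT (X t),
      \forall w \ae P, X 0 w = 0,
      forall (m : nat) (t : nat -> R),
        (forall j, (j <= m)%N -> t j \in `[0, T]) ->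
        (forall j, (j < m)%N -> t j < t j.+1) ->
        independent P (fun j : 'I_m =>
          preimage_set_system setT (X (t j.+1) \- X (t j)) measurable),
      forall s h : R, 0 <= s -> 0 <= h -> s + h <= T ->
        eq_in_law P (X (s + h) \- X s) (X h \- X 0) &
      forall t eps : R, t \in `[0, T] -> 0 < eps ->
        P [set w | eps < `|X s w - X t w|]
          @[s --> within `[0, T]%classic (nbhs t)] --> 0%E].

Definition levy_subordinator (T : R) (X : R -> Omega -> R) : Prop :=
  levy_process T X /\
  \forall w \ae P, forall s t : R, 0 <= s -> s <= t -> t <= T -> X s w <= X t w.

(* s2 is the variance, per unit of time, of the Gaussian component: its
   contribution to the exponent is - s2 / 2 * xi ^+ 2. *)
Definition levy_khinchin_triplet (T : R) (X : R -> Omega -> R)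
    (b s2 : R) (nu : {measure set R -> \bar R}) : Prop :=
  forall t xi : R, t \in `[0, T] ->
    charfun P (X t) xi =
    cexp (t%:C * ('i%C * (b * xi)%:C - (s2 / 2 * xi ^+ 2)%:C +
      cintegral nu [set~ 0] (fun y =>
        cexp ('i%C * (xi * y)%:C) - 1
        - 'i%C * (xi * y * \1_[set z : R | `|z| <= 1] y)%:C))).

Definition subordinator_triplet (T : R) (X : R -> Omega -> R)
    (gamma : R) (nu : {measure set R -> \bar R}) : Prop :=
  [/\ nu `]-oo, 0[%classic = 0%E,
      nu [set 0] = 0%E,
      (\int[nu]_(y in `]0%R, +oo[) (Num.min y 1)%:E < +oo)%E &
      forall t xi : R, t \in `[0, T] ->
        charfun P (X t) xi =
        cexp (t%:C * ('i%C * (gamma * xi)%:C +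
          cintegral nu `]0, +oo[%classic
            (fun y => cexp ('i%C * (xi * y)%:C) - 1)))].

End levy_processes.

Definition orthant (R : realType) (n : nat) : set 'rV[R]_n :=
  [set x | forall k, 0 <= x 0 k].

(* F (x) B(R_+^n)-measurability; a field on R_+^n is represented by a function
   on 'rV_n whose values outside of the orthant are irrelevant. *)
Definition jointly_measurable (R : realType) d (Omega : measurableType d)
    (n : nat) (W : 'rV[R]_n -> Omega -> R) : Prop :=
  let B := g_sigma_algebraType (@open 'rV[R]_n) in
  measurable_fun (([set: Omega] `*` @orthant R n) : set (Omega * B)%type)
    (fun p : (Omega * B)%type => W p.2 p.1).

(* W is a field on R_+^n, l_k a process on [0, T_k]. Since l_k only takes
   nonnegative values almost surely, W may be evaluated outside of the orthant,
   on a negligible event. *)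
Definition subordinated_field (R : realType) d (Omega : measurableType d)
    (n : nat) (W : 'rV[R]_n -> Omega -> R) (l : 'I_n -> R -> Omega -> R)
    (x : 'I_n -> R) (w : Omega) : R :=
  W (\row_k l k (x k) w) w.

Definition gauss_density (R : realType) (v x : R) : R :=
  (Num.sqrt (2 * pi * v))^-1 * expR (- (x ^+ 2 / (2 * v))).

(* Main.v *)
Require Import Defs.
From HB Require Import structures.
From mathcomp Require Import all_boot all_order all_algebra.
From mathcomp Require Import complex.
From mathcomp Require Import all_classical all_reals all_analysis.
From mathcomp Require Import measurable_realfun ring lra.

Set Implicit Arguments.
Unset Strict Implicit.
Unset Printing Implicit Defensive.

Import Order.TTheory GRing.Theory Num.Theory.
Import numFieldNormedType.Exports.

Local Open Scope classical_set_scope.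
Local Open Scope complex_scope.
Local Open Scope ring_scope.

(* Conditionally on the subordinators, W(l_1(x_1), ..., l_d(x_d)) is centred
   Gaussian with variance sigma^2 (l_1(x_1) + ... + l_d(x_d)), so its
   characteristic function at xi is the product of the Laplace transforms
   E exp(- s l_k(x_k)) with s = sigma^2 xi^2 / 2. Each of these equals
   exp(x_k (- gamma_k s + \int_0^oo (e^{-sy} - 1) nu_k(dy))). On the other side
   nusharp_k is the mixture of the laws N(0, sigma^2 t) over nu_k(dt), whence
   \int (cos(xi y) - 1) nusharp_k(dy) = \int_0^oo (e^{-st} - 1) nu_k(dt) while
   the imaginary part vanishes by symmetry: the two characteristic functions
   agree, and they determine the law.

   The Laplace transform of a subordinator is obtained from its characteristic
   function by averaging over a Cauchy variable U independent of everything,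
   since E cos(aU) = exp(-|a|). *)

(** * Integrals of bounded functions *)

(** The characteristic function of a subordinator is given on the real line only, while its Laplace
    transform is the value at an imaginary point. The Cauchy average replaces analytic continuation:
    it sends cos(bu) to e^{-b} for b >= 0, which is e^{ibu} at u = i. On the side of E cos(u(sX +
    c)) this is Fubini. On the side of the exponential of the Levy exponent it has to be proved, and
    this is the main obstacle. There the Levy measure is cut off near 0 to become finite, the
    exponential is replaced by powers (1 + z/n)^n, which contain only frequencies b >= 0, and both
    approximations are removed by bounded convergence, every function involved having modulus at
    most 1. A second obstacle is that nusharp_k is prescribed on compact intervals only and may be
    infinite near 0. It is identified through an even Lebesgue density that is bounded on each set
    |x| >= c > 0. Conditioning on the subordinators is carried out on finite grids, where
    independence of events suffices, and path continuity removes the grid. *)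

Section bounded_functions.
Context d (T : measurableType d) (R : realType).
Variable mu : {finite_measure set T -> \bar R}.
Implicit Types (f g : T -> R) (M : R).

Lemma bounded_integrable f M : measurable_fun setT f ->
  (forall x, `|f x| <= M) -> mu.-integrable setT (EFin \o f).
Proof.
move=> mf fM; apply: (@le_integrable _ _ _ mu setT measurableT _ (EFin \o cst M)).
- exact/measurable_EFinP.
- by move=> x _ /=; rewrite lee_fin (le_trans (fM x))// ler_norm.
- exact: finite_measure_integrable_cst.
Qed.

(** For a finite measure the constant [M] is an integrable dominating function. Most limits under an
    integral below are taken in this form. *)
Lemma bounded_cvg_Rintegral (f_ : nat -> T -> R) f M :
  (forall n, measurable_fun setT (f_ n)) -> measurable_fun setT f ->
  (forall n x, `|f_ n x| <= M) ->
  (\forall x \ae mu, f_ n x @[n --> \oo] --> f x) ->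
  \int[mu]_x f_ n x @[n --> \oo] --> \int[mu]_x f x.
Proof.
move=> mf_ mf fM ff.
have [] := @dominated_convergence _ _ _ mu setT measurableT
    (fun n => EFin \o f_ n) (EFin \o f) (EFin \o cst M).
- by move=> n; exact/measurable_EFinP.
- exact/measurable_EFinP.
- apply: filterS ff => x ff _; apply: cvg_EFin; last exact: ff.
  exact: nearW.
- exact: finite_measure_integrable_cst.
- by apply: aeW => x n _ /=; rewrite lee_fin.
move=> fi _ H; apply: fine_cvg; rewrite fineK//.
exact: integrable_fin_num.
Qed.

Lemma bounded_Rintegral_le f M : measurable_fun setT f ->
  (forall x, `|f x| <= M) -> `|\int[mu]_x f x| <= M * fine (mu setT).
Proof.
move=> mf fM; rewrite -Rintegral_cst//.
have fi := bounded_integrable mf fM.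
apply: (le_trans (le_normr_Rintegral measurableT fi)).
apply: le_Rintegral => //.
- by apply: (bounded_integrable (M := M)); [exact: measurableT_comp|move=> x; rewrite normr_id].
- exact: finite_measure_integrable_cst.
Qed.

End bounded_functions.

Section bounded_Fubini.
Context d1 d2 (T1 : measurableType d1) (T2 : measurableType d2) (R : realType).
Variables (m1 : {finite_measure set T1 -> \bar R})
          (m2 : {finite_measure set T2 -> \bar R}).
Variables (f : T1 -> T2 -> R) (M : R).
Hypothesis mf : measurable_fun setT (fun z : T1 * T2 => f z.1 z.2).
Hypothesis fM : forall x y, `|f x y| <= M.

Let bounded_integrable_prod :
  (m1 \x m2)%E.-integrable setT (EFin \o (fun z : T1 * T2 => f z.1 z.2)).
Proof.
apply: measurable_bounded_integrable => //.
  rewrite /= -setXTT product_measure1E// lte_mul_pinfty//.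
    exact: fin_num_measure.
  by rewrite -ge0_fin_numE//; exact: fin_num_measure.
exists M; split; first exact: num_real.
by move=> N MN z _; apply: le_trans (fM _ _) (ltW MN).
Qed.

Lemma bounded_measurable_Rintegral :
  measurable_fun setT (fun x => \int[m2]_y f x y).
Proof.
have := measurable_fubini_F bounded_integrable_prod; rewrite /fubini_F /= => mF.
exact: (measurableT_comp (fine_measurable measurableT) mF).
Qed.

(** Boundedness over two finite measures supplies the integrability required by Fubini and makes
    every inner integral finite, so that [fine] can be moved through. *)
Lemma bounded_Rintegral_swap :
  \int[m1]_x \int[m2]_y f x y = \int[m2]_y \int[m1]_x f x y.
Proof.
have := Fubini bounded_integrable_prod; rewrite /= /Rintegral => H.
have m1f x : measurable_fun setT (f x).
  exact: (measurableT_comp mf (pair1_measurable x)).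
have m2f y : measurable_fun setT (f ^~ y).
  exact: (measurableT_comp mf (pair2_measurable y)).
transitivity (fine (\int[m1]_x (\int[m2]_y (f x y)%:E)))%E.
  congr fine; apply: eq_integral => x _; rewrite fineK//.
  exact: (integrable_fin_num measurableT (bounded_integrable m2 (m1f x) (fM x))).
rewrite H; congr fine; apply: eq_integral => y _; rewrite fineK//.
exact: (integrable_fin_num measurableT (bounded_integrable m1 (m2f y) (fM^~ y))).
Qed.

End bounded_Fubini.

Import HBNNSimple.

(** Both sides are monotone limits along the same simple approximations of [f], which leaves
    indicators, where the hypothesis on [nu] applies. That hypothesis is an equation between set
    functions, so normal laws, truncated Levy measures and Gaussian mixtures are all covered. *)
Lemma ge0_integral_density d (T : measurableType d) (R : realType)
    (mu nu : {measure set T -> \bar R}) (g : T -> R) (f : T -> \bar R) :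
  measurable_fun setT g -> (forall x, 0 <= g x) ->
  (forall A, measurable A -> nu A = (\int[mu]_(x in A) (g x)%:E)%E) ->
  measurable_fun setT f -> (forall x, 0 <= f x)%E ->
  (\int[nu]_x f x = \int[mu]_x (f x * (g x)%:E))%E.
Proof.
move=> mg g0 nuE mf f0.
have mg' := (measurable_EFinP _ _).2 mg.
pose h := nnsfun_approx measurableT mf.
have -> : (\int[nu]_x f x =
    lim (\int[nu]_x (EFin \o h n) x @[n --> \oo]))%E.
  have fE x : f x = lim ((EFin \o h n) x @[n --> \oo]).
    by apply/esym/cvg_lim => //; exact: cvg_nnsfun_approx.
  under eq_integral do rewrite fE.
  apply: monotone_convergence => //.
  - by move=> n; apply/measurable_EFinP; exact/measurable_funP.
  - by move=> n x _ //=; rewrite lee_fin.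
  - by move=> x _ a b ab; rewrite lee_fin; exact/lefP/nd_nnsfun_approx.
have -> : (\int[mu]_x (f x * (g x)%:E) =
    lim (\int[mu]_x ((EFin \o h n) x * (g x)%:E) @[n --> \oo]))%E.
  have fg x : (f x * (g x)%:E = lim ((EFin \o h n) x * (g x)%:E @[n --> \oo]))%E.
    by apply/esym/cvg_lim => //; apply: cvgeZr => //; exact: cvg_nnsfun_approx.
  under eq_integral do rewrite fg.
  apply: monotone_convergence => //.
  - by move=> n; apply: emeasurable_funM => //; exact/measurable_EFinP.
  - by move=> n x _ /=; rewrite mule_ge0 ?lee_fin.
  - move=> x _ a b ab/=; rewrite lee_wpmul2r ?lee_fin//.
    exact/lefP/nd_nnsfun_approx.
congr (limn _); apply/funext => n.
transitivity (\int[nu]_x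
   (\sum_(y \in range (h n)) (y * \1_(h n @^-1` [set y]) x)%:E))%E.
  by apply: eq_integral => t tE; rewrite /= fimfunE -fsumEFin.
have indich m r : measurable_fun setT (fun x => (r * \1_(h m @^-1` [set r]) x)%:E).
  by apply: (measurable_comp measurableT) => //; exact: measurable_funM.
rewrite ge0_integral_fsum//; last by move=> m y Ey; exact: nnfun_muleindic_ge0.
transitivity (\int[mu]_x (\sum_(y \in range (h n))
    (y * \1_(h n @^-1` [set y]) x)%:E * (g x)%:E))%E; last first.
  under [RHS]eq_integral do rewrite /= fimfunE -fsumEFin//.
  by apply: eq_integral => x _; rewrite ge0_mule_fsuml// => y;
    exact: nnfun_muleindic_ge0.
rewrite ge0_integral_fsum//; last 2 first.
  - by move=> y; apply: emeasurable_funM.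
  - by move=> m y Ey; apply: mule_ge0; [exact: nnfun_muleindic_ge0|rewrite lee_fin].
apply: eq_fsbigr => r rhn.
(* A nonnegative simple function has empty level sets at negative values; for r >= 0 the factor
   comes out of both integrals. *)
have [r0|r0] := ltP r 0.
  rewrite preimage_nnfun0//.
  by rewrite !integral0_eq// => x _; rewrite indicE in_set0 mulr0 ?mul0e.
under eq_integral do rewrite EFinM.
under [RHS]eq_integral do rewrite EFinM -muleA.
rewrite [LHS]ge0_integralZl//; last exact/measurable_EFinP.
rewrite [RHS]ge0_integralZl//; last 2 first.
- by apply: emeasurable_funM => //; exact/measurable_EFinP.
- by move=> x _; rewrite mule_ge0 ?lee_fin.
congr (_ * _)%E.
rewrite [RHS](eq_integral ((EFin \o g) \_ (h n @^-1` [set r]))); last first.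
  by move=> x _; rewrite epatch_indic muleC.
by rewrite -integral_mkcond -nuE// integral_indic// setIT.
Qed.

Section probability_means.
Context d (T : measurableType d) (R : realType) (P : probability T R).

Lemma probability_Rintegral_cst (c : R) : \int[P]_x c = c.
Proof. by rewrite Rintegral_cst// [X in fine X]probability_setT mulr1. Qed.

Lemma probability_Rintegral_le (f : T -> R) (M : R) : measurable_fun setT f ->
  (forall x, `|f x| <= M) -> `|\int[P]_x f x| <= M.
Proof.
move=> mf fM; have := bounded_Rintegral_le P mf fM.
by rewrite [X in fine X]probability_setT mulr1.
Qed.

End probability_means.

Section derivatives.
Context {R : realType}.
Notation mu := (@lebesgue_measure R).

Lemma derivable1_continuous (f : R -> R) :
  (forall x, derivable f x 1) -> continuous f.
Proof. by move=> df x; exact/differentiable_continuous/derivable1_diffP. Qed.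

(** The fundamental theorem of calculus on [-n, n] gives h(n) - h(-n), which tends to 0, while
    dominated convergence with |h'| gives the integral over the line. This is what an integration by
    parts with vanishing boundary terms needs. *)
Lemma Rintegral_derivative0 (h h' : R -> R) :
  (forall x, is_derive x (1 : R) h (h' x)) -> continuous h' ->
  mu.-integrable setT (EFin \o h') ->
  h n%:R @[n --> \oo] --> 0 -> h (- n%:R) @[n --> \oo] --> 0 ->
  \int[mu]_x h' x = 0.
Proof.
move=> hh' ch' ih' hy hNy.
have ch : continuous h by apply: derivable1_continuous => x; exact: ex_derive.
pose f_ (n : nat) x := (h' x * \1_(`[- n%:R, n%:R]%classic) x)%:E.
have f_E n : (0 < n)%N -> (\int[mu]_x f_ n x = (h n%:R - h (- n%:R))%:E)%E.
  move=> n0; rewrite /f_.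
  have nn : - n%:R < n%:R :> R by have : 0 < n%:R :> R; [rewrite ltr0n|lra].
  transitivity (\int[mu]_(x in `[(- n%:R)%R, n%:R]) (h' x)%:E)%E.
    rewrite [RHS]integral_mkcond; apply: eq_integral => x _.
    by rewrite epatch_indic /= EFinM.
  rewrite (@continuous_FTC2 _ h' h)//.
  - exact: continuous_subspaceT.
  - split.
    + by move=> x _; exact: ex_derive.
    + exact/cvg_at_right_filter/ch.
    + exact/cvg_at_left_filter/ch.
  - by move=> x _; rewrite derive1E; exact: derive_val.
have mh' : measurable_fun setT h' by exact: continuous_measurable_fun.
have [] := @dominated_convergence _ _ _ mu setT measurableT f_ (EFin \o h')
  (EFin \o (fun x => `|h' x|)).
- by move=> n; apply/measurable_EFinP; apply: measurable_funM.
- exact/measurable_EFinP.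
- apply: aeW => x _; apply: cvg_EFin; first exact: nearW.
  apply: cvg_near_cst; near=> n.
  rewrite /= indicE mem_set ?mulr1//= in_itv/=.
  have xn : `|x| <= n%:R by near: n; exact: nbhs_infty_ger.
  by rewrite -ler_norml.
- exact: integrable_norm.
- apply: aeW => x n _ /=; rewrite lee_fin normrM ler_piMr//.
  by rewrite indicE; case: (_ \in _); rewrite ?normr1 ?normr0.
move=> _ _ H.
have K : [sequence (\int[mu]_(x in setT) f_ n x)%E]_n @ \oo --> (0 : R)%:E.
  have -> : (0 : R)%:E = (0 - 0)%:E by rewrite subr0.
  have E : {near \oo, (fun n => (h n%:R - h (- n%:R))%:E) =1
      [sequence (\int[mu]_(x in setT) f_ n x)%E]_n}.
    by near=> n; rewrite /= f_E//; near: n; exists 1%N.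
  apply: cvg_trans (near_eq_cvg E) _.
  apply: cvg_EFin; first exact: nearW.
  exact: cvgB.
by rewrite /Rintegral (cvg_unique _ H K).
Unshelve. all: by end_near. Qed.

End derivatives.

(** Positive and negative parts are compared separately as extended reals, so the two sides agree
    even when an integral diverges and [fine] returns its default. *)
Lemma integral_density d (T : measurableType d) (R : realType)
    (mu nu : {measure set T -> \bar R}) (g : T -> R) (f : T -> R) :
  measurable_fun setT g -> (forall x, 0 <= g x) ->
  (forall A, measurable A -> nu A = (\int[mu]_(x in A) (g x)%:E)%E) ->
  measurable_fun setT f ->
  \int[nu]_x f x = \int[mu]_x (f x * g x).
Proof.
move=> mg g0 nuE mf; rewrite /Rintegral integralE [in RHS]integralE.
congr (fine (_ - _)).
- rewrite (ge0_integral_density mg g0 nuE)//; last first.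
    by apply: measurable_funepos; exact/measurable_EFinP.
  apply: eq_integral => x _; rewrite !funeposE -!EFin_max -EFinM.
  by rewrite maxr_pMl// mul0r.
- rewrite (ge0_integral_density mg g0 nuE)//; last first.
    by apply: measurable_funeneg; exact/measurable_EFinP.
  apply: eq_integral => x _; rewrite !funenegE -!EFinN -!EFin_max -EFinM.
  by rewrite maxr_pMl// mul0r mulNr.
Qed.

(** * Normal distributions *)

Section normal.
Context {R : realType}.
Notation mu := (@lebesgue_measure R).

Lemma normal_pdf01E (x : R) :
  normal_pdf 0 1 x = normal_peak 1 * expR (- (x ^+ 2 / 2)).
Proof.
rewrite normal_pdfE ?oner_eq0// /normal_fun subr0 expr1n.
by congr (_ * expR _); rewrite mulNr.
Qed.

Lemma Rintegral_normal (m s : R) (f : R -> R) : measurable_fun setT f ->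
  \int[normal_prob m s]_x f x = \int[mu]_x (f x * normal_pdf m s x).
Proof.
move=> mf; apply: integral_density => //.
- exact: measurable_normal_pdf.
- exact: normal_pdf_ge0.
Qed.

(** Half of the Gaussian decay absorbs the factor |x|: the dominating function is a multiple of the
    density of N(0, 2), because |x| <= 1 + x^2/4 <= e^{x^2/4}. *)
Lemma integrable_id_normal_pdf :
  mu.-integrable setT (EFin \o (fun x : R => `|x| * normal_pdf 0 1 x)).
Proof.
pose s : R := Num.sqrt 2.
have s0 : s != 0 by rewrite gt_eqF// sqrtr_gt0.
have H := integrableZl measurableT (normal_peak 1 / normal_peak s)
  (integrable_normal_pdf 0 s).
apply: (le_integrable _ _ _ H) => //.
  apply/measurable_EFinP; apply: measurable_funM; first exact: normr_measurable.
  exact: measurable_normal_pdf.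
move=> x _ /=; rewrite lee_fin.
rewrite [leLHS]ger0_norm ?mulr_ge0 ?normal_pdf_ge0// [leRHS]ger0_norm; last first.
  rewrite mulr_ge0 ?normal_pdf_ge0// mulr_ge0 ?normal_peak_ge0//.
  by rewrite invr_ge0 normal_peak_ge0.
have p0 := normal_peak_gt0 s0.
rewrite normal_pdf01E (normal_pdfE 0 s0) /normal_fun subr0 sqr_sqrtr//.
have -> : normal_peak 1 / normal_peak s *
    (normal_peak s * expR (- x ^+ 2 / (2 *+ 2))) =
    normal_peak 1 * expR (- (x ^+ 2 / 4)).
  rewrite mulrA divfK ?gt_eqF//; congr (_ * expR _).
  have -> : 2 *+ 2 = 4 :> R by rewrite -mulr_natr; ring.
  by rewrite mulNr.
rewrite mulrCA ler_pM2l ?normal_peak_gt0 ?oner_eq0//.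
have -> : - (x ^+ 2 / 2) = - (x ^+ 2 / 4) - x ^+ 2 / 4 by lra.
rewrite expRD mulrCA ler_piMr ?expR_ge0// expRN.
rewrite ler_pdivrMr ?expR_gt0// mul1r.
apply: le_trans (expR_ge1Dx _).
have := sqr_ge0 (x / 2 + 1); have := sqr_ge0 (x / 2 - 1).
by rewrite !expr2 => h1 h2; rewrite ler_norml; apply/andP; split; lra.
Qed.

Lemma is_derive_sin_normal (a x : R) :
  is_derive x (1 : R) (fun y : R => sin (a * y) * normal_pdf 0 1 y)
    (a * (cos (a * x) * normal_pdf 0 1 x)
      - x * sin (a * x) * normal_pdf 0 1 x).
Proof.
have H1 : is_derive x (1:R) (fun y : R => a * y) a.
  by apply: is_derive_eq; rewrite scaler1.
have H2 : is_derive x (1:R) (fun y : R => sin (a * y)) (cos (a * x) * a).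
  exact: is_derive1_comp.
have H3 : is_derive x (1:R) (fun y : R => - (y ^+ 2 / 2)) (- x).
  by apply: is_derive_eq; rewrite /GRing.scale /=; lra.
have H4 : is_derive x (1:R) (fun y : R => expR (- (y ^+ 2 / 2)))
    (expR (- (x ^+ 2 / 2)) * - x).
  exact: is_derive1_comp.
have H5 : is_derive x (1:R) (normal_pdf 0 1) (- x * normal_pdf 0 1 x).
  rewrite (_ : normal_pdf 0 1 = fun y => normal_peak 1 * expR (- (y ^+ 2 / 2))).
    apply: is_derive_eq (is_deriveZ (normal_peak 1) H4) _.
    by rewrite /GRing.scale /=; ring.
  by apply/funext => y; rewrite normal_pdf01E.
apply: is_derive_eq (is_deriveM H2 H5) _.
by rewrite /GRing.scale /=; ring.
Qed.

Lemma is_derive_cosM (x a : R) :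
  is_derive a (1:R) (fun b : R => cos (b * x)) (- (x * sin (a * x))).
Proof.
have H1 : is_derive a (1:R) (fun b : R => b * x) x.
  by apply: is_derive_eq; rewrite /GRing.scale /= mulr0 add0r mulr1.
have H := @is_derive1_comp R cos _ _ _ _ (is_derive_cos _) H1.
by apply: is_derive_eq H _; rewrite mulNr mulrC.
Qed.

Lemma measurable_cosM (a : R) : measurable_fun setT (fun x : R => cos (a * x)).
Proof.
by apply: measurableT_comp => //; apply: continuous_measurable_fun; exact: continuous_cos.
Qed.

Lemma measurable_sinM (a : R) : measurable_fun setT (fun x : R => sin (a * x)).
Proof.
by apply: measurableT_comp => //; apply: continuous_measurable_fun; exact: continuous_sin.
Qed.

Let F (a : R) : R := \int[mu]_x (cos (a * x) * normal_pdf 0 1 x).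

Let integrable_bdd (f : R -> R) : measurable_fun setT f ->
  (forall x, `|f x| <= 1) ->
  mu.-integrable setT (EFin \o (fun x : R => f x * normal_pdf 0 1 x)).
Proof.
move=> mf f1; apply: le_integrable (integrable_normal_pdf 0 1) => //.
  apply/measurable_EFinP; apply: measurable_funM => //.
  exact: measurable_normal_pdf.
move=> x _ /=; rewrite lee_fin normrM ler_piMl//.
Qed.

Let integrable_idbdd (f : R -> R) : measurable_fun setT f ->
  (forall x, `|f x| <= 1) ->
  mu.-integrable setT (EFin \o (fun x : R => x * f x * normal_pdf 0 1 x)).
Proof.
move=> mf f1; apply: le_integrable integrable_id_normal_pdf => //.
  apply/measurable_EFinP; apply: measurable_funM; first exact: measurable_funM.
  exact: measurable_normal_pdf.
move=> x _ /=; rewrite lee_fin !normrM normr_id ler_wpM2r//.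
by rewrite ler_piMr.
Qed.

(** The end points n and -n are treated at once through [u], the density being even. From e^y >= 1 +
    y follows e^{-n^2/2} <= 2/(n+1), hence the multiple of the harmonic sequence. *)
Let cvg_sin_normal (a : R) (u : nat -> R) :
  (forall n, normal_pdf 0 1 (u n) = normal_pdf (0 : R) 1 n%:R) ->
  sin (a * u n) * normal_pdf 0 1 (u n) @[n --> \oo] --> 0.
Proof.
move=> uE; apply: norm_cvg0.
apply: (@squeeze_cvgr _ _ _ _ (cst 0)
    (fun n => (normal_peak 1 * 2) * (@harmonic R) n)); last 2 first.
- exact: cvg_cst.
- rewrite -(mulr0 (normal_peak 1 * 2)); apply: cvgM; first exact: cvg_cst.
  exact: cvg_harmonic.
apply: nearW => n /=; rewrite normr_ge0 normrM/=.
apply: le_trans (ler_piMl _ (sin_max _)) _ => //.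
rewrite uE ger0_norm ?normal_pdf_ge0// normal_pdf01E -mulrA.
rewrite ler_pM2l ?normal_peak_gt0 ?oner_eq0// expRN.
rewrite -(invrK 2) -invfM lef_pV2 ?posrE ?expR_gt0//.
apply: le_trans (expR_ge1Dx _).
have n0 : 0 <= n%:R :> R by [].
have : (n%:R : R) <= n%:R ^+ 2.
  by rewrite -natrX ler_nat; case: (n) => // k; rewrite -mulnn leq_pmulr.
by rewrite -(natr1 n) invrK => h; lra.
Qed.

(** Integration by parts: the density phi satisfies x phi(x) = -phi'(x), and the derivative of
    sin(ax) phi(x) has total integral 0. *)
Let normal_by_parts (a : R) :
  \int[mu]_x (x * sin (a * x) * normal_pdf 0 1 x) = a * F a.
Proof.
have I1 := integrable_bdd (measurable_cosM a) (fun x => cos_max (a * x)).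
have I2 := integrable_idbdd (measurable_sinM a) (fun x => sin_max (a * x)).
have I3 : mu.-integrable setT
    (EFin \o (fun x => a * (cos (a * x) * normal_pdf 0 1 x))).
  exact: (integrableZl measurableT a I1).
apply/esym/eqP; rewrite -subr_eq0; apply/eqP.
rewrite -(RintegralZl a measurableT I1) -(RintegralB measurableT I3 I2).
apply: Rintegral_derivative0.
- move=> x; exact: is_derive_sin_normal.
- have cp : continuous (normal_pdf (0:R) 1).
    by apply: continuous_normal_pdf; exact: oner_neq0.
  have cl : continuous (fun x : R => a * x) by move=> x; exact: mulrl_continuous.
  move=> x; apply: cvgB; apply: cvgM.
  + exact: cvg_cst.
  + apply: cvgM; last exact: cp.
    apply: (@continuous_comp _ _ _ (fun x => a * x) cos); first exact: cl.
    exact: continuous_cos.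
  + apply: cvgM; first exact: cvg_id.
    apply: (@continuous_comp _ _ _ (fun x => a * x) sin); first exact: cl.
    exact: continuous_sin.
  + exact: cp.
- exact: (integrableB measurableT I3 I2).
- by apply: cvg_sin_normal.
- by apply: cvg_sin_normal => n; rewrite !normal_pdf01E sqrrN.
Qed.

(** Differentiation under the integral sign, dominated by |y| phi(y); integrating by parts then
    closes this into a linear differential equation for [F]. *)
Let derivable_F (a : R) : is_derive a (1 : R) F (- (a * F a)).
Proof.
have aI : a \in `](a - 1), (a + 1)[ by rewrite in_itv/=; apply/andP; split; lra.
have d1 (x y : R) : is_derive x (1:R) (fun b => cos (b * y) * normal_pdf 0 1 y)
    (- (y * sin (x * y) * normal_pdf 0 1 y)).
  rewrite (_ : (fun b => _) = normal_pdf 0 1 y \*: (fun b => cos (b * y))); last first.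
    by apply/funext => b /=; rewrite mulrC.
  apply: is_derive_eq (is_deriveZ _ (is_derive_cosM y x)) _.
  by rewrite /GRing.scale /=; ring.
have H1 (x : R) : [set x | x \in `](a - 1), (a + 1)[] x -> mu.-integrable setT
   (EFin \o (fun y => cos (x * y) * normal_pdf 0 1 y)).
  by move=> _; apply: integrable_bdd (measurable_cosM x) (fun y => cos_max (x * y)).
have H2 (x y : R) : [set x | x \in `](a - 1), (a + 1)[] x -> setT y ->
   derivable (fun b : R => cos (b * y) * normal_pdf 0 1 y) x 1.
  by move=> _ _; have [] := d1 x y.
have E (x y : R) : partial1of2 (fun b y : R => cos (b * y) * normal_pdf 0 1 y) x y =
    - (y * sin (x * y) * normal_pdf 0 1 y).
  by rewrite partial1of2E; have := d1 x y => -[].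
have H3 (y : R) : 0 <= `|y| * normal_pdf 0 1 y.
  by rewrite mulr_ge0// normal_pdf_ge0.
have H4 (x y : R) : [set x | x \in `](a - 1), (a + 1)[] x -> setT y ->
   `|partial1of2 (fun b y : R => cos (b * y) * normal_pdf 0 1 y) x y| <=
     `|y| * normal_pdf 0 1 y.
  move=> _ _; rewrite E normrN 2!normrM (ger0_norm (normal_pdf_ge0 _ _ _)).
  by rewrite ler_wpM2r ?normal_pdf_ge0// ler_piMr// sin_max.
apply: DeriveDef.
  exact: (derivable_under_integral measurableT aI H1 H2 H3 integrable_id_normal_pdf H4).
rewrite -derive1E.
rewrite (differentiation_under_integral measurableT aI H1 H2 H3 integrable_id_normal_pdf H4).
under eq_Rintegral do rewrite E -mulN1r.
rewrite RintegralZl//; last first.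
  exact: integrable_idbdd (measurable_sinM a) (fun x => sin_max (a * x)).
by rewrite normal_by_parts mulN1r.
Qed.

(** Since F' = -aF and F(0) = 1, the product F(b) e^{b^2/2} has zero derivative and is the constant
    1. *)
Lemma Rintegral_normal_cos (a : R) :
  \int[normal_prob 0 1]_x cos (a * x) = expR (- (a ^+ 2 / 2)).
Proof.
rewrite Rintegral_normal; last exact: measurable_cosM.
rewrite -/(F a).
have D (x : R) : is_derive x (1:R) (fun b => F b * expR (b ^+ 2 / 2)) 0.
  have H1 : is_derive x (1:R) (fun y : R => y ^+ 2 / 2) x.
    by apply: is_derive_eq; rewrite /GRing.scale /=; lra.
  have H2 : is_derive x (1:R) (fun y : R => expR (y ^+ 2 / 2)) (expR (x ^+ 2 / 2) * x).
    exact: is_derive1_comp.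
  apply: is_derive_eq (is_deriveM (derivable_F x) H2) _.
  by rewrite /GRing.scale /=; ring.
have := is_derive_0_is_cst a 0 D; rewrite expr0n /= mul0r expR0 mulr1.
have -> : F 0 = 1.
  rewrite /F; under eq_Rintegral do rewrite mul0r cos0 mul1r.
  by rewrite /Rintegral integral_normal_pdf.
move=> FE; apply: (mulIf (lt0r_neq0 (expR_gt0 (a ^+ 2 / 2)))).
by rewrite FE -expRD addNr expR0.
Qed.

(* Stated for nonnegative continuous functions because of the change of
   variables formula of the library. *)
Lemma ge0_integral_normal_scale (m s : R) (f : R -> R) : 0 < s ->
  continuous f -> (forall x, 0 <= f x) ->
  (\int[normal_prob m s]_x (f x)%:E = \int[normal_prob 0 1]_x (f (m + s * x)%R)%:E)%E.
Proof.
move=> s0 cf f0.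
have cg : continuous (fun x => m + s * x).
  by move=> x; apply: (@cvgD _ R^o); [exact: cvg_cst|exact: mulrl_continuous].
have mf := continuous_measurable_fun cf.
have mfg : measurable_fun setT (fun x => f (m + s * x)).
  exact: (measurableT_comp mf (continuous_measurable_fun cg)).
rewrite (@ge0_integral_density _ _ _ mu (normal_prob m s) _ _ (measurable_normal_pdf m s) (normal_pdf_ge0 m s)
  (fun A _ => erefl (normal_prob m s A))); last 2 first.
- exact/measurable_EFinP.
- by move=> x; rewrite lee_fin.
rewrite (@ge0_integral_density _ _ _ mu (normal_prob 0 1) _ _ (measurable_normal_pdf 0 1) (normal_pdf_ge0 0 1)
  (fun A _ => erefl (normal_prob 0 1 A))); last 2 first.
- exact/measurable_EFinP.
- by move=> x; rewrite lee_fin.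
have sN0 : s != 0 by rewrite gt_eqF.
pose g (x : R) : R := m + s * x.
have dg x : is_derive x (1 : R) g s.
  apply: is_derive_eq.
  by rewrite add0r mul1r /GRing.scale/= mulr1.
have g'E : (g^`())%classic = cst s.
  by apply/funext => x; rewrite derive1E; have := dg x => -[].
under eq_integral do rewrite -EFinM.
under [RHS]eq_integral do rewrite -EFinM.
rewrite (@increasing_ge0_integration_by_substitutionT _ g)//.
- apply: eq_integral => x _; rewrite !fctE g'E /g; congr EFin.
  rewrite -mulrA; congr (_ * _).
  rewrite normal_pdf01E normal_pdfE//.
  have -> : normal_peak s = normal_peak 1 / s.
    rewrite /normal_peak expr1n mul1r -mulrnAr sqrtrM ?sqr_ge0//.
    by rewrite sqrtr_sqr gtr0_norm// invfM mulrC.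
  rewrite mulrAC divfK//; congr (_ * _).
  rewrite /normal_fun; congr expR.
  by field.
- by move=> x y xy; rewrite /g ltrD2l ltr_pM2l.
- by rewrite g'E => x; exact: cvg_cst.
- by rewrite g'E; exact: is_cvg_cst.
- by rewrite g'E; exact: is_cvg_cst.
- exact: (cvg_comp (fun x : R => s * x) (fun y : R => m + y)
    (gt0_cvgMrNy s0 cvg_id) (@cvg_addrl_Ny _ m)).
- exact: (cvg_comp (fun x : R => s * x) (fun y : R => m + y)
    (gt0_cvgMry s0 cvg_id) (@cvg_addrl _ m)).
- move=> x; apply: cvgM; first exact: cf.
  exact: continuous_normal_pdf.
- by move=> x; rewrite mulr_ge0// normal_pdf_ge0.
Qed.

End normal.

(** * Gaussian smoothing and uniqueness of laws *)

Section smoothing.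
Context {R : realType}.
Variables (f : R -> R) (M : R).
Hypotheses (cf : continuous f) (f0 : forall x, 0 <= f x)
  (fM : forall x, f x <= M).

(** This is the convolution of [f] with N(0, s^2), written as a mean over one fixed standard normal
    law so that the limit as s tends to 0 is taken pointwise under the integral. *)
Definition gauss_smooth (s x : R) : R := \int[normal_prob 0 1]_z f (x + s * z).

Let mf : measurable_fun setT f. Proof. exact: continuous_measurable_fun. Qed.

Let f_norm x : `|f x| <= M. Proof. by rewrite ger0_norm. Qed.

Let mfD (s : R) : measurable_fun setT (fun p : R * R => f (p.1 + s * p.2)).
Proof.
apply: measurableT_comp => //; apply: measurable_funD => //.
exact: measurable_funM.
Qed.

Let mf2 (s x : R) : measurable_fun setT (fun z : R => f (x + s * z)).
Proof. by apply: measurableT_comp => //; apply: measurable_funD => //; exact: measurable_funM. Qed.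

Lemma measurable_gauss_smooth s : measurable_fun setT (gauss_smooth s).
Proof. exact: (bounded_measurable_Rintegral (normal_prob 0 1) (normal_prob 0 1) (mfD s)). Qed.

Lemma gauss_smooth_norm s x : `|gauss_smooth s x| <= M.
Proof.
exact: (probability_Rintegral_le (normal_prob 0 1) (mf2 s x) (fun z => f_norm (x + s * z))).
Qed.

Lemma cvg_gauss_smooth x : gauss_smooth n.+1%:R^-1 x @[n --> \oo] --> f x.
Proof.
rewrite -[f x](probability_Rintegral_cst (normal_prob 0 1)).
apply: (bounded_cvg_Rintegral (M := M)) => [n|//|n z|].
- exact: mf2.
- exact: f_norm.
apply: aeW => z.
have H : x + n.+1%:R^-1 * z @[n --> \oo] --> x.
  rewrite -[X in _ --> X]addr0; apply: cvgD; first exact: cvg_cst.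
  rewrite -[X in _ --> X](mul0r z); apply: cvgM; last exact: cvg_cst.
  exact: cvg_harmonic.
exact: (cvg_comp _ _ H (@cf x)).
Qed.

(** Moving [x] from the argument of [f] into the density prepares for Tonelli: averaging over a
    random [x] then affects the density only. *)
Lemma gauss_smoothE s x : 0 < s ->
  (gauss_smooth s x)%:E =
  (\int[lebesgue_measure]_a (f a * normal_pdf x s a)%:E)%E.
Proof.
move=> s0; rewrite /gauss_smooth fineK; last first.
  exact: (integrable_fin_num measurableT (bounded_integrable (normal_prob 0 1)
    (mf2 s x) (fun z => f_norm (x + s * z)))).
rewrite -ge0_integral_normal_scale//.
rewrite (@ge0_integral_density _ _ _ lebesgue_measure (normal_prob x s) _ _
  (measurable_normal_pdf x s) (normal_pdf_ge0 x s) (fun A _ => erefl (normal_prob x s A))) //.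
exact/measurable_EFinP.
Qed.

End smoothing.

Section gauss_mixture.
Context {R : realType}.

(** Up to normalisation a Gaussian density is its own Fourier transform, hence a mean of cosines. *)
Lemma normal_pdf_cos (x s a : R) : 0 < s ->
  normal_pdf x s a =
  normal_peak s * \int[normal_prob 0 1]_u cos (s^-1 * (a - x) * u).
Proof.
move=> s0; rewrite Rintegral_normal_cos normal_pdfE ?gt_eqF//.
congr (_ * expR _); rewrite mulNr; congr (- _).
by field; rewrite gt_eqF.
Qed.

Lemma measurable_normal_pdf2 (s : R) : s != 0 ->
  measurable_fun setT (fun p : R * R => normal_pdf p.1 s p.2).
Proof.
move=> s0; under eq_fun do rewrite normal_pdfE//.
apply: measurable_funM => //; apply: measurableT_comp => //.
apply: measurable_funM => //; apply: measurableT_comp => //.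
by apply: measurable_funX; exact: measurable_funB.
Qed.

(** Exchanging the two integrals brings out the mean of cos(b(a - Z)), which is determined by the
    characteristic function of [Z]. *)
Lemma normal_pdf_mean d (T : measurableType d)
    (P : {finite_measure set T -> \bar R}) (Z : T -> R)
    (s a : R) : measurable_fun setT Z -> 0 < s ->
  \int[P]_w normal_pdf (Z w) s a =
  normal_peak s * \int[normal_prob 0 1]_u \int[P]_w cos (s^-1 * u * (a - Z w)).
Proof.
move=> mZ s0.
have mk : measurable_fun setT
    (fun p : T * R => cos (s^-1 * p.2 * (a - Z p.1))).
  apply: (measurableT_comp (continuous_measurable_fun (@continuous_cos R))).
  apply: measurable_funM; first exact: measurable_funM.
  by apply: measurable_funB => //; exact: measurableT_comp.
have kM x y : `|cos (s^-1 * y * (a - Z x))| <= 1 by exact: cos_max.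
rewrite -(bounded_Rintegral_swap P (normal_prob 0 1) mk kM).
have mk1 := bounded_measurable_Rintegral P (normal_prob 0 1) mk kM.
rewrite -RintegralZl//; last first.
  apply: (bounded_integrable P (M := 1)) => // w.
  have mkw : measurable_fun setT (fun u => cos (s^-1 * u * (a - Z w))).
    exact: (measurableT_comp mk (pair1_measurable w)).
  exact: (probability_Rintegral_le (normal_prob 0 1) mkw (kM w)).
apply: eq_Rintegral => w _; rewrite normal_pdf_cos//; congr (_ * _).
by apply: eq_Rintegral => u _; congr cos; ring.
Qed.

End gauss_mixture.

Section charfun_uniqueness.
Context d1 d2 (T1 : measurableType d1) (T2 : measurableType d2) (R : realType).
Variables (P1 : probability T1 R) (P2 : probability T2 R).
Variables (X : T1 -> R) (Y : T2 -> R).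
Hypotheses (mX : measurable_fun setT X) (mY : measurable_fun setT Y).
Hypothesis cosE :
  forall u, \int[P1]_w cos (u * X w) = \int[P2]_w cos (u * Y w).
Hypothesis sinE :
  forall u, \int[P1]_w sin (u * X w) = \int[P2]_w sin (u * Y w).

Let cos_shift d (T : measurableType d) (P : probability T R) (Z : T -> R)
    (b c : R) : measurable_fun setT Z ->
  \int[P]_w cos (b * (c - Z w)) =
  cos (b * c) * \int[P]_w cos (b * Z w) + sin (b * c) * \int[P]_w sin (b * Z w).
Proof.
move=> mZ.
have mc : measurable_fun setT (fun w => cos (b * Z w)).
  exact: measurableT_comp (measurable_cosM b) mZ.
have ms : measurable_fun setT (fun w => sin (b * Z w)).
  exact: measurableT_comp (measurable_sinM b) mZ.
have ic := bounded_integrable P mc (fun w => cos_max (b * Z w)).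
have is_ := bounded_integrable P ms (fun w => sin_max (b * Z w)).
rewrite -(RintegralZl _ measurableT ic) -(RintegralZl _ measurableT is_).
rewrite -RintegralD//; [|exact: (integrableZl measurableT _ ic)
  |exact: (integrableZl measurableT _ is_)].
by apply: eq_Rintegral => w _; rewrite mulrBr cosB.
Qed.

Let pdf_meanE (s a : R) : 0 < s ->
  \int[P1]_w normal_pdf (X w) s a = \int[P2]_w normal_pdf (Y w) s a.
Proof.
move=> s0; rewrite !normal_pdf_mean//; congr (_ * _); apply: eq_Rintegral => u _.
by rewrite !cos_shift// cosE sinE.
Qed.

(** Tonelli separates [f] from the law of [Z], which enters only through averaged Gaussian
    densities; these agree for both variables by [pdf_meanE]. *)
Let smooth_mean d (T : measurableType d) (P : probability T R) (Z : T -> R)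
    (s M : R) (f : R -> R) : measurable_fun setT Z -> 0 < s ->
  continuous f -> (forall x, 0 <= f x) -> (forall x, f x <= M) ->
  (\int[P]_w (gauss_smooth f s (Z w))%:E =
   \int[lebesgue_measure]_a ((f a)%:E * (\int[P]_w normal_pdf (Z w) s a)%:E))%E.
Proof.
move=> mZ s0 cf f0 fM.
have mf := continuous_measurable_fun cf.
under eq_integral do rewrite (gauss_smoothE cf f0 fM)//.
have mp : measurable_fun setT (fun p : T * R => normal_pdf (Z p.1) s p.2).
  have mZ2 : measurable_fun setT (fun p : T * R => (Z p.1, p.2)).
    by apply: measurable_fun_pair => //=; exact: measurableT_comp.
  exact: (measurableT_comp (measurable_normal_pdf2 (lt0r_neq0 s0)) mZ2).
have mfp : measurable_fun setT (fun p : T * R => (f p.2 * normal_pdf (Z p.1) s p.2)%:E).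
  apply/measurable_EFinP; apply: measurable_funM => //; exact: measurableT_comp.
rewrite (@fubini_tonelli _ _ _ _ _ P (@lebesgue_measure R) _ mfp); last first.
  by move=> p; rewrite lee_fin mulr_ge0 ?normal_pdf_ge0.
apply: eq_integral => a _ /=.
have mpa : measurable_fun setT (fun w => normal_pdf (Z w) s a).
  exact: (measurableT_comp mp (pair2_measurable a)).
have ipa : P.-integrable setT (EFin \o (fun w => normal_pdf (Z w) s a)).
  apply: (bounded_integrable P (M := normal_peak s)) => // w.
  by rewrite ger0_norm ?normal_pdf_ge0// normal_pdf_ub// gt_eqF.
rewrite fineK; last exact: (integrable_fin_num measurableT ipa).
by rewrite -integralZl.
Qed.

(* By Fubini, the mean of a Gaussian smoothing of f only depends on the
   characteristic function; let the smoothing parameter tend to 0. *)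
Lemma charfun_eq_bounded_continuous (f : R -> R) (M : R) :
  continuous f -> (forall x, 0 <= f x) -> (forall x, f x <= M) ->
  \int[P1]_w f (X w) = \int[P2]_w f (Y w).
Proof.
move=> cf f0 fM.
have mf := continuous_measurable_fun cf.
have lim d (T : measurableType d) (P : probability T R) (Z : T -> R) :
    measurable_fun setT Z ->
    \int[P]_w gauss_smooth f n.+1%:R^-1 (Z w) @[n --> \oo] -->
    \int[P]_w f (Z w).
  move=> mZ; apply: (bounded_cvg_Rintegral (M := M)) => //.
  - move=> n; apply: measurableT_comp mZ.
    exact: (measurable_gauss_smooth cf f0 fM).
  - exact: measurableT_comp.
  - by move=> n w; exact: gauss_smooth_norm.
  - by apply: aeW => w; exact: (cvg_gauss_smooth cf f0 fM).
have := lim _ _ P1 X mX.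
have -> : (fun n : nat => \int[P1]_w gauss_smooth f n.+1%:R^-1 (X w)) =
          (fun n : nat => \int[P2]_w gauss_smooth f n.+1%:R^-1 (Y w)).
  apply/funext => n; rewrite /Rintegral.
  rewrite (smooth_mean _ _ _ cf f0 fM)//.
  rewrite (smooth_mean _ _ _ cf f0 fM)//.
  by congr fine; apply: eq_integral => a _; rewrite pdf_meanE.
move=> /cvg_unique; apply => //; exact: lim.
Qed.

End charfun_uniqueness.

Section law_uniqueness.
Context d1 d2 (T1 : measurableType d1) (T2 : measurableType d2) (R : realType).
Variables (P1 : probability T1 R) (P2 : probability T2 R).
Variables (X : T1 -> R) (Y : T2 -> R).
Hypotheses (mX : measurable_fun setT X) (mY : measurable_fun setT Y).

(* Piecewise linear functions decreasing to the indicator of [c, +oo[. *)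
Definition ramp (c : R) (n : nat) (x : R) : R :=
  Num.min 1 (Num.max 0 (1 + n%:R * (x - c))).

Lemma ramp_ge0 c n x : 0 <= ramp c n x.
Proof. by rewrite /ramp le_min ler01 le_max lexx. Qed.

Lemma ramp_le1 c n x : ramp c n x <= 1.
Proof. by rewrite /ramp ge_min lexx. Qed.

Lemma continuous_ramp c n : continuous (ramp c n).
Proof.
have c1 : continuous (fun x => 1 + n%:R * (x - c)).
  move=> x; apply: (@cvgD _ R^o); first exact: cvg_cst.
  apply: cvgM; first exact: cvg_cst.
  by apply: (@cvgB _ R^o); [exact: cvg_id|exact: cvg_cst].
have c0 (a : R) : continuous (cst a : R -> R) by move=> x; exact: cvg_cst.
move=> x; exact: (continuous_min (c0 1 x) (continuous_max (c0 0 x) (c1 x))).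
Qed.

Lemma cvg_ramp c x : ramp c n x @[n --> \oo] --> (\1_(`[c, +oo[%classic) x : R).
Proof.
rewrite indicE; have [cx|xc] := leP c x.
  rewrite mem_set ?in_itv/= ?in_itv/= ?cx//.
  apply: cvg_near_cst; apply: nearW => n; rewrite /ramp.
  apply/min_idPl; rewrite le_max; apply/orP; right.
  by rewrite lerDl mulr_ge0// subr_ge0.
rewrite memNset/=; last by rewrite in_itv/= andbT; apply/negP; rewrite -ltNge.
apply: cvg_near_cst; near=> n; rewrite /ramp.
suff -> : Num.max 0 (1 + n%:R * (x - c)) = 0 by apply/min_idPr.
apply/max_idPl.
have : (c - x)^-1 <= n%:R by near: n; exact: nbhs_infty_ger.
rewrite -[(c - x)^-1]mul1r ler_pdivrMr ?subr_gt0//; lra.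
Unshelve. all: by end_near. Qed.

(** The ramps carry the equality over to closed rays by bounded convergence, and closed rays form a
    pi-system that generates the Borel sets. *)
Lemma bounded_continuous_eq_law :
  (forall f : R -> R, continuous f -> (forall x, 0 <= f x) ->
    (forall x, f x <= 1) -> \int[P1]_w f (X w) = \int[P2]_w f (Y w)) ->
  forall B : set R, measurable B -> P1 (X @^-1` B) = P2 (Y @^-1` B).
Proof.
move=> H.
have lim d (T : measurableType d) (P : probability T R) (Z : T -> R) c :
    measurable_fun setT Z ->
    \int[P]_w ramp c n (Z w) @[n --> \oo] --> fine (P (Z @^-1` `[c, +oo[%classic)).
  move=> mZ.
  have mI : measurable (Z @^-1` `[c, +oo[%classic).
    by rewrite -[X in measurable X]setTI; exact: mZ.
  have -> : fine (P (Z @^-1` `[c, +oo[%classic)) =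
      \int[P]_w \1_(Z @^-1` `[c, +oo[%classic) w.
    by rewrite /Rintegral integral_indic// setIT.
  apply: (bounded_cvg_Rintegral (M := 1)) => //.
  - move=> n; apply: measurableT_comp mZ.
    by apply: continuous_measurable_fun; exact: continuous_ramp.
  - by move=> n w; rewrite ger0_norm ?ramp_ge0 ?ramp_le1.
  - by apply: aeW => w; exact: cvg_ramp.
have eqray c : P1 (X @^-1` `[c, +oo[%classic) = P2 (Y @^-1` `[c, +oo[%classic).
  have := lim _ _ P1 X c mX.
  under eq_fun => n do rewrite (H _ (@continuous_ramp c n) (ramp_ge0 c n) (ramp_le1 c n)).
  move=> lim1; have E : fine (P1 (X @^-1` `[c, +oo[%classic)) =
      fine (P2 (Y @^-1` `[c, +oo[%classic)).
    exact: (cvg_unique _ lim1 (lim _ _ P2 Y c mY)).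
  have m1 : measurable (X @^-1` `[c, +oo[%classic).
    by rewrite -[X in measurable X]setTI; exact: mX.
  have m2 : measurable (Y @^-1` `[c, +oo[%classic).
    by rewrite -[X in measurable X]setTI; exact: mY.
  by rewrite -[LHS]fineK ?fin_num_measure// E fineK// fin_num_measure.
pose X' : {mfun T1 >-> R} := MeasurableFun.Pack
  (MeasurableFun.Class (isMeasurableFun.Build _ _ _ _ X mX)).
pose Y' : {mfun T2 >-> R} := MeasurableFun.Pack
  (MeasurableFun.Class (isMeasurableFun.Build _ _ _ _ Y mY)).
move=> B mB; change (distribution P1 X' B = distribution P2 Y' B).
have mE : (measurable : set (set R)) = <<s @RGenCInfty.G R >>.
  exact: RGenCInfty.measurableE.
apply: (measure_unique (@RGenCInfty.G R) (fun k : nat => `[- k%:R, +oo[%classic)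
  mE _ _ _ (distribution P1 X') (distribution P2 Y')) => //.
- move=> _ _ [a ->] [b ->]; exists (Num.max a b).
  by apply/seteqP; split => x /=; rewrite !in_itv/= !andbT ge_max => /andP.
- by move=> k; exists (- k%:R).
- apply/seteqP; split => // x _ /=; exists (Num.bound `|x|) => //=.
  rewrite in_itv/= andbT lerNl (le_trans _ (ltW (archi_boundP _)))//.
  by rewrite -normrN ler_norm.
- by move=> A [c ->]; exact: eqray.
- by move=> k; rewrite (le_lt_trans (probability_le1 _ _)) ?ltry.
Qed.

End law_uniqueness.

Lemma charfun_eq_law d1 d2 (T1 : measurableType d1) (T2 : measurableType d2)
    (R : realType) (P1 : probability T1 R) (P2 : probability T2 R)
    (X : T1 -> R) (Y : T2 -> R) :
  measurable_fun setT X -> measurable_fun setT Y ->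
  (forall u, \int[P1]_w cos (u * X w) = \int[P2]_w cos (u * Y w)) ->
  (forall u, \int[P1]_w sin (u * X w) = \int[P2]_w sin (u * Y w)) ->
  forall B : set R, measurable B -> P1 (X @^-1` B) = P2 (Y @^-1` B).
Proof.
move=> mX mY cosE sinE; apply: bounded_continuous_eq_law => // f cf f0 f1.
exact: (charfun_eq_bounded_continuous mX mY cosE sinE cf f0 f1).
Qed.

Lemma density_measure d (T : measurableType d) (R : realType)
    (mu : {measure set T -> \bar R}) (g : T -> R) :
  (forall x, 0 <= g x) -> measurable_fun setT g ->
  exists nu : {measure set T -> \bar R},
    forall A, nu A = (\int[mu]_(x in A) (g x)%:E)%E.
Proof.
move=> g0 mg.
pose m A := (\int[mu]_(x in A) (g x)%:E)%E.
have m0 : m set0 = 0%E by rewrite /m integral_set0.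
have mge0 A : (0 <= m A)%E.
  by rewrite /m integral_ge0// => x _; rewrite lee_fin.
have madd : semi_sigma_additive m.
  move=> F mF tF mUF; rewrite /m ge0_integral_bigcup//.
  - apply: is_cvg_ereal_nneg_natsum_cond => n _ _.
    by apply: integral_ge0 => x _; rewrite lee_fin.
  - by apply/measurable_EFinP; exact: measurable_funTS.
  - by move=> x _; rewrite lee_fin.
pose m1 := isMeasure.Build _ _ _ m m0 mge0 madd.
pose M : {measure set T -> \bar R} := HB.pack m m1.
by exists M.
Qed.

(** Integrability of the density makes the measure finite, which is what the bounded Fubini lemmas
    ask for. *)
Lemma finite_density_measure d (T : measurableType d) (R : realType)
    (mu : {measure set T -> \bar R}) (g : T -> R) :
  (forall x, 0 <= g x) -> mu.-integrable setT (EFin \o g) ->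
  exists nu : {finite_measure set T -> \bar R},
    forall A, measurable A -> nu A = (\int[mu]_(x in A) (g x)%:E)%E.
Proof.
move=> g0 ig.
have [mg _] := integrableP _ _ _ ig.
have [M ME] := density_measure mu g0 ((measurable_EFinP _ _).1 mg).
have mfin : fin_num_fun M.
  move=> A mA; rewrite ME; apply: integrable_fin_num => //.
  exact: (integrableS measurableT).
have sf : sigma_finite setT M.
  by apply: fin_num_fun_sigma_finite; [rewrite measure0|exact: mfin].
pose H1 := isFinite.Build _ _ _ _ mfin.
pose H2 := isSFinite.Build _ _ _ _ (sfinite_measure_sigma_finite sf).
pose H3 := isSigmaFinite.Build _ _ _ _ sf.
pose M' : {finite_measure set T -> \bar R} :=
  HB.pack_for (FiniteMeasure.type T R) (Measure.sort M) H1 H2 H3.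
by exists M' => A _; exact: ME.
Qed.

(** Adding the constant [M] makes the integrand nonnegative; its mean is [M] on both sides and
    cancels. *)
Lemma Rintegral_normal_scale (R : realType) (m s M : R) (f : R -> R) : 0 < s ->
  continuous f -> (forall x, `|f x| <= M) ->
  \int[normal_prob m s]_x f x = \int[normal_prob 0 1]_x f (m + s * x).
Proof.
move=> s0 cf fM.
have mf := continuous_measurable_fun cf.
have mg : measurable_fun setT (fun x => m + s * x).
  by apply: measurable_funD => //; exact: measurable_funM.
have mfg := measurableT_comp mf mg.
have if1 := bounded_integrable (normal_prob m s) mf fM.
have if2 := bounded_integrable (normal_prob 0 1) mfg (fun x => fM (m + s * x)).
have ic1 : (normal_prob m s).-integrable setT (EFin \o (fun=> M)).
  exact: finite_measure_integrable_cst.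
have ic2 : (normal_prob 0 1).-integrable setT (EFin \o (fun=> M)).
  exact: finite_measure_integrable_cst.
have : \int[normal_prob m s]_x (f x + M) =
       \int[normal_prob 0 1]_x (f (m + s * x) + M).
  rewrite /Rintegral (@ge0_integral_normal_scale R m s (fun x => f x + M) s0)//.
    by move=> x; apply: cvgD; [exact: cf|exact: cvg_cst].
  by move=> x; have := fM x; rewrite ler_norml => /andP[? _]; lra.
rewrite (RintegralD measurableT if1 ic1) (RintegralD measurableT if2 ic2).
rewrite (probability_Rintegral_cst (normal_prob m s)).
by rewrite (probability_Rintegral_cst (normal_prob 0 1)) => /addIr.
Qed.

(** * The Cauchy law and its cosine transform *)

Section cauchy_kernel.
Context {R : realType}.
Notation mu := (@lebesgue_measure R).

(** Unnormalised Laplace density. Its cosine transform 2/(1 + c^2) is elementary, and inverting it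
    yields the transform of the Cauchy law. *)
Let lap (x : R) : R := expR (- `|x|).

Let lap_ge0 x : 0 <= lap x. Proof. exact: expR_ge0. Qed.

Let continuous_lap : continuous lap.
Proof.
move=> x; apply: (@continuous_comp _ _ _ (fun x : R => - `|x|) expR).
  by apply: (@cvgN _ R^o); exact: norm_continuous.
exact: continuous_expR.
Qed.

Let is_derive_expN (x : R) : is_derive x (1 : R) (fun y : R => expR (- y)) (- expR (- x)).
Proof.
have H : is_derive x (1 : R) (fun y : R => - y) (- 1) by exact: is_deriveNid.
by apply: is_derive_eq (is_derive1_comp (is_derive_expR _) H) _; rewrite mulrN1.
Qed.

Let is_derive_sinM (c x : R) :
  is_derive x (1 : R) (fun y : R => sin (c * y)) (c * cos (c * x)).
Proof.
have H : is_derive x (1:R) (fun y : R => c * y) c.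
  by apply: is_derive_eq; rewrite scaler1.
by apply: is_derive_eq (is_derive1_comp (is_derive_sin _) H) _; rewrite mulrC.
Qed.

Let is_derive_cosM' (c x : R) :
  is_derive x (1 : R) (fun y : R => cos (c * y)) (- (c * sin (c * x))).
Proof.
have H : is_derive x (1:R) (fun y : R => c * y) c.
  by apply: is_derive_eq; rewrite scaler1.
by apply: is_derive_eq (is_derive1_comp (is_derive_cos _) H) _; rewrite mulNr mulrC.
Qed.

(** An antiderivative of (1 + cos(cx)) e^{-x}. The added 1 keeps the integrand nonnegative for the
    fundamental theorem on a half-line; comparison with c = 0 removes it afterwards. *)
Let prim (c x : R) : R :=
  expR (- x) * ((c * sin (c * x) - cos (c * x)) / (1 + c ^+ 2) - 1).

Let is_derive_prim c x :
  is_derive x (1 : R) (prim c) ((1 + cos (c * x)) * expR (- x)).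
Proof.
have N0 : 1 + c ^+ 2 != 0 by rewrite gt_eqF// ltr_pwDl// sqr_ge0.
have H1 : is_derive x (1:R) (fun y : R => c * sin (c * y)) (c * (c * cos (c * x))).
  exact: is_deriveZ.
have H2 := is_deriveB H1 (is_derive_cosM' c x).
have H3 : is_derive x (1 : R)
    (fun y : R => (1 + c ^+ 2)^-1 * (c * sin (c * y) - cos (c * y)))
    ((1 + c ^+ 2)^-1 * (c * (c * cos (c * x)) - - (c * sin (c * x)))).
  exact: is_deriveZ.
have H4 : is_derive x (1 : R)
    (fun y : R => (1 + c ^+ 2)^-1 * (c * sin (c * y) - cos (c * y)) - 1)
    ((1 + c ^+ 2)^-1 * (c * (c * cos (c * x)) - - (c * sin (c * x)))).
  by apply: is_derive_eq; rewrite oppr0 addr0.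
have H5 := is_deriveM (is_derive_expN x) H4.
have -> : prim c = (fun y : R => expR (- y)) *
  (fun y : R => (1 + c ^+ 2)^-1 * (c * sin (c * y) - cos (c * y)) - 1).
  by apply/funext => y; rewrite /prim [in LHS](mulrC _ (_^-1)).
by apply: is_derive_eq H5 _; rewrite /GRing.scale/=; field.
Qed.

Let cvg_prim c : prim c x @[x --> +oo] --> 0.
Proof.
pose B : R := `|c| + 2.
have BP x : `|(c * sin (c * x) - cos (c * x)) / (1 + c ^+ 2) - 1| <= B.
  have N1 : 1 <= 1 + c ^+ 2 by rewrite lerDl sqr_ge0.
  apply: le_trans (ler_normB _ _) _; rewrite normr1 /B.
  suff : `|(c * sin (c * x) - cos (c * x)) / (1 + c ^+ 2)| <= `|c| + 1 by lra.
  rewrite normrM normfV (ger0_norm (le_trans ler01 N1)).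
  rewrite ler_pdivrMr ?(lt_le_trans ltr01 N1)//.
  apply: (@le_trans _ _ (`|c| + 1)); last by rewrite ler_peMr// addr_ge0.
  apply: le_trans (ler_normB _ _) _; apply: lerD; last exact: cos_max.
  by rewrite normrM ler_piMr// sin_max.
apply/norm_cvg0P; apply: (@squeeze_cvgr _ _ _ _ (cst 0) (fun x => expR (- x) * B)).
- apply: nearW => x; rewrite normr_ge0/= normrM ger0_norm ?expR_ge0//.
  by rewrite ler_wpM2l ?expR_ge0.
- exact: cvg_cst.
- rewrite -[X in _ --> X](mul0r B); apply: cvgM; last exact: cvg_cst.
  exact: cvgr_expR.
Qed.

Let integral_cos1_lap c :
  (\int[mu]_x ((1 + cos (c * x)) * lap x)%:E =
   (2 * (1 + (1 + c ^+ 2)^-1))%:E)%E.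
Proof.
have c0 x : 0 <= 1 + cos (c * x) by have := cos_geN1 (c * x); lra.
have cc : continuous (fun x : R => 1 + cos (c * x)).
  move=> x; apply: (@cvgD _ R^o); first exact: cvg_cst.
  apply: (@continuous_comp _ _ _ (fun x : R => c * x) cos).
    exact: mulrl_continuous.
  exact: continuous_cos.
rewrite ge0_symfun_integralT; last 3 first.
- by move=> x; rewrite mulr_ge0.
- by move=> x; apply: cvgM; [exact: cc|exact: continuous_lap].
- by move=> x /=; rewrite /lap normrN mulrN cosN.
rewrite -set_itvcy EFinM; congr (_ * _)%E.
transitivity (\int[mu]_(x in `[0%R, +oo[) ((1 + cos (c * x)) * expR (- x))%:E)%E.
  apply: eq_integral => x; rewrite inE/= in_itv/= andbT /lap => x0.
  by rewrite ger0_norm.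
rewrite (@ge0_continuous_FTC2y _ _ (prim c) 0 0).
- rewrite sub0e -EFinN; congr EFin; rewrite /prim oppr0 expR0 mulr0 sin0 cos0.
  by field; rewrite gt_eqF// ltr_pwDl// sqr_ge0.
- by move=> x _; rewrite mulr_ge0 ?expR_ge0.
- apply: continuous_subspaceT => x; apply: cvgM; first exact: cc.
  suff : continuous (fun y : R => expR (- y)) by apply.
  by apply: derivable1_continuous => y; have [] := is_derive_expN y.
- exact: cvg_prim.
- by move=> x _; have [] := is_derive_prim c x.
- apply: cvg_at_right_filter.
  suff : continuous (prim c) by apply.
  by apply: derivable1_continuous => y; have [] := is_derive_prim c y.
- by move=> x _; rewrite derive1E; have [] := is_derive_prim c x.
Qed.

Let integrable_lap : mu.-integrable setT (EFin \o lap).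
Proof.
have ml := continuous_measurable_fun continuous_lap.
apply/integrableP; split; first exact/measurable_EFinP.
under eq_integral do rewrite /= ger0_norm//.
have H := integral_cos1_lap 0.
apply: (@le_lt_trans _ _ (\int[mu]_x ((1 + cos (0 * x)) * lap x)%:E)%E); last first.
  by rewrite H ltry.
apply: ge0_le_integral => //.
- by move=> x _; rewrite lee_fin.
- exact/measurable_EFinP.
- apply/measurable_EFinP; apply: measurable_funM => //.
  by apply: measurable_funD => //; exact: measurable_cosM.
- by move=> x _; rewrite lee_fin mul0r cos0; have := lap_ge0 x; lra.
Qed.

(** At c = 0 the two summands coincide, which gives the integral of [lap]; subtracting it leaves the
    cosine part. *)
Let Rintegral_cos_lap c :
  \int[mu]_x (cos (c * x) * lap x) = 2 / (1 + c ^+ 2).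
Proof.
have aux1 (y : R) : y + y = 2 * (1 + 1) -> y = 2 by lra.
have aux2 (y z : R) : 2 + y = 2 * (1 + z) -> y = 2 * z by lra.
have ml := continuous_measurable_fun continuous_lap.
have icl b : mu.-integrable setT (EFin \o (fun x : R => cos (b * x) * lap x)).
  apply: le_integrable integrable_lap => //.
    by apply/measurable_EFinP; apply: measurable_funM => //; exact: measurable_cosM.
  by move=> x _ /=; rewrite lee_fin normrM ler_piMl// cos_max.
have E b : \int[mu]_x lap x + \int[mu]_x (cos (b * x) * lap x) =
    2 * (1 + (1 + b ^+ 2)^-1).
  rewrite -(RintegralD measurableT integrable_lap (icl b)).
  rewrite -[RHS]/(fine (2 * (1 + (1 + b ^+ 2)^-1))%:E) -integral_cos1_lap.
  by congr fine; apply: eq_integral => x _; rewrite mulrDl mul1r.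
have E0 : \int[mu]_x lap x = 2.
  have := E 0; rewrite expr0n/= addr0 invr1.
  under [X in _ + X = _ -> _]eq_Rintegral do rewrite mul0r cos0 mul1r.
  exact: aux1.
by have := E c; rewrite E0 => /aux2.
Qed.

Let cauchy (u : R) : R := (pi * oneDsqr u)^-1.

Let cauchy_ge0 u : 0 <= cauchy u.
Proof. by rewrite invr_ge0 mulr_ge0 ?pi_ge0// (le_trans ler01)// oneDsqr_ge1. Qed.

Let measurable_cauchy : measurable_fun setT cauchy.
Proof.
rewrite (_ : cauchy = fun u => pi^-1 * (oneDsqr u)^-1).
  apply: measurable_funM => //; apply: continuous_measurable_fun.
  exact: continuous_oneDsqrV.
by apply/funext => u; rewrite /cauchy invfM.
Qed.

Let integrable_cauchy : mu.-integrable setT (EFin \o cauchy).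
Proof.
suff H : mu.-integrable setT (EFin \o (fun u : R => (oneDsqr u)^-1)).
  have := integrableZl measurableT pi^-1 H; apply: eq_integrable => // u _ /=.
  by rewrite /cauchy invfM EFinM.
have mo := continuous_measurable_fun (@continuous_oneDsqrV R).
have o0 (x : R) : 0 <= (oneDsqr x)^-1.
  by rewrite invr_ge0 (le_trans ler01)// oneDsqr_ge1.
apply/integrableP; split; first exact/measurable_EFinP.
under eq_integral do rewrite /= ger0_norm//.
rewrite (@ge0_symfun_integralT _ (fun u : R => (oneDsqr u)^-1))//; last 2 first.
- exact: continuous_oneDsqrV.
- by move=> x /=; rewrite /oneDsqr sqrrN.
by rewrite -set_itvcy integral0y_oneDsqr -EFinM ltry.
Qed.

(** Fourier inversion with Gaussian damping. The smoothed function is a mean of Gaussian densities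
    under the measure with density [lap], hence a mean of cosines, and the cosine transform of [lap]
    produces 1/(1 + v^2). Adding the values at a and -a cancels the sine terms. *)
Let smooth_lap (s a : R) : 0 < s ->
  gauss_smooth lap s a + gauss_smooth lap s (- a) =
  2 * \int[mu]_u (cos (a * u) * expR (- ((s * u) ^+ 2 / 2)) * cauchy u).
Proof.
move=> s0.
have sN0 : s != 0 by rewrite gt_eqF.
have lap_le1 x : lap x <= 1 by rewrite -expR0 ler_expR oppr_le0.
have [lam lamE] := @finite_density_measure _ (measurableTypeR R) R mu lap lap_ge0 integrable_lap.
have ml := continuous_measurable_fun continuous_lap.
have lamD (f : R -> R) : measurable_fun setT f ->
    \int[lam]_x f x = \int[mu]_x (f x * lap x).
  by move=> mf; exact: (@integral_density _ (measurableTypeR R) R mu lam lap f ml lap_ge0 lamE mf).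
have smE b : gauss_smooth lap s b = \int[lam]_x normal_pdf x s b.
  rewrite lamD; last first.
    exact: (measurableT_comp (measurable_normal_pdf2 (lt0r_neq0 s0)) (pair2_measurable b)).
  have /(congr1 fine) /= -> := gauss_smoothE continuous_lap lap_ge0 lap_le1 b s0.
  congr fine; apply: eq_integral => x _; rewrite mulrC; congr ((_ * _)%:E).
  rewrite 2!(normal_pdfE _ sN0) /normal_fun.
  by rewrite -(sqrrN (b - x)) opprB.
pose N : probability (measurableTypeR R) R := normal_prob 0 1.
pose I b u := \int[lam]_w cos (s^-1 * u * (b - w)).
have I1 b u w : `|cos (s^-1 * u * (b - w))| <= 1 by exact: cos_max.
have mc := continuous_measurable_fun (@continuous_cos R).
have mcb b : measurable_fun setT
    (fun z : measurableTypeR R * measurableTypeR R => cos (s^-1 * z.1 * (b - z.2))).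
  apply: (measurableT_comp mc); apply: measurable_funM; first exact: measurable_funM.
  exact: measurable_funB.
have mcbu b u : measurable_fun setT (fun w : measurableTypeR R => cos (s^-1 * u * (b - w))).
  exact: (measurableT_comp (mcb b) (pair1_measurable u)).
have mI b : measurable_fun setT (I b).
  exact: (bounded_measurable_Rintegral N lam (mcb b) (I1 b)).
have iI b : N.-integrable setT (EFin \o I b).
  have H u := @bounded_Rintegral_le _ (measurableTypeR R) R lam _ 1 (mcbu b u) (I1 b u).
  exact: (bounded_integrable N (mI b) H).
(* The sum over a and -a is 2 cos(av) times the transform 2/(1 + v^2), taken at v = u/s. *)
pose h (v : R) : R := 4 * cos (a * v) / (1 + v ^+ 2).
have sumI u : I a u + I (- a) u = h (0 + s^-1 * u).
  rewrite /I -(RintegralD measurableT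
    (bounded_integrable lam (mcbu a u) (I1 a u))
    (bounded_integrable lam (mcbu (- a) u) (I1 (- a) u))).
  pose k := s^-1 * u.
  transitivity (\int[lam]_w (2 * cos (k * a) * cos (k * w))).
    apply: eq_Rintegral => w _; rewrite -/k !mulrBr mulrN -(opprD (k * a)) cosN.
    by rewrite cosB cosD; ring.
  rewrite RintegralZl//; last first.
    apply: (bounded_integrable lam (measurable_cosM k)) => w.
    exact: cos_max.
  rewrite lamD; last exact: measurable_cosM.
  by rewrite Rintegral_cos_lap /h add0r -/k (mulrC a); ring.
rewrite !smE.
rewrite (normal_pdf_mean lam a (@measurable_id _ (measurableTypeR R) setT) s0).
rewrite (normal_pdf_mean lam (- a) (@measurable_id _ (measurableTypeR R) setT) s0).
rewrite -mulrDr -(RintegralD measurableT (iI a) (iI (- a))).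
under eq_Rintegral do rewrite sumI.
have h_le v : `|h v| <= 4.
  have N1 : 1 <= 1 + v ^+ 2 by rewrite lerDl sqr_ge0.
  rewrite /h normrM normfV (ger0_norm (le_trans ler01 N1)).
  rewrite ler_pdivrMr ?(lt_le_trans ltr01 N1)// normrM ger0_norm//.
  by rewrite ler_pM2l// (le_trans (cos_max _)).
have ch : continuous h.
  have H : continuous (fun v => 4 * cos (a * v)).
    move=> v; apply: cvgM; first exact: cvg_cst.
    apply: (@continuous_comp _ _ _ (fun x : R => a * x) cos).
      exact: mulrl_continuous.
    exact: continuous_cos.
  by move=> v; apply: cvgM; [exact: H|exact: continuous_oneDsqrV].
have mh := continuous_measurable_fun ch.
have si0 : 0 < s^-1 by rewrite invr_gt0.
have siN0 : s^-1 != 0 by rewrite gt_eqF.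
rewrite -(Rintegral_normal_scale 0 si0 ch h_le).
rewrite (Rintegral_normal 0 s^-1 mh).
have i1 : mu.-integrable setT (EFin \o (fun v => h v * normal_pdf 0 s^-1 v)).
  apply: le_integrable (integrableZl measurableT 4 (integrable_normal_pdf 0 s^-1)) => //.
    apply/measurable_EFinP; apply: measurable_funM => //.
    exact: measurable_normal_pdf.
  move=> v _ /=; rewrite lee_fin [leLHS]normrM [leRHS]normrM (ger0_norm (ler0n _ 4)).
  by apply: ler_wpM2r => //; exact: h_le.
have mk : measurable_fun setT (fun v : R => cos (a * v) * expR (- ((s * v) ^+ 2 / 2))).
  apply: measurable_funM; first exact: measurable_cosM.
  apply: measurableT_comp => //; apply: measurableT_comp => //.
  apply: measurable_funM => //; apply: measurable_funX.
  exact: measurable_funM.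
have i2 : mu.-integrable setT
    (EFin \o (fun v => cos (a * v) * expR (- ((s * v) ^+ 2 / 2)) * cauchy v)).
  apply: le_integrable integrable_cauchy => //.
    by apply/measurable_EFinP; exact: measurable_funM.
  move=> v _ /=; rewrite lee_fin normrM ler_piMl// normrM.
  rewrite mulr_ile1// ?cos_max// ger0_norm ?expR_ge0// expR_le1 oppr_le0.
  by rewrite divr_ge0// sqr_ge0.
rewrite -(RintegralZl _ measurableT i1) -(RintegralZl _ measurableT i2).
(* The two normalisations multiply to 1/(2 pi), which turns 4/(1 + v^2) into four thirds of nothing
   else than twice the Cauchy density once written as 2/(pi (1 + v^2)). *)
have peakM : normal_peak s * normal_peak s^-1 = (pi * 2)^-1 :> R.
  rewrite /normal_peak -invfM -sqrtrM; last first.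
    by rewrite mulrn_wge0// mulr_ge0 ?sqr_ge0// pi_ge0.
  congr (_^-1); rewrite -[RHS]ger0_norm ?mulr_ge0 ?pi_ge0//.
  rewrite -sqrtr_sqr; congr Num.sqrt.
  have aux (p : R) : s ^+ 2 * p * 2 * (s^-1 ^+ 2 * p * 2) = (p * 2) ^+ 2 by field.
  by rewrite -(mulr_natr (s ^+ 2 * pi)) -(mulr_natr (s^-1 ^+ 2 * pi)) aux.
apply: eq_Rintegral => v _.
rewrite (normal_pdfE _ siN0) /normal_fun subr0 /h /cauchy /oneDsqr.
have -> : - v ^+ 2 / (s^-1 ^+ 2 *+ 2) = - ((s * v) ^+ 2 / 2).
  by rewrite -(mulr_natr (s^-1 ^+ 2)); field.
rewrite mulrCA (mulrA (normal_peak s)) peakM.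
have aux (p q c e : R) : p != 0 -> q != 0 ->
    4 * c / q * ((p * 2)^-1 * e) = 2 * (c * e * (p * q)^-1).
  by move=> p0 q0; field; rewrite p0 q0.
by rewrite aux// gt_eqF ?pi_gt0// ltr_pwDl// sqr_ge0.
Qed.

(** Let s tend to 0 in the damped inversion formula: one side tends to 2 e^{-|a|}, the other to
    twice the Cauchy mean of cos(au). *)
Lemma exists_cauchy_kernel : exists kappa : {finite_measure set (measurableTypeR R) -> \bar R},
  forall a : R, \int[kappa]_u cos (a * u) = expR (- `|a|).
Proof.
have [kap kapE] := @finite_density_measure _ (measurableTypeR R) R mu cauchy cauchy_ge0 integrable_cauchy.
exists kap => a.
have kapD (f : R -> R) : measurable_fun setT f ->
    \int[kap]_x f x = \int[mu]_x (f x * cauchy x).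
  move=> mf; exact: (@integral_density _ (measurableTypeR R) R mu kap cauchy f
    measurable_cauchy cauchy_ge0 kapE mf).
have lap_le1 x : lap x <= 1 by rewrite -expR0 ler_expR oppr_le0.
pose g (n : nat) (u : R) : R := cos (a * u) * expR (- ((n.+1%:R^-1 * u) ^+ 2 / 2)).
have mg n : measurable_fun setT (g n).
  apply: measurable_funM; first exact: measurable_cosM.
  apply: measurableT_comp => //; apply: measurableT_comp => //.
  apply: measurable_funM => //; apply: measurable_funX.
  exact: measurable_funM.
have lim1 : gauss_smooth lap n.+1%:R^-1 a + gauss_smooth lap n.+1%:R^-1 (- a)
    @[n --> \oo] --> lap a + lap (- a).
  by apply: cvgD; exact: (cvg_gauss_smooth continuous_lap lap_ge0 lap_le1).
have lim2 : \int[kap]_u g n u @[n --> \oo] --> \int[kap]_u cos (a * u).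
  apply: (bounded_cvg_Rintegral (M := 1)) => //.
  - exact: measurable_cosM.
  - move=> n u; rewrite normrM mulr_ile1// ?cos_max//.
    rewrite ger0_norm ?expR_ge0// expR_le1 oppr_le0.
    by rewrite divr_ge0// sqr_ge0.
  - apply: aeW => u; rewrite -[X in _ --> X]mulr1.
    apply: cvgM; first exact: cvg_cst.
    have H : - ((n.+1%:R^-1 * u) ^+ 2 / 2) @[n --> \oo] --> (0 : R).
      have H0 : n.+1%:R^-1 * u @[n --> \oo] --> (0 : R).
        rewrite -[X in _ --> X](mul0r u).
        by apply: cvgM; [exact: cvg_harmonic|exact: cvg_cst].
      have H1 : (n.+1%:R^-1 * u) ^+ 2 @[n --> \oo] --> (0 : R) ^+ 2.
        exact: (cvg_comp _ _ H0 (@exprn_continuous R 2 0)).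
      rewrite expr0n/= in H1.
      rewrite -oppr0; apply: cvgN; rewrite -(mul0r 2^-1).
      by apply: cvgM; [exact: H1|exact: cvg_cst].
    have H2 : expR (- ((n.+1%:R^-1 * u) ^+ 2 / 2)) @[n --> \oo] --> expR (0 : R).
      exact: (cvg_comp _ _ H (@continuous_expR R 0)).
    by rewrite expR0 in H2.
have lim3 : 2 * \int[kap]_u g n u @[n --> \oo] --> 2 * \int[kap]_u cos (a * u).
  by apply: cvgM; [exact: cvg_cst|exact: lim2].
have E : (fun n : nat => gauss_smooth lap n.+1%:R^-1 a + gauss_smooth lap n.+1%:R^-1 (- a))
     = (fun n => 2 * \int[kap]_u g n u).
  by apply/funext => n; rewrite smooth_lap// kapD.
have lim4 : 2 * \int[kap]_u g n u @[n --> \oo] --> lap a + lap (- a) by rewrite -E.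
have F : 2 * \int[kap]_u cos (a * u) = lap a + lap (- a).
  exact: (cvg_unique _ lim3 lim4).
have : 2 * \int[kap]_u cos (a * u) = 2 * lap a.
  by rewrite F /lap normrN mulr_natl mulr2n.
by move/mulfI; apply.
Qed.

End cauchy_kernel.

(** * Laplace transform of a subordinator *)

(** Telescoping inside the unit disc. It controls the error made when each of n factors e^{z/n} is
    replaced by 1 + z/n. *)
Lemma normr_exprB_le (F : numDomainType) (x y : F) (m : nat) :
  `|x| <= 1 -> `|y| <= 1 -> `|x ^+ m - y ^+ m| <= `|x - y| *+ m.
Proof.
move=> x1 y1; elim: m => [|m IH]; first by rewrite !expr0 subrr normr0 mulr0n.
have -> : x ^+ m.+1 - y ^+ m.+1 = x * (x ^+ m - y ^+ m) + (x - y) * y ^+ m.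
  by rewrite !exprS; ring.
rewrite mulrS addrC; apply: le_trans (ler_normD _ _) _; apply: lerD.
  by rewrite normrM; apply: le_trans IH; rewrite ler_piMl.
by rewrite normrM normrX ler_piMr// exprn_ile1.
Qed.

(** * Exponentials as limits of complex powers *)

Section complex_powers.
Context {R : realType}.
Implicit Types (x y L : R) (z e : R[i]).

Definition cis (y : R) : R[i] := cos y +i* sin y.

Lemma cisD x y : cis (x + y) = cis x * cis y.
Proof. by rewrite /cis cosD sinD; simpc; congr (_ +i* _); ring. Qed.

Lemma cis_mulrn y m : cis y ^+ m = cis (y *+ m).
Proof.
elim: m => [|m IH]; first by rewrite expr0 mulr0n /cis cos0 sin0.
by rewrite exprS IH mulrS cisD.
Qed.

Lemma normc_le z M : 0 <= M ->
  complex.Re z ^+ 2 + complex.Im z ^+ 2 <= M ^+ 2 -> `|z| <= M%:C.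
Proof.
move=> M0 h; rewrite normc_def lecR -[M]ger0_norm// -sqrtr_sqr.
by rewrite ler_wsqrtr.
Qed.

Lemma norm_cis_le1 y : `|cis y| <= 1.
Proof. by apply: (@normc_le _ 1) => //=; rewrite cos2Dsin2 expr1n. Qed.

Lemma normr_Re_le z M : `|z| <= M%:C -> `|complex.Re z| <= M.
Proof.
rewrite normc_def lecR; apply: le_trans.
by rewrite -sqrtr_sqr ler_wsqrtr// lerDl sqr_ge0.
Qed.

Lemma normc_leD z : `|z| <= (`|complex.Re z| + `|complex.Im z|)%:C.
Proof.
apply: normc_le; first by rewrite addr_ge0.
rewrite sqrrD !real_normK ?num_real//.
by rewrite addrAC lerDl mulrn_wge0// mulr_ge0.
Qed.

(** The last hypothesis places x + iy in the closed disc of radius L centred at -L. Hence 1 + t(x +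
    iy) is a convex combination, with weights 1 - tL and tL, of 1 and a point of the unit disc. *)
Lemma norm_convex_le1 x y L (t : R) : 0 <= t -> 0 <= L -> t * L <= 1 ->
  (x + L) ^+ 2 + y ^+ 2 <= L ^+ 2 ->
  `|(1 + t * x) +i* (t * y)| <= 1.
Proof.
move=> t0 L0 tL h.
have -> : (1 + t * x) +i* (t * y) = (1 - t * L)%:C + t%:C * ((x + L) +i* y).
  by simpc; congr (_ +i* _); ring.
apply: le_trans (ler_normD _ _) _; rewrite normrM.
have H : `|(x + L) +i* y| <= L%:C by apply: normc_le.
have -> : `|(1 - t * L)%:C| = (1 - t * L)%:C by rewrite ger0_norm// ler0c subr_ge0.
have -> : `|t%:C| = t%:C by rewrite ger0_norm// ler0c.
have : t%:C * `|(x + L) +i* y| <= t%:C * L%:C by rewrite ler_wpM2l// ler0c.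
move=> {}H; apply: le_trans (lerD (lexx _) H) _.
by rewrite -rmorphM -rmorphD /= subrK.
Qed.

Lemma cvg_difference_quotient (g : R -> R) (g' : R) :
  is_derive (0 : R) (1 : R) g g' ->
  n.+1%:R * (g n.+1%:R^-1 - g 0) @[n --> \oo] --> g'.
Proof.
move=> [dg gE].
have := dg; rewrite /derivable => /cvg_ex[l /= lP].
have lE : l = g' by rewrite -gE; apply/esym/cvg_lim.
move: lP; rewrite lE => /cvgr_dnbhsP /(_ (fun n => n.+1%:R^-1)).
have H : (forall n : nat, n.+1%:R^-1 != 0 :> R) /\ n.+1%:R^-1 @[n --> \oo] --> (0 : R).
  by split; [move=> n; rewrite invr_eq0 pnatr_eq0|exact: cvg_harmonic].
move=> /(_ H); apply: cvg_trans; apply: near_eq_cvg; apply: nearW => n /=.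
by rewrite invrK scaler1 addr0.
Qed.

(** Let z = x + iy. Since e^z = (e^{z/n})^n and both e^{z/n} and 1 + z/n eventually lie in the unit
    disc, the powers differ by at most n |e^{z/n} - 1 - z/n|, which tends to 0 because e^{tz} has
    derivative z at t = 0. The factor [e] will be e^{iau}. *)
Lemma cvg_expn_exp x y L e : 0 <= L -> (x + L) ^+ 2 + y ^+ 2 <= L ^+ 2 ->
  `|e| <= 1 ->
  complex.Re (e * ((1 + n.+1%:R^-1 * x) +i* (n.+1%:R^-1 * y)) ^+ n.+1)
    @[n --> \oo] --> complex.Re (e * ((expR x)%:C * cis y)).
Proof.
move=> L0 h e1.
pose v (t : R) : R[i] := (expR (t * x))%:C * cis (t * y).
pose w (t : R) : R[i] := (1 + t * x) +i* (t * y).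
(* The disc of radius L centred at -L lies in the left half-plane, so e^{tz} stays in the unit disc
   for t >= 0. *)
have x0 : x <= 0.
  have : (x + L) ^+ 2 <= L ^+ 2 by apply: le_trans h; rewrite lerDl sqr_ge0.
  by move=> h2; rewrite leNgt; apply/negP => x1; clear h; nra.
have v1 t : 0 <= t -> `|v t| <= 1.
  move=> t0; rewrite normrM mulr_ile1// ?norm_cis_le1//.
  rewrite ger0_norm ?ler0c ?expR_ge0//.
  by rewrite lecR expR_le1 mulr_ge0_le0.
have vn n : v n.+1%:R^-1 ^+ n.+1 = (expR x)%:C * cis y.
  rewrite /v exprMn cis_mulrn -rmorphXn /= -expRM_natl.
  rewrite -(mulr_natl (_ * _) n.+1).
  by rewrite !mulrA mulfV ?mul1r// pnatr_eq0.
pose d1 (n : nat) : R := n.+1%:R * (expR (n.+1%:R^-1 * x) * cos (n.+1%:R^-1 * y) - 1) - x.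
pose d2 (n : nat) : R := n.+1%:R * (expR (n.+1%:R^-1 * x) * sin (n.+1%:R^-1 * y)) - y.
have D1 : is_derive (0 : R) (1 : R) (fun t => t * x) x.
  by apply: is_derive_eq; rewrite /GRing.scale /= mulr0 add0r mulr1.
have D2 : is_derive (0 : R) (1 : R) (fun t => t * y) y.
  by apply: is_derive_eq; rewrite /GRing.scale /= mulr0 add0r mulr1.
have D3 : is_derive (0 : R) (1 : R) (fun t : R => expR (t * x)) x.
  apply: is_derive_eq (is_derive1_comp (is_derive_expR _) D1) _.
  by rewrite mul0r expR0 mul1r.
have D4 : is_derive (0 : R) (1 : R) (fun t : R => cos (t * y)) 0.
  apply: is_derive_eq (is_derive1_comp (is_derive_cos _) D2) _.
  by rewrite mul0r sin0 oppr0 mul0r.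
have D5 : is_derive (0 : R) (1 : R) (fun t : R => sin (t * y)) y.
  apply: is_derive_eq (is_derive1_comp (is_derive_sin _) D2) _.
  by rewrite mul0r cos0 mul1r.
have c1 : d1 n @[n --> \oo] --> 0.
  have D : is_derive (0 : R) (1 : R) (fun t : R => expR (t * x) * cos (t * y)) x.
    apply: is_derive_eq (is_deriveM D3 D4) _.
    by rewrite !mul0r cos0 /GRing.scale/= mulr0 add0r mul1r.
  have := cvg_difference_quotient D; rewrite !mul0r expR0 cos0 mulr1 => H.
  by rewrite -(subrr x); apply: cvgB; [exact: H|exact: cvg_cst].
have c2 : d2 n @[n --> \oo] --> 0.
  have D : is_derive (0 : R) (1 : R) (fun t : R => expR (t * x) * sin (t * y)) y.
    apply: is_derive_eq (is_deriveM D3 D5) _.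
    by rewrite !mul0r sin0 expR0 /GRing.scale/= mul0r mul1r addr0.
  have := cvg_difference_quotient D; rewrite !mul0r sin0 mulr0 => H.
  rewrite -(subrr y); apply: cvgB; last exact: cvg_cst.
  by under eq_fun do rewrite -[X in _ * X]subr0.
have c3 : `|d1 n| + `|d2 n| @[n --> \oo] --> 0.
  rewrite -[X in _ --> X](addr0 (0 : R)); apply: cvgD; exact/norm_cvg0P.
apply/cvgrPdist_le => eps eps0.
have [N _ LN] : \forall n \near \oo, L <= n%:R by exact: nbhs_infty_ger.
near=> n.
have n0 : 0 <= n.+1%:R^-1 :> R by rewrite invr_ge0.
have tL : n.+1%:R^-1 * L <= 1.
  rewrite mulrC ler_pdivrMr// mul1r.
  have : L <= n%:R by apply: LN; near: n; exists N.
  by move=> /le_trans; apply; rewrite ler_nat.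
have w1 : `|w n.+1%:R^-1| <= 1 by exact: norm_convex_le1 tL h.
rewrite -(vn n) -/(w n.+1%:R^-1).
have ReB (p q : R[i]) : complex.Re p - complex.Re q = complex.Re (p - q) by case: p q => [? ?] [? ?].
rewrite ReB -mulrBr.
have c4 : `| `|d1 n| + `|d2 n| | <= eps.
  near: n; have /cvgrPdist_le/(_ eps eps0) := c3.
  by apply: filterS => k; rewrite sub0r normrN.
apply: le_trans (le_trans (ler_norm _) c4).
apply: normr_Re_le; rewrite normrM.
apply: le_trans (ler_piMl _ e1) _ => //.
apply: le_trans (normr_exprB_le _ (v1 _ n0) w1) _.
set D := v _ - w _.
have K : n.+1%:R * `|D| <= n.+1%:R * (`|complex.Re D| + `|complex.Im D|)%:C.
  by rewrite ler_wpM2l// normc_leD.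
rewrite -(mulr_natl `|D|); apply: le_trans K _.
rewrite -[n.+1%:R](rmorph_nat (real_complex R)) -rmorphM /= lecR.
have nE (r : R) : n.+1%:R * `|r| = `|n.+1%:R * r| by rewrite normrM (ger0_norm (ler0n _ _)).
rewrite mulrDr !nE.
rewrite /D /d1 /d2 /v /w /cis; simpc => /=.
have nN0 : n.+1%:R != 0 :> R by rewrite pnatr_eq0.
apply: lerD; rewrite le_eqVlt; apply/orP; left; apply/eqP; congr `|_|.
  by rewrite addrA mulrBr [in X in _ - X]mulrA mulfV// mul1r.
by rewrite mulrBr [in X in _ - X]mulrA mulfV// mul1r.
Unshelve. all: by end_near. Qed.

End complex_powers.

(** * Cauchy averages for a finite Levy measure *)

Section compound_kernel.
Context d (T : measurableType d) (R : realType).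
Variable nu : {finite_measure set T -> \bar R}.
Variable Y : T -> R.
Hypotheses (mY : measurable_fun setT Y) (Y0 : forall y, 0 <= Y y).
Variable kappa : {finite_measure set (measurableTypeR R) -> \bar R}.
Hypothesis kappaE : forall a, \int[kappa]_u cos (a * u) = expR (- `|a|).
Variable tau : R.
Hypothesis tau0 : 0 <= tau.

Let lam : R := fine (nu setT).
Let C (u : R) : R := \int[nu]_y cos (u * Y y).
Let S (u : R) : R := \int[nu]_y sin (u * Y y).
Let X : R := \int[nu]_y expR (- Y y).

Let lam0 : 0 <= lam. Proof. exact: fine_ge0. Qed.

Let mcos : measurable_fun setT (@cos R).
Proof. exact: continuous_measurable_fun (@continuous_cos R). Qed.

Let msin : measurable_fun setT (@sin R).
Proof. exact: continuous_measurable_fun (@continuous_sin R). Qed.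

Let mcY u : measurable_fun setT (fun y => cos (u * Y y)).
Proof. exact: measurableT_comp (measurable_cosM u) mY. Qed.

Let msY u : measurable_fun setT (fun y => sin (u * Y y)).
Proof. exact: measurableT_comp (measurable_sinM u) mY. Qed.

Let meY : measurable_fun setT (fun y => expR (- Y y)).
Proof. by apply: measurableT_comp => //; exact: measurableT_comp. Qed.

Let eY1 y : `|expR (- Y y)| <= 1.
Proof. by rewrite ger0_norm ?expR_ge0// expR_le1 oppr_le0. Qed.

Let icY u := bounded_integrable nu (mcY u) (fun y => cos_max (u * Y y)).
Let isY u := bounded_integrable nu (msY u) (fun y => sin_max (u * Y y)).
Let ieY := bounded_integrable nu meY eY1.

Let int_cs u p q : \int[nu]_y (p * cos (u * Y y) + q * sin (u * Y y)) =
  p * C u + q * S u.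
Proof.
rewrite (RintegralD measurableT (integrableZl measurableT p (icY u))
  (integrableZl measurableT q (isY u))).
by rewrite (RintegralZl p measurableT (icY u)) (RintegralZl q measurableT (isY u)).
Qed.

(** Test against the direction (C, S): the integral of C cos + S sin is C^2 + S^2, while the
    integrand is at most the length [N] by the Cauchy-Schwarz inequality, so N^2 <= N lam. *)
Let CS_le u : C u ^+ 2 + S u ^+ 2 <= lam ^+ 2.
Proof.
pose N := Num.sqrt (C u ^+ 2 + S u ^+ 2).
have NE : N ^+ 2 = C u ^+ 2 + S u ^+ 2 by rewrite sqr_sqrtr// addr_ge0// sqr_ge0.
have N0 : 0 <= N by exact: sqrtr_ge0.
have le y : `|C u * cos (u * Y y) + S u * sin (u * Y y)| <= N.
  rewrite -[N]ger0_norm// -ler_sqr ?nnegrE//.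
  rewrite !real_normK ?num_real// NE.
  have := cos2Dsin2 (u * Y y); set c := cos _; set s := sin _ => cs.
  have : 0 <= (C u * s - S u * c) ^+ 2 by exact: sqr_ge0.
  rewrite -subr_ge0 => H.
  suff -> : C u ^+ 2 + S u ^+ 2 - (C u * c + S u * s) ^+ 2 = (C u * s - S u * c) ^+ 2.
    exact: sqr_ge0.
  transitivity ((C u ^+ 2 + S u ^+ 2) * (c ^+ 2 + s ^+ 2) - (C u * c + S u * s) ^+ 2).
    by rewrite cs mulr1.
  by ring.
have m : measurable_fun setT (fun y => C u * cos (u * Y y) + S u * sin (u * Y y)).
  by apply: measurable_funD; exact: measurable_funM.
have := le_trans (ler_norm _) (bounded_Rintegral_le nu m le).
rewrite int_cs -!expr2 -NE -/lam => H.
have [N00|NN0] := eqVneq N 0; first by rewrite N00 expr0n sqr_ge0.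
have Np : 0 < N by rewrite lt_neqAle eq_sym NN0.
rewrite ler_sqr ?nnegrE//.
by move: H; rewrite expr2 ler_pM2l.
Qed.

Let X_le : `|X| <= lam.
Proof. by have := bounded_Rintegral_le nu meY eY1; rewrite mul1r. Qed.

Section power.
Variable k : R.
Hypotheses (k0 : 0 <= k) (kL : k * (tau * lam) <= 1).

(** With k = 1/n this is 1 + z/n, where z = tau (C + iS - lam) is the compound Poisson exponent. *)
Let rho (u : R) : R[i] := (1 + k * (tau * (C u - lam))) +i* (k * (tau * S u)).

Let A j (a u : R) : R := complex.Re (cis (a * u) * rho u ^+ j).

Let hyp u : (tau * (C u - lam) + tau * lam) ^+ 2 + (tau * S u) ^+ 2 <= (tau * lam) ^+ 2.
Proof.
have -> : tau * (C u - lam) + tau * lam = tau * C u by ring.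
by rewrite !exprMn -mulrDr ler_wpM2l ?sqr_ge0// CS_le.
Qed.

Let rho_le1 u : `|rho u| <= 1.
Proof. exact: norm_convex_le1 k0 (mulr_ge0 tau0 lam0) kL (hyp u). Qed.

Let A_le1 j a u : `|A j a u| <= 1.
Proof.
apply: normr_Re_le; rewrite normrM mulr_ile1 ?norm_cis_le1//.
by rewrite normrX exprn_ile1.
Qed.

Let mC : measurable_fun setT C.
Proof.
apply: (@bounded_measurable_Rintegral _ _ (measurableTypeR R) T R kappa nu
  (fun u y => cos (u * Y y)) 1); last by move=> u y; exact: cos_max.
apply: (measurableT_comp mcos); apply: measurable_funM => //.
exact: measurableT_comp.
Qed.

Let mS : measurable_fun setT S.
Proof.
apply: (@bounded_measurable_Rintegral _ _ (measurableTypeR R) T R kappa nu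
  (fun u y => sin (u * Y y)) 1); last by move=> u y; exact: sin_max.
apply: (measurableT_comp msin); apply: measurable_funM => //.
exact: measurableT_comp.
Qed.

Let ReM (z w : R[i]) :
  complex.Re (z * w) = complex.Re z * complex.Re w - complex.Im z * complex.Im w.
Proof. by case: z w => [? ?] [? ?]. Qed.

Let ImM (z w : R[i]) :
  complex.Im (z * w) = complex.Re z * complex.Im w + complex.Im z * complex.Re w.
Proof. by case: z w => [? ?] [? ?]. Qed.

Let mrho j : measurable_fun setT (fun u => complex.Re (rho u ^+ j)) /\
             measurable_fun setT (fun u => complex.Im (rho u ^+ j)).
Proof.
have m1 : measurable_fun setT (fun u => 1 + k * (tau * (C u - lam))).
  apply: measurable_funD => //; apply: measurable_funM => //.
  by apply: measurable_funM => //; exact: measurable_funB.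
have m2 : measurable_fun setT (fun u => k * (tau * S u)).
  by apply: measurable_funM => //; exact: measurable_funM.
elim: j => [|j [IH1 IH2]]; first by split.
split.
- under eq_fun do rewrite exprS ReM /=.
  by apply: measurable_funB; exact: measurable_funM.
- under eq_fun do rewrite exprS ImM /=.
  by apply: measurable_funD; exact: measurable_funM.
Qed.

Let mA j d' (T' : measurableType d') (f g : T' -> R) :
  measurable_fun setT f -> measurable_fun setT g ->
  measurable_fun setT (fun p => A j (f p) (g p)).
Proof.
move=> mf mg; have [m1 m2] := mrho j.
rewrite /A; under eq_fun do rewrite ReM /=.
have mfg : measurable_fun setT (fun p => f p * g p) by exact: measurable_funM.
apply: measurable_funB; apply: measurable_funM.
- exact: (measurableT_comp mcos mfg).
- exact: (measurableT_comp m1 mg).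
- exact: (measurableT_comp msin mfg).
- exact: (measurableT_comp m2 mg).
Qed.

(** A further factor [rho] is (1 - k tau lam) plus k tau times the integral of e^{iuY}. It either
    keeps the frequency [a] or raises it to a + Y. *)
Let A_succ j a u :
  A j.+1 a u = (1 - k * tau * lam) * A j a u
               + k * tau * \int[nu]_y A j (a + Y y) u.
Proof.
pose z := cis (a * u) * rho u ^+ j.
have -> : \int[nu]_y A j (a + Y y) u =
   complex.Re z * C u + (- complex.Im z) * S u.
  rewrite -int_cs; apply: eq_Rintegral => y _.
  rewrite /A mulrDl cisD mulrAC -/z ReM /= (mulrC (Y y)).
  by rewrite mulNr.
by rewrite /A exprSr mulrA -/z ReM /=; ring.
Qed.

(** The induction quantifies over all a >= 0, since the recursion shifts [a]. As the jumps are
    nonnegative, so are all frequencies, and the kernel value e^{-(a + Y)} factors as e^{-a} e^{-Y};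
    each step multiplies by the value of [rho] at u = i. *)
Let int_A j a : 0 <= a ->
  \int[kappa]_u A j a u = expR (- a) * (1 + k * (tau * (X - lam))) ^+ j.
Proof.
elim: j a => [|j IH] a a0.
  rewrite expr0 mulr1 -[a in RHS]ger0_norm// -kappaE.
  by apply: eq_Rintegral => u _; rewrite /A expr0 mulr1.
have mAu b : measurable_fun setT (fun u : measurableTypeR R => A j b u).
  by apply: mA.
have iA : kappa.-integrable setT (EFin \o (fun u => A j a u)).
  exact: (bounded_integrable kappa (mAu a) (A_le1 j a)).
have mAp : measurable_fun setT
    (fun p : measurableTypeR R * T => A j (a + Y p.2) p.1).
  apply: mA => //; apply: measurable_funD => //; exact: measurableT_comp.
have mI := bounded_measurable_Rintegral kappa nu mAp (fun u y => A_le1 j (a + Y y) u).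
have mAy u : measurable_fun setT (fun y => A j (a + Y y) u).
  by apply: mA => //; exact: measurable_funD.
have iI : kappa.-integrable setT (EFin \o (fun u => \int[nu]_y A j (a + Y y) u)).
  have H u := @bounded_Rintegral_le _ T R nu _ 1 (mAy u) (fun y => A_le1 j (a + Y y) u).
  exact: (bounded_integrable kappa mI H).
transitivity (\int[kappa]_u ((1 - k * tau * lam) * A j a u
               + k * tau * \int[nu]_y A j (a + Y y) u)).
  by apply: eq_Rintegral => u _; exact: A_succ.
rewrite (RintegralD measurableT (integrableZl measurableT _ iA)
  (integrableZl measurableT _ iI)).
rewrite (RintegralZl _ measurableT iA) (RintegralZl _ measurableT iI).
rewrite IH// (bounded_Rintegral_swap kappa nu mAp (fun u y => A_le1 j (a + Y y) u)).
have -> : \int[nu]_y \int[kappa]_u A j (a + Y y) u =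
   (expR (- a) * (1 + k * (tau * (X - lam))) ^+ j) * X.
  rewrite -(RintegralZl _ measurableT ieY); apply: eq_Rintegral => y _.
  by rewrite IH ?addr_ge0// opprD expRD; ring.
by rewrite exprSr; ring.
Qed.

Lemma compound_power_kernel j a : 0 <= a ->
  [/\ measurable_fun setT (A j a), (forall u, `|A j a u| <= 1) &
  \int[kappa]_u A j a u = expR (- a) * (1 + k * (tau * (X - lam))) ^+ j].
Proof.
move=> a0; split; [|exact: A_le1|exact: int_A].
by apply: mA.
Qed.

End power.

(* The integrand is the real part of the limit of the powers
   e^{iau} (1 + tau (\int e^{iuY} - lam) / n)^n; expanding such a power gives
   mixtures of cos(bu) with b >= 0, on which the kernel acts as exp(-b). *)
Lemma compound_kernel a : 0 <= a ->
  \int[kappa]_u (expR (tau * (\int[nu]_y cos (u * Y y) - fine (nu setT))) *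
     cos (a * u + tau * \int[nu]_y sin (u * Y y))) =
  expR (- a + tau * (\int[nu]_y expR (- Y y) - fine (nu setT))).
Proof.
move=> a0; rewrite -/lam -/X.
have CSt u : (tau * (C u - lam) + tau * lam) ^+ 2 + (tau * S u) ^+ 2 <= (tau * lam) ^+ 2.
  have -> : tau * (C u - lam) + tau * lam = tau * C u by ring.
  by rewrite !exprMn -mulrDr ler_wpM2l ?sqr_ge0// CS_le.
have L0 : 0 <= tau * lam by rewrite mulr_ge0.
(* Starting the sequence at an [N] above tau lam ensures k tau lam <= 1, the condition under which
   [rho] stays in the unit disc. *)
have [N _ LN] : \forall n \near \oo, tau * lam <= n%:R by exact: nbhs_infty_ger.
have kL n : (n + N).+1%:R^-1 * (tau * lam) <= 1.
  rewrite mulrC ler_pdivrMr// mul1r.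
  have : tau * lam <= (n + N)%:R by apply: LN => /=; rewrite leq_addl.
  by move=> /le_trans; apply; rewrite ler_nat.
have k0 n : 0 <= (n + N).+1%:R^-1 :> R by rewrite invr_ge0.
pose G u : R := complex.Re (cis (a * u) * ((expR (tau * (C u - lam)))%:C * cis (tau * S u))).
have GE u : expR (tau * (C u - lam)) * cos (a * u + tau * S u) = G u.
  by rewrite /G cosD /cis; simpc => /=; ring.
have H n := compound_power_kernel (k0 n) (kL n) (n + N).+1 a0.
pose g n u : R := complex.Re (cis (a * u) *
  ((1 + (n + N).+1%:R^-1 * (tau * (C u - lam))) +i*
   ((n + N).+1%:R^-1 * (tau * S u))) ^+ (n + N).+1).
have gG u : g n u @[n --> \oo] --> G u.
  have := cvg_expn_exp L0 (CSt u) (norm_cis_le1 (a * u)).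
  by rewrite -(cvg_shiftn N).
have mG : measurable_fun setT G.
  apply: (@measurable_fun_cvg _ _ _ setT g G) => [n|u _]; last exact: gG.
  by have [] := H n.
have lim1 : \int[kappa]_u g n u @[n --> \oo] --> \int[kappa]_u G u.
  apply: (bounded_cvg_Rintegral (M := 1)) => //.
  - by move=> n; have [] := H n.
  - by move=> n u; have [_ + _] := H n; apply.
  - by apply: aeW => u; exact: gG.
have lim2 : \int[kappa]_u g n u @[n --> \oo] --> expR (- a) * expR (tau * (X - lam)).
  have -> : (fun n => \int[kappa]_u g n u) = (fun n => expR (- a) *
      (1 + (n + N).+1%:R^-1 * (tau * (X - lam))) ^+ (n + N).+1).
    by apply/funext => n; have [_ _] := H n.
  apply: cvgM; first exact: cvg_cst.
  rewrite (cvg_shiftn N (fun n => (1 + n.+1%:R^-1 * (tau * (X - lam))) ^+ n.+1)).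
  (* The powers on the right are real: the same limit lemma applies with y = 0 and factor 1, because
     |X| <= lam puts tau (X - lam) in the same disc. *)
  have XL : (tau * (X - lam) + tau * lam) ^+ 2 + 0 ^+ 2 <= (tau * lam) ^+ 2.
    have -> : tau * (X - lam) + tau * lam = tau * X by ring.
    rewrite expr0n addr0 !exprMn ler_wpM2l ?sqr_ge0//.
    by rewrite -[X ^+ 2]real_normK ?num_real// ler_sqr ?nnegrE.
  have := cvg_expn_exp L0 XL (e := 1); rewrite normr1 => /(_ (lexx _)).
  rewrite /cis sin0 cos0 mul1r mulr1 /=.
  under eq_fun do rewrite mul1r mulr0 complexr0 -rmorphXn /=.
  by [].
rewrite expRD; under eq_Rintegral do rewrite GE.
exact: (cvg_unique _ lim1 lim2).
Qed.

End compound_kernel.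

(** * Integrability against a Levy measure *)

Section trig_bounds.
Context {R : realType}.

Let lipschitz (f f' : R -> R) (x : R) :
  (forall y, is_derive y (1 : R) f (f' y)) -> (forall y, `|f' y| <= 1) ->
  0 <= x -> `|f x - f 0| <= x.
Proof.
move=> df f1 x0.
have cf : continuous f by apply: derivable1_continuous => y; have [] := df y.
have [|c _ ->] := @MVT_segment R f f' 0 x x0 (fun y _ => df y).
  exact: continuous_subspaceT.
by rewrite subr0 normrM (ger0_norm x0) ler_piMl.
Qed.

Lemma cosB1_norm_le (x : R) : `|cos x - 1| <= `|x|.
Proof.
rewrite -cos_norm -[X in _ - X]cos0.
apply: (lipschitz (fun y => is_derive_cos y)) => // y.
by rewrite normrN sin_max.
Qed.

Lemma sin_norm_le (x : R) : `|sin x| <= `|x|.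
Proof.
have H : `|sin `|x| | <= `|x|.
  rewrite -[sin _]subr0 -[X in _ - X]sin0.
  by apply: (lipschitz (fun y => is_derive_sin y)) => // y; exact: cos_max.
by case: (leP 0 x) H => x0; rewrite ?(ger0_norm x0)// (ltr0_norm x0) sinN normrN.
Qed.

End trig_bounds.

Lemma ae_eq_Rintegral d (T : measurableType d) (R : realType)
    (mu : {measure set T -> \bar R}) (f g : T -> R) :
  measurable_fun setT f -> measurable_fun setT g ->
  (\forall x \ae mu, f x = g x) -> \int[mu]_x f x = \int[mu]_x g x.
Proof.
move=> mf mg fg; congr fine; apply: ae_eq_integral => //.
- exact/measurable_EFinP.
- exact/measurable_EFinP.
- by apply: filterS fg => x fgx _; rewrite fgx.
Qed.

Section levy_measure_truncation.
Context {R : realType}.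
Variable nu : {measure set R -> \bar R}.
Hypothesis nu_min : (\int[nu]_(y in `]0%R, +oo[) (Num.min y 1)%:E < +oo)%E.

Let D : set R := `]0, +oo[%classic.

Let mD : measurable D. Proof. exact: measurable_itv. Qed.

Let mmin : measurable_fun setT (fun y : R => Num.min y 1).
Proof. by apply: measurable_minr. Qed.

Let min_ge0 y : D y -> 0 <= Num.min y 1.
Proof. by rewrite /D/= in_itv/= andbT le_min ler01 andbT => /ltW. Qed.

Lemma integrable_min1 (K : R) (f : R -> R) : measurable_fun setT f ->
  (forall y, 0 < y -> `|f y| <= K * Num.min y 1) ->
  nu.-integrable D (EFin \o f).
Proof.
move=> mf fK.
have imin : nu.-integrable D (EFin \o (fun y : R => Num.min y 1)).
  apply/integrableP; split; first by apply/measurable_EFinP; exact: measurable_funTS.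
  rewrite (eq_integral (fun y : R => (Num.min y 1)%:E))//.
  by move=> y /[!inE] Dy /=; rewrite ger0_norm// min_ge0.
apply: le_integrable (integrableZl mD K imin) => //.
  by apply/measurable_EFinP; exact: measurable_funTS.
move=> y; rewrite /D/= in_itv/= andbT => y0; rewrite lee_fin.
by apply: le_trans (fK y y0) _; rewrite ler_norm.
Qed.

Let An (n : nat) : set R := `[n.+1%:R^-1, +oo[%classic.

Let mAn n : measurable_fun setT (\1_(An n) : R -> R).
Proof. by apply: measurable_indic; exact: measurable_itv. Qed.

(** On (0, +oo) the indicator of [1/(n+1), +oo) is at most (n+1) min(y, 1), so the cut-off measure
    is finite and the identities for finite measures apply to it. *)
Lemma exists_truncation n : exists nun : {finite_measure set R -> \bar R},
  forall f : R -> R, measurable_fun setT f ->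
    \int[nun]_y f y = \int[nu]_y (f y * \1_(An n) y).
Proof.
have i1 : nu.-integrable setT (EFin \o (\1_(An n) : R -> R)).
  have m1 := mAn n.
  have H : forall y, 0 < y -> `|(\1_(An n) : R -> R) y| <= n.+1%:R * Num.min y 1.
    move=> y y0; rewrite indicE; case: (boolP (y \in An n)) => [|_].
      rewrite inE /An/= in_itv/= andbT => yn; rewrite normr1.
      rewrite -ler_pdivrMl// mulr1 le_min yn/=.
      by rewrite invf_le1// ler1n.
    by rewrite normr0 mulr_ge0// le_min (ltW y0) ler01.
  have := integrable_min1 m1 H; rewrite (integrable_mkcond _ mD).
  apply: eq_integrable => // y _.
  rewrite patchE /=; case: ifPn => // yD.
  rewrite indicE; case: (boolP (y \in An n)) => // yA.
  exfalso; move/negP : yD; apply; move: yA; rewrite !inE /An /D /= !in_itv/= !andbT.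
  by apply: lt_le_trans; rewrite invr_gt0.
have i0 y : 0 <= (\1_(An n) : R -> R) y by rewrite indicE.
have [nun nunE] := finite_density_measure i0 i1.
by exists nun => f mf; exact: (integral_density (mAn n) i0 nunE).
Qed.

(** Every y > 0 is eventually kept by the cut-off, and the bound by min(y, 1) makes |f| itself the
    dominating function. *)
Lemma cvg_truncation (K : R) (f : R -> R) : measurable_fun setT f ->
  (forall y, 0 < y -> `|f y| <= K * Num.min y 1) ->
  \int[nu]_y (f y * \1_(An n) y) @[n --> \oo] --> \int[nu]_(y in D) f y.
Proof.
move=> mf fK.
have iF : nu.-integrable D (EFin \o f) by exact: integrable_min1 fK.
have E n : \int[nu]_y (f y * \1_(An n) y) = \int[nu]_(y in D) (f y * \1_(An n) y).
  rewrite [RHS]Rintegral_mkcond; apply: eq_Rintegral => y _.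
  rewrite patchE; case: ifPn => // yD.
  rewrite indicE; case: (boolP (y \in An n)) => yA; last by rewrite mulr0.
  exfalso; move/negP : yD; apply; move: yA; rewrite !inE /An /D /= !in_itv/= !andbT.
  by apply: lt_le_trans; rewrite invr_gt0.
under eq_fun do rewrite E.
have [] := @dominated_convergence _ _ _ nu D mD
    (fun n y => (f y * \1_(An n) y)%:E) (EFin \o f) (EFin \o (fun y => `|f y|)).
- move=> n; apply/measurable_EFinP; apply: measurable_funTS.
  exact: measurable_funM.
- by apply/measurable_EFinP; exact: measurable_funTS.
- apply: aeW => y Dy; apply: cvg_EFin; first exact: nearW.
  apply: cvg_near_cst; near=> n.
  rewrite /= indicE mem_set ?mulr1// /An /= in_itv/= andbT.
  have y0 : 0 < y by move: Dy; rewrite /D/= in_itv/= andbT.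
  have : y^-1 <= n%:R by near: n; exact: nbhs_infty_ger.
  move=> yn; rewrite invf_ple ?posrE// (le_trans yn)// ler_nat.
  by [].
- exact: integrable_norm.
- apply: aeW => y n _ /=; rewrite lee_fin normrM ler_piMr//.
  by rewrite indicE; case: (_ \in _); rewrite ?normr1 ?normr0.
move=> _ _ H; apply: fine_cvg; rewrite fineK; first exact: H.
exact: (integrable_fin_num mD iF).
Unshelve. all: by end_near. Qed.

End levy_measure_truncation.

Section charfun_real.
Context {R : realType}.

Lemma cexp_i (r : R) : cexp ('i%C * r%:C) = cis r.
Proof. by rewrite /cexp /cis; simpc => /=; rewrite expR0; simpc. Qed.

Lemma charfunE d (Omega : measurableType d) (P : probability Omega R)
    (X : Omega -> R) (xi : R) :
  charfun P X xi = (\int[P]_w cos (xi * X w)) +i* (\int[P]_w sin (xi * X w)).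
Proof.
by rewrite /charfun /cintegral; congr (_ +i* _); apply: eq_Rintegral => w _;
  rewrite cexp_i.
Qed.

Lemma cexpE (a b : R) : cexp (a +i* b) = (expR a * cos b) +i* (expR a * sin b).
Proof. by rewrite /cexp; simpc. Qed.

End charfun_real.

(** * From the characteristic function to the Laplace transform *)

Section subordinator_laplace.
Context d (Omega : measurableType d) (R : realType) (P : probability Omega R).
Variables (X : Omega -> R) (t gamma : R) (nu : {measure set R -> \bar R}).
Hypotheses (mX : measurable_fun setT X) (X0 : \forall w \ae P, 0 <= X w)
  (t0 : 0 <= t)
  (nu_min : (\int[nu]_(y in `]0%R, +oo[) (Num.min y 1)%:E < +oo)%E)
  (X_charfun : forall xi, charfun P X xi =
    cexp (t%:C * ('i%C * (gamma * xi)%:C +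
      cintegral nu `]0, +oo[%classic
        (fun y => cexp ('i%C * (xi * y)%:C) - 1)))).

Let psiR (xi : R) : R := \int[nu]_(y in `]0, +oo[%classic) (cos (xi * y) - 1).
Let psiI (xi : R) : R := \int[nu]_(y in `]0, +oo[%classic) sin (xi * y).

Let charfunXE xi :
  \int[P]_w cos (xi * X w) = expR (t * psiR xi) * cos (t * (gamma * xi + psiI xi)) /\
  \int[P]_w sin (xi * X w) = expR (t * psiR xi) * sin (t * (gamma * xi + psiI xi)).
Proof.
have := X_charfun xi; rewrite charfunE.
have -> : t%:C * ('i%C * (gamma * xi)%:C +
      cintegral nu `]0, +oo[%classic (fun y => cexp ('i%C * (xi * y)%:C) - 1)) =
   (t * psiR xi) +i* (t * (gamma * xi + psiI xi)).
  have -> : cintegral nu `]0, +oo[%classic (fun y => cexp ('i%C * (xi * y)%:C) - 1)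
    = psiR xi +i* psiI xi.
    rewrite /cintegral; congr (_ +i* _); apply: eq_Rintegral => y _;
      rewrite cexp_i /cis /=; by rewrite ?oppr0 ?addr0.
  by simpc; congr (_ +i* _); rewrite ?add0r.
by rewrite cexpE => -[-> ->].
Qed.

Section positive_part.
Variable s : R.
Hypothesis s0 : 0 <= s.

(** [c] and [a] are the negative and positive parts of t gamma s. As c >= 0, sX + c is nonnegative
    whenever X is, so the kernel gives e^{-(sX + c)} there. *)
Let c : R := Num.max 0 (- (t * gamma * s)).
Let a : R := Num.max 0 (t * gamma * s).

Let ac : t * gamma * s + c = a.
Proof.
rewrite /a /c; have [h|h] := leP 0 (t * gamma * s).
  by rewrite (max_idPl _) ?addr0// oppr_le0.
by rewrite (max_idPr _) ?subrr// oppr_ge0 ltW.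
Qed.

Let c0 : 0 <= c. Proof. by rewrite le_max lexx. Qed.
Let a0 : 0 <= a. Proof. by rewrite le_max lexx. Qed.

Let mcX b : measurable_fun setT (fun w => cos (b * X w)).
Proof. exact: measurableT_comp (measurable_cosM b) mX. Qed.

Let msX b : measurable_fun setT (fun w => sin (b * X w)).
Proof. exact: measurableT_comp (measurable_sinM b) mX. Qed.

Let mean_cos u : \int[P]_w cos ((s * X w + c) * u) =
  expR (t * psiR (u * s)) * cos (a * u + t * psiI (u * s)).
Proof.
have ic := bounded_integrable P (mcX (u * s)) (fun w => cos_max (u * s * X w)).
have is_ := bounded_integrable P (msX (u * s)) (fun w => sin_max (u * s * X w)).
transitivity (\int[P]_w (cos (c * u) * cos (u * s * X w)
   + (- sin (c * u)) * sin (u * s * X w))).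
  apply: eq_Rintegral => w _.
  have -> : (s * X w + c) * u = c * u + u * s * X w by ring.
  by rewrite cosD mulNr.
rewrite (RintegralD measurableT (integrableZl measurableT _ ic)
  (integrableZl measurableT _ is_)).
rewrite (RintegralZl _ measurableT ic) (RintegralZl _ measurableT is_).
have [-> ->] := charfunXE (u * s).
have -> : a * u + t * psiI (u * s) = c * u + t * (gamma * (u * s) + psiI (u * s)).
  by rewrite -ac; ring.
by rewrite cosD; ring.
Qed.

(** The identity for finite measures wants a jump size that is nonnegative everywhere, hence the
    positive part; on (0, +oo), where the Levy integrals are taken, it is s y. *)
Let Y (y : R) : R := s * Num.max 0 y.

Let mY : measurable_fun setT Y.
Proof. by apply: measurable_funM => //; exact: measurable_maxr. Qed.

Let Y0 y : 0 <= Y y. Proof. by rewrite mulr_ge0// le_max lexx. Qed.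

Let YE y : 0 < y -> Y y = s * y.
Proof. by move=> y0; rewrite /Y (max_idPr _)// ltW. Qed.

(** The linear bound serves for y < 1 and the constant one for y >= 1; 2 + K covers both. *)
Let bound (K x : R) y : 0 <= K -> 0 < y -> x <= K * y -> x <= 2 ->
  x <= (2 + K) * Num.min y 1.
Proof.
move=> K0 y0 xK x2; rewrite /Num.min; case: ifP => y1.
  by rewrite (le_trans xK)// mulrDl lerDr mulr_ge0// ltW.
by rewrite mulr1 (le_trans x2)// lerDl.
Qed.

Let YK u y : 0 < y -> `|u * Y y| <= (`|u| * s) * y.
Proof. by move=> y0; rewrite YE// normrM (ger0_norm (mulr_ge0 s0 (ltW y0))) mulrA. Qed.

Let cosK u y : 0 < y -> `|cos (u * Y y) - 1| <= (2 + `|u| * s) * Num.min y 1.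
Proof.
move=> y0; apply: bound => //; first by rewrite mulr_ge0.
  by apply: le_trans (cosB1_norm_le _) _; exact: YK.
apply: le_trans (ler_normB _ _) _; rewrite normr1.
by have := cos_max (u * Y y); lra.
Qed.

Let sinK u y : 0 < y -> `|sin (u * Y y)| <= (2 + `|u| * s) * Num.min y 1.
Proof.
move=> y0; apply: bound => //; first by rewrite mulr_ge0.
  by apply: le_trans (sin_norm_le _) _; exact: YK.
by have := sin_max (u * Y y); lra.
Qed.

Let expK y : 0 < y -> `|expR (- Y y) - 1| <= (2 + s) * Num.min y 1.
Proof.
move=> y0.
have e1 : expR (- Y y) <= 1 by rewrite expR_le1 oppr_le0.
have e0 := expR_ge0 (- Y y).
have e2 := expR_ge1Dx (- Y y).
rewrite ler0_norm; last by lra.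
apply: bound => //; last by lra.
by move: e2; rewrite YE// => e2; lra.
Qed.

(* The shift c keeps a = t gamma s + c nonnegative without assuming
   gamma >= 0, so that the kernel identity applies at a. *)
Lemma subordinator_laplace :
  \int[P]_w expR (- (s * X w)) =
  expR (t * (- (gamma * s) + \int[nu]_(y in `]0, +oo[%classic) (expR (- (s * y)) - 1))).
Proof.
have [kap kapE] := @exists_cauchy_kernel R.
have m1 : measurable_fun setT (fun w => s * X w + c).
  by apply: measurable_funD => //; exact: measurable_funM.
have m2 : measurable_fun setT (fun w => `|s * X w + c|).
  have mn : measurable_fun setT (fun x : R => `|x|) by exact: normr_measurable.
  exact: (measurableT_comp mn m1).
have m3 : measurable_fun setT (fun w => expR (- `|s * X w + c|)).
  by apply: measurableT_comp => //; exact: measurableT_comp.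
(* The positive part equals X almost surely and makes e^{-sX'} bounded by 1 at every outcome. *)
pose X' w := Num.max 0 (X w).
have mX' : measurable_fun setT X' by exact: measurable_maxr.
have XX' : \forall w \ae P, X w = X' w.
  by apply: filterS X0 => w Xw; rewrite /X' (max_idPr _).
have meX b : measurable_fun setT (fun w => expR (- (b * X w))).
  by apply: measurableT_comp => //; apply: measurableT_comp => //; exact: measurable_funM.
have meX' : measurable_fun setT (fun w => expR (- (s * X' w))).
  by apply: measurableT_comp => //; apply: measurableT_comp => //; exact: measurable_funM.
have LHS : \int[P]_w expR (- `|s * X w + c|) = expR (- c) * \int[P]_w expR (- (s * X w)).
  have -> : \int[P]_w expR (- (s * X w)) = \int[P]_w expR (- (s * X' w)).
    by apply: ae_eq_Rintegral => //; apply: filterS XX' => w <-.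
  have X'0 w : 0 <= X' w by rewrite /X' le_max lexx.
  have ieX : P.-integrable setT (EFin \o (fun w => expR (- (s * X' w)))).
    apply: (bounded_integrable P meX' (M := 1)) => w.
    by rewrite ger0_norm ?expR_ge0// expR_le1 oppr_le0 mulr_ge0.
  rewrite -(RintegralZl _ measurableT ieX); apply: ae_eq_Rintegral => //.
    exact: measurable_funM.
  apply: filterS XX' => w ->.
  by rewrite ger0_norm ?addr_ge0// ?mulr_ge0// opprD expRD mulrC.
pose tr := exists_truncation nu_min.
pose nun n := projT1 (cid (tr n)).
have nunE n (f : R -> R) : measurable_fun setT f ->
  \int[nun n]_y f y = \int[nu]_y (f y * \1_(`[n.+1%:R^-1, +oo[%classic) y).
  exact: (projT2 (cid (tr n))).
have lim (f g : R -> R) (K : R) : measurable_fun setT f ->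
    (forall y, 0 < y -> `|f y| <= K * Num.min y 1) -> (forall y, 0 < y -> f y = g y) ->
    \int[nun n]_y f y @[n --> \oo] --> \int[nu]_(y in `]0, +oo[%classic) g y.
  move=> mf fK fg; under eq_fun do rewrite nunE//.
  have -> : \int[nu]_(y in `]0, +oo[%classic) g y = \int[nu]_(y in `]0, +oo[%classic) f y.
    by apply: eq_Rintegral => y; rewrite inE/= in_itv/= andbT => /fg.
  exact: cvg_truncation fK.
have mcY u : measurable_fun setT (fun y => cos (u * Y y)).
  exact: measurableT_comp (measurable_cosM u) mY.
have msY u : measurable_fun setT (fun y => sin (u * Y y)).
  exact: measurableT_comp (measurable_sinM u) mY.
have meY : measurable_fun setT (fun y => expR (- Y y)).
  by apply: measurableT_comp => //; exact: measurableT_comp.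
have eY1 y : `|expR (- Y y)| <= 1.
  by rewrite ger0_norm ?expR_ge0// expR_le1 oppr_le0.
have B1 n (f : R -> R) : measurable_fun setT f -> (forall y, `|f y| <= 1) ->
    \int[nun n]_y f y - fine (nun n setT) = \int[nun n]_y (f y - 1).
  move=> mf f1; rewrite RintegralB//.
  - by rewrite Rintegral_cst// mul1r.
  - exact: (bounded_integrable (nun n) mf f1).
  - exact: finite_measure_integrable_cst.
have limC u : \int[nun n]_y cos (u * Y y) - fine (nun n setT) @[n --> \oo] --> psiR (u * s).
  under eq_fun do rewrite (B1 _ _ (mcY u) (fun y => cos_max (u * Y y))).
  apply: lim (cosK u) _; first exact: measurable_funB.
  by move=> y y0; rewrite YE// mulrA.
have limS u : \int[nun n]_y sin (u * Y y) @[n --> \oo] --> psiI (u * s).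
  apply: lim (sinK u) _; first exact: msY.
  by move=> y y0; rewrite YE// mulrA.
have limE : \int[nun n]_y expR (- Y y) - fine (nun n setT) @[n --> \oo] -->
    \int[nu]_(y in `]0, +oo[%classic) (expR (- (s * y)) - 1).
  under eq_fun do rewrite (B1 _ _ meY eY1).
  apply: lim expK _; first exact: measurable_funB.
  by move=> y y0; rewrite YE.
pose G u : R := expR (t * psiR (u * s)) * cos (a * u + t * psiI (u * s)).
have mcos := continuous_measurable_fun (@continuous_cos R).
have msin := continuous_measurable_fun (@continuous_sin R).
(* Writing e^{-|sX + c|} as a Cauchy average and exchanging integrals leaves E cos((sX + c)u), which
   the characteristic function determines. *)
have LHSG : \int[P]_w expR (- `|s * X w + c|) = \int[kap]_u G u.
  transitivity (\int[P]_w \int[kap]_u cos ((s * X w + c) * u)).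
    by apply: eq_Rintegral => w _; rewrite kapE.
  rewrite (@bounded_Rintegral_swap _ _ _ (measurableTypeR R) _ P kap
    (fun w u => cos ((s * X w + c) * u)) 1).
  - by apply: eq_Rintegral => u _; rewrite mean_cos.
  - apply: (measurableT_comp mcos); apply: measurable_funM => //.
    exact: (measurableT_comp m1 measurable_fst).
  - by move=> w u; exact: cos_max.
(* This is [G] with the Levy measure cut off at 1/(n+1), the case settled by [compound_kernel]. *)
pose g n u : R := expR (t * (\int[nun n]_y cos (u * Y y) - fine (nun n setT)))
  * cos (a * u + t * \int[nun n]_y sin (u * Y y)).
have mCn n : measurable_fun setT (fun u : R => \int[nun n]_y cos (u * Y y)).
  apply: (@bounded_measurable_Rintegral _ _ (measurableTypeR R) R R kap (nun n)
    (fun u y => cos (u * Y y)) 1); last by move=> u y; exact: cos_max.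
  apply: (measurableT_comp mcos); apply: measurable_funM => //.
  exact: measurableT_comp.
have mSn n : measurable_fun setT (fun u : R => \int[nun n]_y sin (u * Y y)).
  apply: (@bounded_measurable_Rintegral _ _ (measurableTypeR R) R R kap (nun n)
    (fun u y => sin (u * Y y)) 1); last by move=> u y; exact: sin_max.
  apply: (measurableT_comp msin); apply: measurable_funM => //.
  exact: measurableT_comp.
have mg n : measurable_fun setT (g n).
  have e1 : measurable_fun setT
      (fun u : R => t * (\int[nun n]_y cos (u * Y y) - fine (nun n setT))).
    by apply: measurable_funM => //; exact: measurable_funB.
  have e2 : measurable_fun setT (fun u : R => a * u + t * \int[nun n]_y sin (u * Y y)).
    by apply: measurable_funD; exact: measurable_funM.
  have mexp := continuous_measurable_fun (@continuous_expR R).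
  exact: (measurable_funM (measurableT_comp mexp e1) (measurableT_comp mcos e2)).
have g1 n u : `|g n u| <= 1.
  rewrite normrM mulr_ile1// ?cos_max// ger0_norm ?expR_ge0// expR_le1.
  rewrite mulr_ge0_le0// subr_le0 (le_trans (ler_norm _))//.
  have := bounded_Rintegral_le (nun n) (mcY u) (fun y => cos_max (u * Y y)).
  by rewrite mul1r.
have gG u : g n u @[n --> \oo] --> G u.
  apply: cvgM.
    have H : t * (\int[nun n]_y cos (u * Y y) - fine (nun n setT)) @[n --> \oo]
        --> t * psiR (u * s).
      by apply: cvgM; [exact: cvg_cst|exact: limC].
    exact: (cvg_comp _ _ H (@continuous_expR R _)).
  have H : a * u + t * (\int[nun n]_y sin (u * Y y)) @[n --> \oo]
      --> a * u + t * psiI (u * s).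
    apply: cvgD; first exact: cvg_cst.
    by apply: cvgM; [exact: cvg_cst|exact: limS].
  exact: (cvg_comp _ _ H (@continuous_cos R _)).
have mG : measurable_fun setT G.
  by apply: (@measurable_fun_cvg _ _ _ setT g G) => [n|u _]; [exact: mg|exact: gG].
have lim1 : \int[kap]_u g n u @[n --> \oo] --> \int[kap]_u G u.
  by apply: (@bounded_cvg_Rintegral _ (measurableTypeR R) R kap g G 1) => //; exact: aeW.
pose Psi := \int[nu]_(y in `]0, +oo[%classic) (expR (- (s * y)) - 1).
have lim2 : \int[kap]_u g n u @[n --> \oo] --> expR (- a + t * Psi).
  have -> : (fun n => \int[kap]_u g n u) = (fun n =>
      expR (- a + t * (\int[nun n]_y expR (- Y y) - fine (nun n setT)))).
    by apply/funext => n; rewrite -(compound_kernel (nun n) mY Y0 kapE t0 a0).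
  have H : - a + t * (\int[nun n]_y expR (- Y y) - fine (nun n setT)) @[n --> \oo]
      --> - a + t * Psi.
    apply: cvgD; first exact: cvg_cst.
    by apply: cvgM; [exact: cvg_cst|exact: limE].
  exact: (cvg_comp _ _ H (@continuous_expR R _)).
have E : expR (- c) * \int[P]_w expR (- (s * X w)) = expR (- a + t * Psi).
  by rewrite -LHS LHSG; exact: (cvg_unique _ lim1 lim2).
(* Cancelling e^{-c} leaves the exponent c - a = -t gamma s next to the jump part. *)
apply: (mulfI (lt0r_neq0 (expR_gt0 (- c)))); rewrite E -expRD; congr expR.
by rewrite -ac -/Psi; ring.
Qed.

End positive_part.
End subordinator_laplace.

(** * Independent variables *)

Lemma Rintegral_sum d (T : measurableType d) (R : realType)
    (mu : {measure set T -> \bar R}) (I : Type) (s : seq I) (f : I -> T -> R) :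
  (forall i, mu.-integrable setT (EFin \o f i)) ->
  \int[mu]_x (\sum_(i <- s) f i x) = \sum_(i <- s) \int[mu]_x f i x.
Proof.
move=> fi.
have si s' : mu.-integrable setT (EFin \o (fun x => \sum_(i <- s') f i x)).
  elim: s' => [|i s' IH].
    by apply: eq_integrable (integrable0 mu setT) => // x _ /=; rewrite big_nil.
  apply: eq_integrable (integrableD measurableT (fi i) IH) => // x _ /=.
  by rewrite big_cons EFinD.
elim: s => [|i s IH].
  under eq_Rintegral do rewrite big_nil.
  by rewrite big_nil /Rintegral integral0.
under eq_Rintegral do rewrite big_cons.
by rewrite big_cons (RintegralD measurableT (fi i) (si s)) IH.
Qed.

Section discretization.
Context {R : realType}.
Variable M : nat.

Definition cell (N k : nat) : set R :=
  `[k%:R / N.+1%:R - M%:R, k.+1%:R / N.+1%:R - M%:R[%classic.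

Definition cell_value (N k : nat) : R := k%:R / N.+1%:R - M%:R.

(** The cells have width 1/(N+1), start at -M and are open on the right; the last index is there for
    the point x = M. *)
Definition discretize (N : nat) (x : R) : R :=
  \sum_(k < (2 * M * N.+1).+1) cell_value N k * \1_(cell N k) x.

Lemma measurable_cell N k : measurable (cell N k).
Proof. exact: measurable_itv. Qed.

Let cellE N k x :
  cell N k x = (k%:R <= N.+1%:R * (x + M%:R) < k.+1%:R) :> Prop.
Proof.
rewrite /cell/= in_itv/= lerBlDr ltrBrDr ler_pdivrMr// ltr_pdivlMr//.
by rewrite (mulrC N.+1%:R).
Qed.

Lemma discretizeE N x : `|x| <= M%:R -> exists2 k : nat,
  cell N k x & discretize N x = cell_value N k.
Proof.
move=> xM.
have N0 : 0 < N.+1%:R :> R by rewrite ltr0n.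
have /andP[xM1 xM2] : - M%:R <= x <= M%:R by rewrite -ler_norml.
have xM0 : 0 <= x + M%:R by rewrite -lerBlDr sub0r.
pose y := N.+1%:R * (x + M%:R).
have y0 : 0 <= y by rewrite mulr_ge0.
pose k := Num.truncn y.
have kx : cell N k x by rewrite cellE; exact: truncn_itv.
exists k => //.
have kK : (k < (2 * M * N.+1).+1)%N.
  rewrite ltnS -(ler_nat R); have /andP[ky _] := truncn_itv y0.
  apply: (le_trans ky); rewrite /y mulrC !natrM ler_pM2r//.
  by rewrite mulr_natl mulr2n lerD2r.
rewrite /discretize (bigD1 (Ordinal kK))//= big1 ?addr0; last first.
  move=> j jk; rewrite indicE memNset ?mulr0//.
  rewrite cellE -truncn_eq// => /eqP kj.
  by move/eqP: jk; apply; apply/val_inj => /=.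
by rewrite indicE mem_set// mulr1.
Qed.

Lemma discretize_dist N x : `|x| <= M%:R -> `|x - discretize N x| <= N.+1%:R^-1.
Proof.
move=> /(discretizeE N)[k kx ->]; rewrite /cell_value.
move: kx; rewrite /cell/= in_itv/= => /andP[h1 h2].
rewrite ger0_norm ?subr_ge0//.
move: h2; rewrite -(natr1 k) mulrDl mul1r => /ltW h2.
by rewrite lerBlDr addrA (addrC N.+1%:R^-1).
Qed.

Lemma cvg_discretize x : `|x| <= M%:R -> discretize n x @[n --> \oo] --> x.
Proof.
move=> xM; apply/cvgrPdist_le => eps eps0.
have := @cvg_harmonic R; move=> /cvgrPdist_le/(_ _ eps0).
apply: filterS => n; rewrite sub0r normrN => h.
by apply: le_trans (discretize_dist n xM) (le_trans (ler_norm _) h).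
Qed.

End discretization.

Section independent_products.
Context d (Omega : measurableType d) (R : realType) (P : probability Omega R).
Variables (I : finType) (F : I -> set (set Omega)).
Hypothesis iF : independent P F.

(** Independence concerns events, so each variable is rounded down to a grid. The product of the
    resulting finite sums expands over all choices of cells, and each term becomes a product of
    probabilities. Refining the grid concludes by bounded convergence. *)
Lemma independent_Rintegral_prod (Y : I -> Omega -> R) (M : nat) :
  (forall i, measurable_fun setT (Y i)) ->
  (forall i B, measurable B -> F i (Y i @^-1` B)) ->
  (forall i w, `|Y i w| <= M%:R) ->
  \int[P]_w \prod_i Y i w = \prod_i \int[P]_w Y i w.
Proof.
move=> mY FY YM.
pose K N := (2 * M * N.+1).+1.
have mD N i : measurable_fun setT (fun w => discretize M N (Y i w)).
  rewrite /discretize; apply: measurable_sum => k.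
  apply: measurable_funM => //.
  apply: (measurableT_comp _ (mY i)).
  by apply: measurable_indic; exact: measurable_cell.
have D1 N i w : `|discretize M N (Y i w)| <= M%:R + 1.
  have h := discretize_dist N (YM i w).
  have h2 : N.+1%:R^-1 <= 1 :> R by rewrite invf_le1// ler1n.
  have h3 := YM i w.
  rewrite -[X in `|X|](subKr (Y i w)); apply: le_trans (ler_normB _ _) _.
  exact: lerD h3 (le_trans h h2).
have bprod (Z : I -> Omega -> R) (C : R) : 0 <= C -> (forall i w, `|Z i w| <= C) ->
    forall w, `|\prod_i Z i w| <= C ^+ #|I|.
  move=> C0 ZC w; rewrite normr_prod -prodr_const; apply: ler_prod => i _.
  by rewrite normr_ge0 ZC.
have step N : \int[P]_w \prod_i discretize M N (Y i w) =
              \prod_i \int[P]_w discretize M N (Y i w).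
  have mYk i k : measurable (Y i @^-1` cell M N k).
    by rewrite -[X in measurable X]setTI; apply: mY => //; exact: measurable_cell.
  transitivity (\sum_(f : {ffun I -> 'I_(K N)})
      (\prod_i cell_value M N (f i)) * \prod_i fine (P (Y i @^-1` cell M N (f i)))).
    transitivity (\int[P]_w \sum_(f : {ffun I -> 'I_(K N)})
      (\prod_i cell_value M N (f i)) *
      \1_(\bigcap_(i in [set: I]) (Y i @^-1` cell M N (f i))) w).
      apply: eq_Rintegral => w _; rewrite bigA_distr_bigA /=.
      apply: eq_bigr => f _; rewrite big_split/=; congr (_ * _).
      rewrite indicE; case: (boolP (w \in _)) => [|/negP wN].
        rewrite inE => wf; rewrite big1// => i _.
        by rewrite indicE mem_set//; exact: wf.
      have [i wi] : exists i, ~ (Y i @^-1` cell M N (f i)) w.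
        by apply/existsNP => H; apply: wN; rewrite inE => i _; exact: H.
      by rewrite (bigD1 i)//= indicE memNset// mul0r.
    have mcap (f : {ffun I -> 'I_(K N)}) :
        measurable (\bigcap_(i in [set: I]) (Y i @^-1` cell M N (f i))).
      by apply: fin_bigcap_measurable => //; exact: finite_finset.
    have icap (f : {ffun I -> 'I_(K N)}) : P.-integrable setT
        (EFin \o (\1_(\bigcap_(i in [set: I]) (Y i @^-1` cell M N (f i))))).
      apply: (bounded_integrable P (M := 1)); first exact: measurable_indic.
      by move=> w; rewrite indicE; case: (_ \in _); rewrite ?normr1 ?normr0.
    rewrite Rintegral_sum; last first.
      by move=> f; exact: (integrableZl measurableT _ (icap f)).
    apply: eq_bigr => f _; rewrite (RintegralZl _ measurableT (icap f)).
    congr (_ * _); rewrite /Rintegral integral_indic// setIT.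
    have K1 := iF (fun i => FY i _ (measurable_cell M N (f i))).
    transitivity (fine (\prod_i P (Y i @^-1` cell M N (f i))))%E; first by congr fine; exact: K1.
    rewrite -[RHS]/(fine (_%:E)) (big_morph EFin EFinM erefl); congr fine.
    by apply: eq_bigr => i _; rewrite fineK// fin_num_measure.
  have ind i k : P.-integrable setT (EFin \o (fun w => \1_(cell M N k) (Y i w) : R)).
    apply: (bounded_integrable P (M := 1)).
      apply: (measurableT_comp _ (mY i)).
      by apply: measurable_indic; exact: measurable_cell.
    by move=> w; rewrite indicE; case: (_ \in _); rewrite ?normr1 ?normr0.
  have intd i : \int[P]_w discretize M N (Y i w) =
      \sum_(k < K N) cell_value M N k * fine (P (Y i @^-1` cell M N k)).
    rewrite /discretize Rintegral_sum; last first.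
      by move=> k; exact: (integrableZl measurableT _ (ind i k)).
    apply: eq_bigr => k _; rewrite (RintegralZl _ measurableT (ind i k)).
    congr (_ * _); rewrite /Rintegral -[X in fine X = _]/(integral P setT
      (fun w => (\1_(Y i @^-1` cell M N k) w)%:E)).
    by rewrite integral_indic// setIT.
  under [RHS]eq_bigr do rewrite intd.
  rewrite bigA_distr_bigA /=; apply: eq_bigr => f _.
  by rewrite big_split.
have M0 : 0 <= M%:R + 1 :> R by rewrite addr_ge0.
have limp (g : nat -> I -> R) (l : I -> R) : (forall i, g n i @[n --> \oo] --> l i) ->
    \prod_i g n i @[n --> \oo] --> \prod_i l i.
  move=> gl; apply: (@cvg_big R I *%R 1 xpredT) => //.
  exact: mul_continuous.
have lim1 : \int[P]_w \prod_i discretize M n (Y i w) @[n --> \oo] -->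
    \int[P]_w \prod_i Y i w.
  apply: (bounded_cvg_Rintegral (M := (M%:R + 1) ^+ #|I|)).
  - by move=> n; apply: measurable_prod.
  - by apply: measurable_prod.
  - by move=> n w; exact: (bprod (fun i w => discretize M n (Y i w))).
  - by apply: aeW => w; apply: limp => i; exact: cvg_discretize.
have lim2 : \int[P]_w \prod_i discretize M n (Y i w) @[n --> \oo] -->
    \prod_i \int[P]_w Y i w.
  under eq_fun do rewrite step.
  apply: limp => i; apply: (bounded_cvg_Rintegral (M := M%:R + 1)) => //.
  by apply: aeW => w; exact: cvg_discretize.
exact: (cvg_unique _ lim1 lim2).
Qed.

End independent_products.

(** * Characteristic function of an independent sum *)

Section complex_expectation.
Context {R : realType}.

Let ReD (z w : R[i]) : complex.Re (z + w) = complex.Re z + complex.Re w.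
Proof. by case: z w => [? ?] [? ?]. Qed.

Let ImD (z w : R[i]) : complex.Im (z + w) = complex.Im z + complex.Im w.
Proof. by case: z w => [? ?] [? ?]. Qed.

Let Re0 : complex.Re (0 : R[i]) = 0. Proof. by []. Qed.
Let Im0 : complex.Im (0 : R[i]) = 0. Proof. by []. Qed.

Lemma cis0 : cis 0 = 1 :> R[i].
Proof. by rewrite /cis cos0 sin0. Qed.

Lemma cis_sum (I : finType) (x : I -> R) :
  cis (\sum_i x i) = \prod_i cis (x i).
Proof. exact: (big_morph (@cis R) (@cisD R) cis0). Qed.

Context d (Omega : measurableType d) (P : probability Omega R).
Variables (I : finType) (F : I -> set (set Omega)).
Hypothesis iF : independent P F.
Variable X : I -> Omega -> R.
Hypotheses (mX : forall i, measurable_fun setT (X i))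
  (FX : forall i B, measurable B -> F i (X i @^-1` B)).

Let trig (b : bool) (x : R) : R := if b then cos x else sin x.
Let unit_ (b : bool) : R[i] := if b then 1 else 'i%C.

Let cisE x : cis x = \sum_(b : bool) unit_ b * (trig b x)%:C.
Proof. by rewrite big_bool /= /cis; simpc. Qed.

Let mtrig b : measurable_fun setT (trig b).
Proof.
case: b; first exact: continuous_measurable_fun (@continuous_cos R).
exact: continuous_measurable_fun (@continuous_sin R).
Qed.

Let trig_le1 b x : `|trig b x| <= 1.
Proof. by case: b; [exact: cos_max|exact: sin_max]. Qed.

(* Expand the product of the exponentials into the 2^#|I| products of
   cosines and sines, which are real-valued. *)
Lemma independent_charfun_sum (xi : R) :
  charfun P (fun w => \sum_i X i w) xi = \prod_i charfun P (X i) xi.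
Proof.
pose r i b w := trig b (xi * X i w).
have mr i b : measurable_fun setT (r i b).
  by apply: (measurableT_comp (mtrig b)); exact: measurable_funM.
pose Z (f : {ffun I -> bool}) := \prod_i unit_ (f i).
pose rf (f : {ffun I -> bool}) w := \prod_i r i (f i) w.
have irf f : P.-integrable setT (EFin \o rf f).
  apply: (bounded_integrable P (M := 1)).
    by apply: measurable_prod => i _; exact: mr.
  move=> w; rewrite /rf normr_prod; apply: prodr_ile1 => i _.
  by rewrite normr_ge0 trig_le1.
have cE w : cis (xi * \sum_i X i w) = \sum_f Z f * (rf f w)%:C.
  rewrite mulr_sumr cis_sum; under eq_bigr do rewrite cisE.
  rewrite bigA_distr_bigA /=; apply: eq_bigr => f _.
  by rewrite big_split /= rmorph_prod.
have ReZ (z : R[i]) (y : R) : complex.Re (z * y%:C) = complex.Re z * y.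
  by case: z => [? ?]; simpc.
have ImZ (z : R[i]) (y : R) : complex.Im (z * y%:C) = complex.Im z * y.
  by case: z => [? ?]; simpc.
have Erf f : \int[P]_w rf f w = \prod_i \int[P]_w r i (f i) w.
  apply: (independent_Rintegral_prod (M := 1) iF).
  - by move=> i; exact: mr.
  - move=> i B mB; rewrite (_ : r i (f i) @^-1` B =
      X i @^-1` ((fun x => trig (f i) (xi * x)) @^-1` B))//.
    apply: FX; rewrite -[Y in measurable Y]setTI.
    by apply: (measurableT_comp (mtrig (f i))) => //; exact: measurable_funM.
  - by move=> i w; exact: trig_le1.
transitivity (\sum_f Z f * (\int[P]_w rf f w)%:C).
  rewrite charfunE; apply/eqP; rewrite eq_complex /=; apply/andP; split; apply/eqP.
  - transitivity (\int[P]_w \sum_f complex.Re (Z f) * rf f w).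
      apply: eq_Rintegral => w _; rewrite -[cos _]/(complex.Re (cis _)) cE.
      rewrite (big_morph (@complex.Re R) ReD Re0).
      by apply: eq_bigr => f _; rewrite ReZ.
    rewrite Rintegral_sum; last by move=> f; exact: (integrableZl measurableT _ (irf f)).
    rewrite (big_morph (@complex.Re R) ReD Re0).
    by apply: eq_bigr => f _; rewrite ReZ (RintegralZl _ measurableT (irf f)).
  - transitivity (\int[P]_w \sum_f complex.Im (Z f) * rf f w).
      apply: eq_Rintegral => w _; rewrite -[sin _]/(complex.Im (cis _)) cE.
      rewrite (big_morph (@complex.Im R) ImD Im0).
      by apply: eq_bigr => f _; rewrite ImZ.
    rewrite Rintegral_sum; last by move=> f; exact: (integrableZl measurableT _ (irf f)).
    rewrite (big_morph (@complex.Im R) ImD Im0).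
    by apply: eq_bigr => f _; rewrite ImZ (RintegralZl _ measurableT (irf f)).
under [RHS]eq_bigr => i _.
  rewrite charfunE (_ : _ +i* _ = \sum_(b : bool) unit_ b * (\int[P]_w r i b w)%:C); last first.
    by rewrite big_bool /=; simpc.
  over.
rewrite bigA_distr_bigA /=; apply: eq_bigr => f _.
by rewrite big_split /= Erf rmorph_prod.
Qed.

End complex_expectation.

(** * Gaussian mixtures of a Levy measure *)

Section levy_measure_sigma_finite.
Context {R : realType}.
Variable nu : {measure set R -> \bar R}.
Hypothesis nu_min : (\int[nu]_(y in `]0%R, +oo[) (Num.min y 1)%:E < +oo)%E.

Let D : set R := `]0, +oo[%classic.

Let mD : measurable D. Proof. exact: measurable_itv. Qed.

(** Tonelli calls for sigma-finiteness. It holds on (0, +oo), where each [1/(n+1), +oo) has finite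
    mass by integrability of min(y, 1). *)
Lemma exists_sigma_finite_restriction :
  exists nuD : {sigma_finite_measure set R -> \bar R},
  forall f : R -> \bar R, measurable_fun setT f -> (forall y, 0 <= f y)%E ->
    (\int[nuD]_y f y = \int[nu]_(y in D) f y)%E.
Proof.
have i0 y : 0 <= (\1_D : R -> R) y by rewrite indicE.
have m0 : measurable_fun setT (\1_D : R -> R) by exact: measurable_indic.
have [N NE] := density_measure nu i0 m0.
have ND A : measurable A -> N A = nu (D `&` A).
  by move=> mA; rewrite NE integral_indic// setIC.
pose An (n : nat) : set R := `[n.+1%:R^-1, +oo[%classic.
have mAn n : measurable (An n) by exact: measurable_itv.
have Anoo n : (nu (D `&` An n) < +oo)%E.
  have mI : measurable_fun setT (\1_(An n) : R -> R) by exact: measurable_indic.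
  have H : forall y, 0 < y -> `|(\1_(An n) : R -> R) y| <= n.+1%:R * Num.min y 1.
    move=> y y0; rewrite indicE; case: (boolP (y \in An n)) => [|_].
      rewrite inE /An/= in_itv/= andbT => yn; rewrite normr1.
      rewrite -ler_pdivrMl// mulr1 le_min yn/=.
      by rewrite invf_le1// ler1n.
    by rewrite normr0 mulr_ge0// le_min (ltW y0) ler01.
  have := integrable_min1 nu_min mI H => /integrableP[_].
  under eq_integral do rewrite /= ger0_norm//.
  by rewrite integral_indic// setIC.
(* Adding the complement of [D], a null set for the restricted measure, makes these sets cover the
   line. *)
pose G n := ~` D `|` An n.
have sf : sigma_finite setT N.
  exists G; last first.
    move=> n; split; first by apply: measurableU => //; exact: measurableC.
    rewrite ND; last by apply: measurableU => //; exact: measurableC.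
    by rewrite setIUr setICr set0U.
  apply/esym/seteqP; split => // y _.
  have [y0|y0] := ltP 0 y; last first.
    exists 0%N => //; left; rewrite /D/= in_itv/= andbT.
    by apply/negP; rewrite -leNgt.
  exists (Num.bound y^-1) => //; right; rewrite /An/= in_itv/= andbT.
  rewrite invf_ple ?posrE// ltW// (lt_le_trans (archi_boundP _))//.
    by rewrite invr_ge0 ltW.
  by rewrite ler_nat.
pose H2 := isSFinite.Build _ _ _ _ (sfinite_measure_sigma_finite sf).
pose H3 := isSigmaFinite.Build _ _ _ _ sf.
pose M : {sigma_finite_measure set R -> \bar R} :=
  HB.pack_for (SigmaFiniteMeasure.type R R) (Measure.sort N) H2 H3.
exists M => f mf f0.
rewrite (@ge0_integral_density _ _ _ nu M (\1_D))//; last by move=> A _; exact: NE.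
rewrite [RHS]integral_mkcond; apply: eq_integral => y _.
by rewrite epatch_indic.
Qed.

End levy_measure_sigma_finite.

Section lebesgue_on_reals.
Context {R : realType}.

(* lebesgue_measure lives on [measurableTypeR R], whose display differs from
   that of the canonical measurable structure of [R]. *)
Lemma exists_lebesgue_real : exists leb : {measure set R -> \bar R},
  (forall A : set R, leb A = lebesgue_measure A) /\
  forall f : R -> \bar R, measurable_fun setT f -> (forall y, 0 <= f y)%E ->
    (\int[leb]_y f y = \int[lebesgue_measure]_y f y)%E.
Proof.
pose idR : measurableTypeR R -> R := fun x => x.
have midR : measurable_fun setT idR.
  by move=> _ B mB; rewrite setTI; exact: mB.
unshelve refine (ex_intro _
  (pushforward (@lebesgue_measure R) idR : {measure set R -> \bar R}) _) => //.
split => // f mf f0; rewrite ge0_integral_pushforward//.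
Qed.

End lebesgue_on_reals.

Section gaussian_kernel.
Context {R : realType}.
Variable sigma : R.
Hypothesis sigma0 : 0 < sigma.

(* gauss_density (sigma ^+ 2 * t) x for t > 0, written without division so
   that joint measurability is immediate. *)
Definition gauss_kernel (t x : R) : R :=
  expR (- (ln (2 * pi * (sigma ^+ 2 * t)) / 2)
        - x ^+ 2 / (2 * sigma ^+ 2) * expR (- ln t)).

Lemma gauss_kernel_ge0 t x : 0 <= gauss_kernel t x.
Proof. exact: expR_ge0. Qed.

Lemma measurable_gauss_kernel :
  measurable_fun setT (fun p : R * R => gauss_kernel p.1 p.2).
Proof.
have mln : measurable_fun setT (@ln R) by exact: measurable_ln.
have mexp := continuous_measurable_fun (@continuous_expR R).
have m1 : measurable_fun setT (fun p : R * R => ln (2 * pi * (sigma ^+ 2 * p.1)) / 2).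
  apply: measurable_funM => //; apply: (measurableT_comp mln).
  by apply: measurable_funM => //; exact: measurable_funM.
have m2 : measurable_fun setT (fun p : R * R => - ln p.1).
  by apply: measurableT_comp => //; exact: (measurableT_comp mln).
have m3 : measurable_fun setT (fun p : R * R => p.2 ^+ 2 / (2 * sigma ^+ 2)).
  by apply: measurable_funM => //; exact: measurable_funX.
apply: (measurableT_comp mexp); apply: measurable_funB.
  exact: measurableT_comp m1.
by apply: measurable_funM => //; exact: (measurableT_comp mexp m2).
Qed.

Let sqrtrE (v : R) : 0 < v -> (Num.sqrt v)^-1 = expR (- (ln v / 2)).
Proof.
move=> v0; rewrite expRN; congr (_^-1).
have H : expR (ln v / 2) ^+ 2 = v.
  by rewrite -expRM_natl mulrC divfK// lnK.
by rewrite -[v in LHS]H sqrtr_sqr ger0_norm// expR_ge0.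
Qed.

Lemma gauss_kernelE t x : 0 < t -> gauss_kernel t x = gauss_density (sigma ^+ 2 * t) x.
Proof.
move=> t0; have v0 : 0 < sigma ^+ 2 * t by rewrite mulr_gt0// exprn_gt0.
rewrite /gauss_kernel /gauss_density expRD -sqrtrE; last first.
  by rewrite !mulr_gt0// pi_gt0.
congr (_ * expR (- _)); rewrite expRN lnK ?posrE//.
by field; rewrite !gt_eqF.
Qed.

Lemma gauss_kernel_normal t x : 0 < t ->
  gauss_kernel t x = normal_pdf 0 (sigma * Num.sqrt t) x.
Proof.
move=> t0; have v0 : 0 < sigma ^+ 2 * t by rewrite mulr_gt0// exprn_gt0.
have s0 : sigma * Num.sqrt t != 0 by rewrite gt_eqF// mulr_gt0// sqrtr_gt0.
rewrite gauss_kernelE// (normal_pdfE _ s0) /gauss_density /normal_peak /normal_fun.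
rewrite subr0 exprMn sqr_sqrtr ?ltW//; congr ((Num.sqrt _)^-1 * expR _).
  have aux (p : R) : 2 * p * (sigma ^+ 2 * t) = sigma ^+ 2 * t * p *+ 2 by ring.
  exact: aux.
rewrite mulNr; congr (- (_ / _)).
have aux (r : R) : 2 * r = r *+ 2 by ring.
exact: aux.
Qed.

Lemma gauss_kernelN t x : gauss_kernel t (- x) = gauss_kernel t x.
Proof. by rewrite /gauss_kernel sqrrN. Qed.

(* For v < 1 the exponential is bounded by e^{-y} <= 2 / y^2. *)
Let gauss_density_le (c v x : R) : 0 < c -> c <= `|x| -> 0 < v ->
  gauss_density v x <= (1 + 8 / c ^+ 4) * Num.min v 1.
Proof.
move=> c0 cx v0; rewrite /gauss_density.
set r := Num.sqrt _; set y := x ^+ 2 / _.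
have r2 : r ^+ 2 = 2 * pi * v by rewrite sqr_sqrtr// !mulr_ge0 ?pi_ge0 ?ltW.
have r0 : 0 < r by rewrite sqrtr_gt0 !mulr_gt0// pi_gt0.
have pi2 := @pi_ge2 R.
have pv1 (p : R) : 2 <= p -> 1 <= v -> 1 <= 2 * p * v by nra.
have pv2 (p : R) : 2 <= p -> v <= 1 -> v ^+ 2 <= 2 * p * v by nra.
have x2 : c ^+ 2 <= x ^+ 2.
  by rewrite -[x ^+ 2]real_normK ?num_real// ler_sqr ?nnegrE// (ltW c0).
have x20 : 0 < x ^+ 2 by apply: lt_le_trans x2; rewrite exprn_gt0.
have y0 : 0 < y by apply: divr_gt0 => //; apply: mulr_gt0.
have c4 : 0 < c ^+ 4 by rewrite exprn_gt0.
have k0 : 0 <= 8 / c ^+ 4 by rewrite divr_ge0// ltW.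
rewrite /Num.min; case: ifPn => [v1|]; last first.
  rewrite -leNgt mulr1 => v1.
  have r1 : 1 <= r.
    by rewrite -(@ler_pXn2r _ 2)// ?nnegrE ?(ltW r0)// r2 expr1n pv1.
  rewrite (@le_trans _ _ 1)//; last by rewrite lerDl.
  apply: mulr_ile1; rewrite ?expR_ge0 ?invr_ge0 ?(ltW r0)//.
    by rewrite invf_le1.
  by rewrite expR_le1 oppr_le0 (ltW y0).
have rv : v <= r.
  by rewrite -(@ler_pXn2r _ 2)// ?nnegrE ?(ltW r0) ?(ltW v0)// r2 pv2// ltW.
have e2 : expR (- y) <= 2 / y ^+ 2.
  have h := @expR_ge1Dxn _ y 1 (ltW y0).
  rewrite expRN invf_ple ?posrE ?expR_gt0//; last first.
    by rewrite divr_gt0// exprn_gt0.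
  rewrite invf_div; apply: le_trans h; rewrite ler_wpDl//.
(* Since y = x^2/(2v), the bound 2/y^2 equals 8 v^2/x^4, whence the constant 8; the prefactor 1/r <=
   1/v then leaves one power of v. *)
have yc : 2 / y ^+ 2 <= 8 * v ^+ 2 / c ^+ 4.
  have -> : y ^+ 2 = x ^+ 4 / (4 * v ^+ 2) by rewrite /y; field; rewrite gt_eqF.
  rewrite invf_div mulrA; have -> : 2 * (4 * v ^+ 2) = 8 * v ^+ 2 by ring.
  have cx4 : c ^+ 4 <= x ^+ 4.
    by rewrite (exprM x 2 2) (exprM c 2 2) ler_sqr ?nnegrE ?sqr_ge0.
  apply: ler_wpM2l; first by rewrite mulr_ge0// sqr_ge0.
  by rewrite lef_pV2 ?posrE// (lt_le_trans c4).
apply: (@le_trans _ _ (v^-1 * (8 * v ^+ 2 / c ^+ 4))).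
  apply: ler_pM; rewrite ?invr_ge0 ?expR_ge0 ?(ltW r0)//.
    by rewrite lef_pV2 ?posrE.
  exact: le_trans e2 yc.
have -> : v^-1 * (8 * v ^+ 2 / c ^+ 4) = 8 / c ^+ 4 * v by field; rewrite !gt_eqF.
by rewrite ler_wpM2r ?(ltW v0)// lerDr.
Qed.

(** Because min(sigma^2 t, 1) <= max(sigma^2, 1) min(t, 1), the kernel is dominated in [t] by a
    function integrable against the Levy measure, uniformly over |x| >= c. *)
Lemma gauss_kernel_le (c t x : R) : 0 < c -> c <= `|x| -> 0 < t ->
  gauss_kernel t x <= (1 + 8 / c ^+ 4) * Num.max (sigma ^+ 2) 1 * Num.min t 1.
Proof.
move=> c0 cx t0; rewrite gauss_kernelE// -mulrA.
have v0 : 0 < sigma ^+ 2 * t by rewrite mulr_gt0// exprn_gt0.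
apply: le_trans (gauss_density_le c0 cx v0) _.
apply: ler_wpM2l; first by rewrite addr_ge0// divr_ge0// exprn_ge0// ltW.
set m := Num.max _ _.
have m1 : 1 <= m by rewrite le_max lexx orbT.
have ms : sigma ^+ 2 <= m by rewrite le_max lexx.
rewrite [Num.min t 1]/Order.min; case: ifPn => t1.
  by rewrite ge_min ler_wpM2r// ltW.
by rewrite mulr1 ge_min m1 orbT.
Qed.

End gaussian_kernel.

Section reflection.
Context {R : realType}.

Lemma ge0_integral_lebesgueN (f : R -> \bar R) : measurable_fun setT f ->
  (forall x, 0 <= f x)%E ->
  (\int[lebesgue_measure]_x f (- x)%R = \int[lebesgue_measure]_x f x)%E.
Proof.
move=> mf f0.
pose opp : measurableTypeR R -> measurableTypeR R := -%R.
have mo : measurable_fun setT opp by exact: oppr_measurable.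
transitivity (\int[pushforward (@lebesgue_measure R) opp]_x f x)%E.
  by rewrite ge0_integral_pushforward.
apply: eq_measure_integral => A mA _.
exact: lebesgue_measureN.
Qed.

End reflection.

Section mixture_density.
Context {R : realType}.
Variables (sigma : R) (nu : {measure set R -> \bar R}).
Hypothesis sigma0 : 0 < sigma.
Hypothesis nu_min : (\int[nu]_(y in `]0%R, +oo[) (Num.min y 1)%:E < +oo)%E.

(** The density is the kernel integrated over [nu]. It is bounded on |x| >= c but may be infinite at
    0, so taking [fine] can change it there only, on a Lebesgue-null set. The integral identity is
    Tonelli. *)
Lemma exists_mixture_density : exists g : R -> R,
  [/\ measurable_fun setT g, forall x, 0 <= g x,
      forall x, g (- x) = g x,
      forall c, 0 < c -> exists K, forall x, c <= `|x| -> g x <= K &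
      forall f : R -> \bar R, measurable_fun setT f -> (forall x, 0 <= f x)%E ->
        (\int[lebesgue_measure]_x (f x * (g x)%:E) =
         \int[nu]_(t in `]0%R, +oo[) \int[lebesgue_measure]_x
           (f x * (gauss_kernel sigma t x)%:E))%E].
Proof.
have [nuD nuDE] := exists_sigma_finite_restriction nu_min.
pose leb : {sigma_finite_measure set (measurableTypeR R) -> \bar R} := @lebesgue_measure R.
have mk : measurable_fun setT (fun p : R * measurableTypeR R => (gauss_kernel sigma p.1 p.2)%:E).
  by apply/measurable_EFinP; exact: measurable_gauss_kernel.
have k0 (p : R * measurableTypeR R) : (0 <= (gauss_kernel sigma p.1 p.2)%:E)%E.
  by rewrite lee_fin gauss_kernel_ge0.
pose h (x : R) : \bar R := (\int[nuD]_t (gauss_kernel sigma t x)%:E)%E.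
have mh : measurable_fun setT (h : measurableTypeR R -> \bar R).
  exact: (@measurable_fun_fubini_tonelli_G _ _ _ _ _ nuD _ mk k0).
have mkx x : measurable_fun setT (fun t => gauss_kernel sigma t x).
  exact: (measurableT_comp (measurable_gauss_kernel sigma) (pair2_measurable x)).
have h0 x : (0 <= h x)%E.
  by apply: integral_ge0 => t _; rewrite lee_fin gauss_kernel_ge0.
pose M : \bar R := (\int[nu]_(y in `]0%R, +oo[) (Num.min y 1)%:E)%E.
have hK c : 0 < c -> exists K, forall x, c <= `|x| -> (h x <= K%:E)%E.
  move=> c0; set a := (1 + 8 / c ^+ 4) * Num.max (sigma ^+ 2) 1.
  have a0 : 0 <= a.
    apply: mulr_ge0; first by rewrite addr_ge0// divr_ge0// exprn_ge0// ltW.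
    by rewrite le_max ler01 orbT.
  have min0 y : 0 < y -> 0 <= Num.min y 1 :> R by move=> y0; rewrite le_min ltW/=.
  have M0 : (0 <= M)%E.
    apply: integral_ge0 => y; rewrite /= in_itv/= andbT => y0.
    by rewrite lee_fin min0.
  have Mfin : M \is a fin_num by rewrite ge0_fin_numE.
  have mm : measurable_fun setT (fun y : R => Num.min y 1).
    by apply: measurable_minr.
  exists (a * fine M) => x cx; rewrite EFinM fineK//.
  have -> : (a%:E * M = \int[nu]_(y in `]0%R, +oo[) (a%:E * (Num.min y 1)%:E))%E.
    rewrite /M [RHS]ge0_integralZl//.
    - by apply/measurable_EFinP; exact: measurable_funTS.
    - by move=> y; rewrite /= in_itv/= andbT => y0; rewrite lee_fin min0.
  rewrite /h nuDE; last 2 first.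
  - exact/measurable_EFinP.
  - by move=> y; rewrite lee_fin gauss_kernel_ge0.
  apply: ge0_le_integral => //.
  - by move=> y _; rewrite lee_fin gauss_kernel_ge0.
  - by apply/measurable_EFinP; exact: measurable_funTS.
  - by apply/measurable_EFinP; apply: measurable_funM => //; exact: measurable_funTS.
  - move=> y; rewrite /= in_itv/= andbT => y0.
    by rewrite lee_fin; exact: gauss_kernel_le.
have hfin x : x != 0 -> h x = (fine (h x))%:E.
  move=> x0; have [|K hxK] := hK `|x|; first by rewrite normr_gt0.
  by rewrite fineK// ge0_fin_numE// (le_lt_trans (hxK x (lexx _))) ?ltry.
exists (fun x => fine (h x)); split.
- exact: measurableT_comp.
- by move=> x; rewrite fine_ge0.
- move=> x; congr fine; apply: eq_integral => t _.
  by rewrite gauss_kernelN.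
- move=> c c0; have [K hcK] := hK c c0; exists K => x cx.
  rewrite -lee_fin -hfin ?hcK//.
  by rewrite -normr_gt0 (lt_le_trans c0).
move=> f mf f0.
have mF : measurable_fun setT (fun p : R * measurableTypeR R =>
    f p.2 * (gauss_kernel sigma p.1 p.2)%:E)%E.
  by apply: emeasurable_funM => //; exact: measurableT_comp.
have F0 (p : R * measurableTypeR R) : (0 <= f p.2 * (gauss_kernel sigma p.1 p.2)%:E)%E.
  by rewrite mule_ge0.
have := @fubini_tonelli _ _ _ _ _ nuD leb _ mF F0.
rewrite /fubini_F/= nuDE; last 2 first.
- exact: (@measurable_fun_fubini_tonelli_F _ _ _ _ _ leb _ mF F0).
- by move=> t; apply: integral_ge0 => x _; exact: (F0 (t, x)).
move=> ->.
apply: (@ge0_ae_eq_integral _ (measurableTypeR R)) => //.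
- apply: emeasurable_funM => //; apply/measurable_EFinP.
  exact: (measurableT_comp (fine_measurable measurableT) mh).
- exact: (@measurable_fun_fubini_tonelli_G _ _ _ _ _ nuD _ mF F0).
- by move=> x _; rewrite mule_ge0// lee_fin fine_ge0.
- by move=> x _; apply: integral_ge0 => t _; exact: (F0 (t, x)).
exists [set 0]; split => //.
  exact: lebesgue_measure_set1.
move=> x; apply: contra_notP => /eqP x0 _.
rewrite -hfin// -ge0_integralZl//.
- exact/measurable_EFinP.
- by move=> t _; rewrite lee_fin gauss_kernel_ge0.
Qed.

End mixture_density.

Section mixture.
Context {R : realType}.
Variables (sigma : R) (nu nus : {measure set R -> \bar R}).
Hypothesis sigma0 : 0 < sigma.
Hypothesis nu_min : (\int[nu]_(y in `]0%R, +oo[) (Num.min y 1)%:E < +oo)%E.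
Hypothesis nusE : forall a b : R, nus `[a, b]%classic =
  (\int[nu]_(t in `]0%R, +oo[) \int[lebesgue_measure]_(x in `[a, b])
     (gauss_density (sigma ^+ 2 * t) x)%:E)%E.

(** [nus] is prescribed on these sets only, so they have to serve as the generating pi-system. *)
Let closed_itvs : set (set R) := [set A | exists a b : R, A = `[a, b]%classic].

Let closed_itvsE : (measurable : set (set R)) = <<s closed_itvs >>.
Proof.
apply/seteqP; split; last first.
  apply: smallest_sub; first exact: sigma_algebra_measurable.
  by move=> _ [a [b ->]]; exact: measurable_itv.
have -> : (measurable : set (set R)) = <<s @RGenCInfty.G R >>.
  exact: RGenCInfty.measurableE.
apply: smallest_sub; first exact: smallest_sigma_algebra.
move=> _ [x ->].
have -> : `[x, +oo[%classic = \bigcup_n `[x, x + n%:R]%classic.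
  apply/seteqP; split => y /=; last first.
    by move=> [m _] /=; rewrite !in_itv/= andbT => /andP[].
  rewrite in_itv/= andbT => xy; exists (Num.bound (y - x)) => //=.
  rewrite in_itv/= xy/= -lerBlDl ltW// archi_boundP//.
  by rewrite subr_ge0.
have [_ _] := smallest_sigma_algebra [set: R] closed_itvs; apply => m.
by apply: sub_gen_smallest; exists x, (x + m%:R).
Qed.

(** [nus] and the measure with density [g] agree on compact intervals. Uniqueness of measures asks
    for a countable cover by such intervals of finite mass, and intervals around 0 may have infinite
    mass. *)
Lemma mixture_symmetric_density : exists g : R -> R,
  [/\ measurable_fun setT g, forall x, 0 <= g x, forall x, g (- x) = g x,
      forall f : R -> \bar R, measurable_fun setT f -> (forall x, 0 <= f x)%E ->
        (\int[nus]_x f x = \int[lebesgue_measure]_x (f x * (g x)%:E))%E &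
      forall f : R -> \bar R, measurable_fun setT f -> (forall x, 0 <= f x)%E ->
        (\int[nus]_x f x = \int[nu]_(t in `]0%R, +oo[) \int[lebesgue_measure]_x
           (f x * (gauss_kernel sigma t x)%:E))%E].
Proof.
have [g [mg g0 gN gK gE]] := exists_mixture_density sigma0 nu_min.
have [leb [lebE lebI]] := @exists_lebesgue_real R.
have [N NE] := density_measure leb g0 mg.
have Nitv a b : nus `[a, b]%classic = N `[a, b]%classic.
  have mi : measurable (`[a, b]%classic : set R) by exact: measurable_itv.
  have i0 (x : R) : (0 <= ((\1_(`[a, b]%classic : set R) x : R))%:E)%E.
    by rewrite lee_fin indicE.
  have mi' : measurable_fun setT (fun x : R => ((\1_(`[a, b]%classic : set R) x : R))%:E).
    by apply/measurable_EFinP; exact: measurable_indic.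
  have patchE (h : R -> R) : (fun x => (h x)%:E) \_ `[a, b]%classic =
      (fun x => ((\1_(`[a, b]%classic : set R) x : R))%:E * (h x)%:E)%E.
    by apply/funext => x; rewrite epatch_indic muleC.
  rewrite NE integral_mkcond patchE lebI; last 2 first.
  - by apply: emeasurable_funM => //; exact/measurable_EFinP.
  - by move=> x; rewrite mule_ge0 ?i0 ?lee_fin.
  apply: etrans (esym (gE _ mi' i0)); rewrite nusE.
  apply: eq_integral => t; rewrite inE/= in_itv/= andbT => t0.
  rewrite integral_mkcond patchE; apply: eq_integral => x _.
  by rewrite gauss_kernelE.
have Nfin a b K : (forall x, a <= x -> x <= b -> g x <= K) ->
    (nus `[a, b]%classic < +oo)%E.
  move=> gKab; rewrite Nitv NE.
  apply: (@le_lt_trans _ _ (\int[leb]_(x in `[a, b]) K%:E)%E).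
    apply: ge0_le_integral => //.
    - by move=> x _; rewrite lee_fin.
    - by apply/measurable_EFinP; exact: measurable_funTS.
    - by move=> x /=; rewrite in_itv/= lee_fin => /andP[]; exact: gKab.
  rewrite integral_cst//; have [ab|ba] := leP a b; last first.
    by rewrite set_itv_ge ?measure0 ?mule0 ?ltry// bnd_simp -ltNge.
  rewrite [X in (_ * X)%E]lebE lebesgue_measure_itv/= lte_fin.
  by case: ifPn => _; rewrite -?EFinB -?EFinM ltry.
have nusN A : measurable A -> nus A = N A.
  (* The cover stays away from punctured neighbourhoods of 0: {0} for k = 0, then [1/(k+1), k+1] for
     odd k and intervals on the negative side for even k. *)
  pose G (k : nat) : set R := if k == 0%N then `[0, 0]%classic
    else if odd k then `[k.+1%:R^-1, k.+1%:R]%classic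
    else `[- k.+1%:R, - k.+1%:R^-1]%classic.
  apply: (measure_unique closed_itvs G closed_itvsE) => //.
  - move=> _ _ [a [b ->]] [a' [b' ->]]; exists (Num.max a a'), (Num.min b b').
    apply/seteqP; split => x /=; rewrite !in_itv/= ge_max le_min.
      by move=> [/andP[-> ->] /andP[-> ->]].
    by move=> /andP[/andP[-> ->] /andP[-> ->]].
  - move=> k; rewrite /G; case: ifPn => _; first by exists 0, 0.
    by case: ifPn => _; [exists k.+1%:R^-1, k.+1%:R|exists (- k.+1%:R), (- k.+1%:R^-1)].
  - apply/seteqP; split => // x _.
    have [->|x0] := eqVneq x 0; first by exists 0%N; rewrite // /G/= in_itv/= lexx.
    have x0' : 0 < `|x| by rewrite normr_gt0.
    (* [m] dominates |x| and 1/|x|, so every interval of index at least m on the side of x contains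
       x; 2m + 1 and 2m + 2 have the two parities. *)
    pose m := maxn (Num.bound `|x|) (Num.bound `|x|^-1).
    have [m1 m2] : `|x| <= m%:R /\ `|x|^-1 <= m%:R.
      split; [apply: le_trans (ltW (archi_boundP (normr_ge0 x))) _
             |apply: le_trans (ltW (archi_boundP _)) _; rewrite ?invr_ge0//];
      by rewrite ler_nat ?leq_maxl ?leq_maxr.
    have bnd k : (m <= k)%N -> `|x| <= k.+1%:R /\ k.+1%:R^-1 <= `|x|.
      move=> mk; have mk' : m%:R <= k.+1%:R :> R by rewrite ler_nat (leq_trans mk).
      split; first exact: le_trans m1 mk'.
      by rewrite invf_ple ?posrE// (le_trans m2).
    have mm : (m <= m.*2)%N by rewrite -addnn leq_addr.
    have [xp|xn] := leP 0 x.
      exists m.*2.+1 => //; rewrite /G/= odd_double/= in_itv/=.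
      have := bnd m.*2.+1 (leqW mm).
      by rewrite (ger0_norm xp) => -[-> ->].
    exists m.*2.+2 => //; rewrite /G/= odd_double/= in_itv/=.
    have := bnd m.*2.+2 (leqW (leqW mm)).
    by rewrite (ltr0_norm xn) lerNl lerNr => -[-> ->].
  - by move=> _ [a [b ->]]; exact: Nitv.
  - move=> k; rewrite /G.
    case: ifPn => _; first by apply: (Nfin _ _ (g 0)) => x x0 x1;
      rewrite (@le_anti _ _ x 0) ?x0 ?x1.
    have k0 : 0 < k.+1%:R^-1 :> R by rewrite invr_gt0.
    have [K gK'] := gK k.+1%:R^-1 k0.
    case: ifPn => _; apply: (Nfin _ _ K) => x xa xb; apply: gK'.
      by rewrite (le_trans xa)// ler_norm.
    by rewrite -normrN (le_trans _ (ler_norm _))// lerNr.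
have nusI (f : R -> \bar R) : measurable_fun setT f -> (forall x, 0 <= f x)%E ->
    (\int[nus]_x f x = \int[lebesgue_measure]_x (f x * (g x)%:E))%E.
  move=> mf f0.
  rewrite (@ge0_integral_density _ _ _ leb nus g f mg g0 _ mf f0); last first.
    by move=> A mA; rewrite nusN.
  rewrite lebI//; first by apply: emeasurable_funM => //; exact/measurable_EFinP.
  by move=> x; rewrite mule_ge0// lee_fin.
by exists g; split => // f mf f0; rewrite nusI// gE.
Qed.

End mixture.

(** * Levy exponent of the mixture *)

Section mixture_exponent.
Context {R : realType}.
Variables (sigma : R) (nu nus : {measure set R -> \bar R}).
Hypothesis sigma0 : 0 < sigma.
Hypothesis nu_min : (\int[nu]_(y in `]0%R, +oo[) (Num.min y 1)%:E < +oo)%E.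
Hypothesis nusE : forall a b : R, nus `[a, b]%classic =
  (\int[nu]_(t in `]0%R, +oo[) \int[lebesgue_measure]_(x in `[a, b])
     (gauss_density (sigma ^+ 2 * t) x)%:E)%E.

Let setC0_integral (f : R -> R) : f 0 = 0 ->
  (\int[nus]_(x in [set~ 0%R]) (f x)%:E = \int[nus]_x (f x)%:E)%E.
Proof.
move=> f0; rewrite integral_mkcond; apply: eq_integral => x _.
rewrite patchE; case: ifPn => // /negP; rewrite in_setE /= => xN.
have -> : x = 0 by apply/eqP/negPn/negP => /eqP /xN.
by rewrite f0.
Qed.

(** An odd integrand meets an even density: reflection exchanges its positive and negative parts,
    whose integrals are equal as extended reals. [fine] maps their difference to 0, in the infinite
    case too. *)
Lemma mixture_sin xi :
  \int[nus]_(x in [set~ 0])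
    (sin (xi * x) - xi * x * \1_[set z : R | `|z| <= 1] x) = 0.
Proof.
have [g [mg g0 gN nusI _]] := mixture_symmetric_density sigma0 nu_min nusE.
pose f x : R := sin (xi * x) - xi * x * \1_[set z : R | `|z| <= 1] x.
have f0 : f 0 = 0 by rewrite /f !mulr0 sin0 mul0r subr0.
have fN x : f (- x) = - f x.
  rewrite /f !mulrN sinN mulNr opprD; congr (_ + - - (_ * _)).
  rewrite !indicE; congr (_%:R); congr nat_of_bool.
  by apply/idP/idP; rewrite !inE /= normrN.
have mball : measurable [set z : R | `|z| <= 1].
  have -> : [set z : R | `|z| <= 1] = `[-1, 1]%classic.
    by apply/seteqP; split => z /=; rewrite in_itv/= ler_norml.
  exact: measurable_itv.
have mf : measurable_fun setT f.
  apply: measurable_funB; first exact: measurable_sinM.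
  by apply: measurable_funM => //; exact: measurable_indic.
have mfE : measurable_fun setT (EFin \o f) by exact/measurable_EFinP.
rewrite /Rintegral (setC0_integral f0) integralE.
set a := (X in (X - _)%E); set b := (X in (_ - X)%E).
suff -> : b = a by rewrite /a; case: (integral _ _ _) => [r| |]//=; rewrite subrr.
have mp : measurable_fun setT (EFin \o f)^\+%E by exact: measurable_funepos.
have mn : measurable_fun setT (EFin \o f)^\-%E by exact: measurable_funeneg.
rewrite /a /b (nusI _ mp)// (nusI _ mn)//.
rewrite -ge0_integral_lebesgueN; last 2 first.
- by apply: emeasurable_funM => //; exact/measurable_EFinP.
- by move=> x; rewrite mule_ge0 ?lee_fin.
apply: eq_integral => x _; rewrite gN; congr (_ * _)%E.
by rewrite funeposE funenegE /= fN opprK.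
Qed.

(** The sign is reversed first, because 1 - cos(xi x) is nonnegative and the mixture formula holds
    for such functions. The inner integral is then 1 minus the characteristic function of N(0,
    sigma^2 t) at xi. *)
Lemma mixture_cos xi :
  \int[nus]_(x in [set~ 0]) (cos (xi * x) - 1) =
  \int[nu]_(t in `]0, +oo[%classic)
    (expR (- (sigma ^+ 2 * xi ^+ 2 / 2 * t)) - 1).
Proof.
have [g [mg g0 gN _ nusI]] := mixture_symmetric_density sigma0 nu_min nusE.
pose f (x : R) : R := 1 - cos (xi * x).
have f0 x : 0 <= f x by rewrite subr_ge0 cos_le1.
have f2 x : f x <= 2 by rewrite /f; have := cos_geN1 (xi * x); lra.
have cf : continuous f.
  move=> x; apply: (@cvgB _ R^o); first exact: cvg_cst.
  apply: (@continuous_comp _ _ _ (fun x : R => xi * x) cos).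
    exact: mulrl_continuous.
  exact: continuous_cos.
have mf := continuous_measurable_fun cf.
have fE t : 0 < t -> (\int[lebesgue_measure]_x ((f x)%:E * (gauss_kernel sigma t x)%:E) =
    (1 - expR (- (sigma ^+ 2 * xi ^+ 2 / 2 * t)))%:E)%E.
  move=> t0; have s0 : 0 < sigma * Num.sqrt t by rewrite mulr_gt0// sqrtr_gt0.
  transitivity (gauss_smooth f (sigma * Num.sqrt t) 0)%:E.
    rewrite (gauss_smoothE cf f0 f2)//; apply: eq_integral => x _.
    by rewrite gauss_kernel_normal.
  congr EFin; rewrite /gauss_smooth /f.
  under eq_Rintegral do rewrite add0r mulrA.
  rewrite RintegralB//; last 2 first.
  - exact: finite_measure_integrable_cst.
  - apply: (bounded_integrable (normal_prob 0 1) (measurable_cosM _)) => x.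
    exact: cos_max.
  rewrite (probability_Rintegral_cst (normal_prob 0 1)) Rintegral_normal_cos.
  congr (1 - expR (- _)).
  by rewrite !exprMn sqr_sqrtr ?ltW//; ring.
rewrite /Rintegral (@setC0_integral (fun x => cos (xi * x) - 1)); last first.
  by rewrite mulr0 cos0 subrr.
congr fine.
transitivity (- \int[nus]_x (f x)%:E)%E.
  rewrite -integral_ge0N; last by move=> x _; rewrite lee_fin.
  by apply: eq_integral => x _; rewrite -EFinN opprB.
rewrite nusI; last 2 first.
- exact/measurable_EFinP.
- by move=> x; rewrite lee_fin.
rewrite -integral_ge0N; last first.
  by move=> t _; apply: integral_ge0 => x _; rewrite mule_ge0// lee_fin ?f0 ?gauss_kernel_ge0.
apply: eq_integral => t; rewrite inE/= in_itv/= andbT => t0.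
by rewrite fE// -EFinN opprB.
Qed.

End mixture_exponent.

(** By evenness the exponent is real, and it is the Laplace exponent of the subordinator at [s]: the
    Gaussian part gives -gamma s and the jump part the integral of e^{-sy} - 1. *)
Lemma symmetric_levy_charfun d (Omega : measurableType d) (R : realType)
    (P : probability Omega R) (X : R -> Omega -> R) (T sigma gamma : R)
    (nu nus : {measure set R -> \bar R}) :
  0 < sigma ->
  (\int[nu]_(y in `]0%R, +oo[) (Num.min y 1)%:E < +oo)%E ->
  (forall a b : R, nus `[a, b]%classic =
    (\int[nu]_(t in `]0%R, +oo[) \int[lebesgue_measure]_(x in `[a, b])
       (gauss_density (sigma ^+ 2 * t) x)%:E)%E) ->
  levy_khinchin_triplet P T X 0 (sigma ^+ 2 * gamma) nus ->
  forall t xi, t \in `[0, T] -> let s := sigma ^+ 2 * xi ^+ 2 / 2 in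
  charfun P (X t) xi =
  (expR (t * (- (gamma * s) +
     \int[nu]_(y in `]0, +oo[%classic) (expR (- (s * y)) - 1))))%:C.
Proof.
move=> sigma0 nu_min nusE XE t xi tT s; rewrite XE//.
set psi := \int[nu]_(y in _) _.
have -> : cintegral nus [set~ 0] (fun y =>
    cexp ('i%C * (xi * y)%:C) - 1
    - 'i%C * (xi * y * \1_[set z : R | `|z| <= 1] y)%:C) = psi%:C.
  rewrite /cintegral; congr (_ +i* _).
    rewrite /psi -(mixture_cos sigma0 nu_min nusE).
    by apply: eq_Rintegral => y _; rewrite cexp_i /cis /=; lra.
  rewrite -[RHS](mixture_sin sigma0 nu_min nusE xi).
  by apply: eq_Rintegral => y _; rewrite cexp_i /cis /=; lra.
rewrite mul0r mulr0 sub0r.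
have -> : - (sigma ^+ 2 * gamma / 2 * xi ^+ 2)%:C + psi%:C = (- (gamma * s) + psi)%:C.
  by rewrite -rmorphN -rmorphD /s; congr (_ + _)%:C; field.
by rewrite -rmorphM cexpE cos0 sin0 mulr1 mulr0.
Qed.

(** * Subordination of a random field *)

Section freezing.
Context d (Omega : measurableType d) (R : realType) (P : probability Omega R).
Variables (n : nat) (W : 'rV[R]_n -> Omega -> R) (X : 'I_n -> Omega -> R).

(** With mesh 1/(N+1), this many points per axis cover [0, N+1): the grid refines and grows at the
    same time. *)
Definition grid_size (N : nat) := (N.+1 ^ 2)%N.

Definition grid_cell (N : nat) (f : {ffun 'I_n -> 'I_(grid_size N)}) : set Omega :=
  \bigcap_(k in [set: 'I_n])
    X k @^-1` `[(f k)%:R / N.+1%:R, (f k).+1%:R / N.+1%:R[%classic.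

Definition grid_point (N : nat) (f : {ffun 'I_n -> 'I_(grid_size N)}) : 'rV[R]_n :=
  \row_k ((f k)%:R / N.+1%:R).

(* Phi evaluated at the grid point below X(w), and 0 when X(w) lies outside of
   the grid: a finite sum, hence no joint measurability of Phi is involved. *)
Definition freeze (N : nat) (Phi : 'rV[R]_n -> Omega -> R) (w : Omega) : R :=
  \sum_(f : {ffun 'I_n -> 'I_(grid_size N)})
    \1_(grid_cell f) w * Phi (grid_point f) w.

Let cellE N f w : @grid_cell N f w <->
  forall k, (f k)%:R <= N.+1%:R * X k w < (f k).+1%:R.
Proof.
have N0 : 0 < N.+1%:R :> R by rewrite ltr0n.
have E k j : (X k @^-1` `[j%:R / N.+1%:R, j.+1%:R / N.+1%:R[%classic) w <->
    j%:R <= N.+1%:R * X k w < j.+1%:R.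
  by rewrite /= in_itv/= ler_pdivrMr// ltr_pdivlMr// (mulrC N.+1%:R).
by split => [H k|H k _]; [apply/E; exact: H|apply/E].
Qed.

Lemma orthant_grid_point N f : orthant (@grid_point N f).
Proof. by move=> k; rewrite mxE divr_ge0. Qed.

Lemma freezeE N (f : {ffun 'I_n -> 'I_(grid_size N)}) w Phi :
  grid_cell f w -> freeze N Phi w = Phi (grid_point f) w.
Proof.
move=> fw; rewrite /freeze (bigD1 f)//= big1 ?addr0; last first.
  move=> g gf; rewrite indicE memNset ?mul0r// => gw.
  move/eqP: gf; apply; apply/ffunP => k; apply/val_inj => /=.
  have /cellE/(_ k) hf := fw; have /cellE/(_ k) hg := gw.
  have x0 : 0 <= N.+1%:R * X k w by apply: le_trans (proj1 (andP hf)).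
  by move: hf hg; rewrite -!truncn_eq// => /eqP <- /eqP.
by rewrite indicE mem_set// mul1r.
Qed.

Lemma freeze_norm_le N Phi M w : 0 <= M ->
  (forall x, orthant x -> `|Phi x w| <= M) -> `|freeze N Phi w| <= M.
Proof.
move=> M0 PM; have [[f fw]|fN] := pselect (exists f, @grid_cell N f w).
  by rewrite (freezeE _ fw); exact/PM/orthant_grid_point.
rewrite /freeze big1 ?normr0// => f _; rewrite indicE memNset ?mul0r// => fw.
by apply: fN; exists f.
Qed.

Let ex_cell N w : (forall k, 0 <= X k w) -> (forall k, X k w < N.+1%:R) -> exists f, @grid_cell N f w.
Proof.
move=> X0 XN.
have N0 : 0 < N.+1%:R :> R by rewrite ltr0n.
have tr k : (Num.truncn (N.+1%:R * X k w) < grid_size N)%N.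
  rewrite -(ltr_nat R); have NX0 : 0 <= N.+1%:R * X k w by rewrite mulr_ge0.
  have /andP[h _] := truncn_itv NX0; apply: le_lt_trans h _.
  by rewrite /grid_size natrX expr2 ltr_pM2l.
exists [ffun k => Ordinal (tr k)]; apply/cellE => k; rewrite ffunE /=.
by apply: truncn_itv; rewrite mulr_ge0.
Qed.

(** Once N + 1 exceeds all coordinates, the point falls into a cell whose lower corner is within
    1/(N+1) of it. Corners lie in the orthant, so continuity relative to the orthant applies. *)
Lemma cvg_freeze Phi w : (forall k, 0 <= X k w) ->
  {within @orthant R n, continuous (fun x => Phi x w)} ->
  freeze N Phi w @[N --> \oo] --> Phi (\row_k X k w) w.
Proof.
move=> X0 cPhi; pose x : 'rV[R]_n := \row_k X k w.
have ox : orthant x by move=> k; rewrite mxE.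
have /subspace_continuousP/(_ x ox) := cPhi.
move=> /cvgrPdist_lt cx; apply/cvgrPdist_lt => e e0.
have /nbhs_ballP[r /= r0 rx] := cx e e0.
(* One threshold for two purposes: N + 1 > b yields both a cell containing the point and a mesh
   below r. *)
pose b := (\sum_k X k w + r^-1).
have bX k : X k w <= b.
  rewrite /b (bigD1 k)//= -addrA lerDl; apply: addr_ge0.
    by apply: sumr_ge0.
  by rewrite invr_ge0 ltW.
near=> N.
have bN : b < N.+1%:R.
  apply: lt_le_trans (_ : N%:R <= _); last by rewrite ler_nat.
  by near: N; exact: nbhs_infty_gtr.
have XN k : X k w < N.+1%:R by rewrite (le_lt_trans (bX k)).
have rN : N.+1%:R^-1 < r.
  rewrite invf_plt ?posrE//; apply: le_lt_trans bN.
  by rewrite /b lerDr sumr_ge0.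
have [f fw] := ex_cell X0 XN.
rewrite (freezeE _ fw); apply: rx; last exact: orthant_grid_point.
split => // i k; rewrite /ball/= ord1 !mxE.
have /cellE/(_ k)/andP[h1 h2] := fw.
have N0 : 0 < N.+1%:R :> R by rewrite ltr0n.
apply: le_lt_trans rN.
rewrite ler_norml; apply/andP; split.
  by rewrite (@le_trans _ _ 0)// ?oppr_le0 ?invr_ge0// subr_ge0 ler_pdivrMr// mulrC.
have h3 : X k w < (f k).+1%:R / N.+1%:R by rewrite ltr_pdivlMr// mulrC.
by rewrite lerBlDr (le_trans (ltW h3))// -(natr1 (f k)) mulrDl mul1r addrC.
Unshelve. all: by end_near. Qed.

Variables (GW GX : set (set Omega)).
Hypotheses (iWX : independent P (fun b : bool => if b then <<s GW >> else <<s GX >>))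
  (mW : forall x, orthant x -> measurable_fun setT (W x))
  (mX : forall k, measurable_fun setT (X k))
  (GW_W : forall x (B : set R), orthant x -> measurable B -> <<s GW >> (W x @^-1` B))
  (GX_X : forall k (B : set R), measurable B -> <<s GX >> (X k @^-1` B))
  (X_ge0 : \forall w \ae P, forall k, 0 <= X k w).

Lemma measurable_grid_cell N f : measurable (@grid_cell N f).
Proof.
apply: fin_bigcap_measurable; first exact: finite_finset.
move=> k _; rewrite -[Y in measurable Y]setTI; apply: mX => //.
Qed.

Let GX_cell N f : <<s GX >> (@grid_cell N f).
Proof.
apply: (@fin_bigcap_measurable _ (g_sigma_algebraType GX)).
  exact: finite_finset.
by move=> k _; exact: GX_X.
Qed.

Lemma measurable_freeze N Phi :
  (forall x, orthant x -> measurable_fun setT (Phi x)) ->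
  measurable_fun setT (freeze N Phi).
Proof.
move=> mPhi; apply: measurable_sum => f; apply: measurable_funM.
  by apply: measurable_indic; exact: measurable_grid_cell.
exact/mPhi/orthant_grid_point.
Qed.

Lemma measurable_subordinated : measure_is_complete P ->
  (\forall w \ae P, {within @orthant R n, continuous (fun x => W x w)}) ->
  measurable_fun setT (fun w => W (\row_k X k w) w).
Proof.
move=> cP cW.
have [E [mE E0 EP]] := filterI X_ge0 cW.
(* The factor [I] vanishes on the exceptional event, so that the convergence holds at every
   outcome. *)
pose I : Omega -> R := \1_(~` E).
have mI : measurable_fun setT I by apply: measurable_indic; exact: measurableC.
have IE w : ~ E w -> I w = 1 by move=> Ew; rewrite /I indicE mem_set.
apply/measurable_EFinP.
apply: (@ae_measurable_fun _ _ _ P cP setT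
  (EFin \o (fun w => I w * W (\row_k X k w) w))).
  exists E; split => // w /= H; apply: contrapT => Ew; apply: H => _.
  by rewrite IE// mul1r.
apply/measurable_EFinP.
apply: (@measurable_fun_cvg _ _ _ _ (fun N w => I w * freeze N W w)).
  by move=> N; apply: measurable_funM => //; exact: measurable_freeze.
move=> w _; have [Ew|Ew] := pselect (E w).
  rewrite /I indicE memNset//.
  by rewrite mul0r; under eq_fun do rewrite mul0r; exact: cvg_cst.
have [X0 cw] : (forall k, 0 <= X k w) /\
    {within @orthant R n, continuous (fun x => W x w)}.
  by apply: contrapT => H; apply: Ew; exact: EP.
by apply: cvgM; [exact: cvg_cst|exact: cvg_freeze].
Qed.

Lemma freezing_mean (g : R -> R) (G : 'rV[R]_n -> R) (M : nat) :
  measurable_fun setT (fun w => W (\row_k X k w) w) ->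
  (\forall w \ae P, {within @orthant R n, continuous (fun x => W x w)}) ->
  continuous g -> (forall x, `|g x| <= M%:R) ->
  {within @orthant R n, continuous G} ->
  (forall x, orthant x -> G x = \int[P]_w g (W x w)) ->
  measurable_fun setT (fun w => G (\row_k X k w)) ->
  \int[P]_w g (W (\row_k X k w) w) = \int[P]_w G (\row_k X k w).
Proof.
move=> mL cW cg gM cG GE mGX.
have mg := continuous_measurable_fun cg.
have M0 : 0 <= M%:R :> R by [].
have mgW x : orthant x -> measurable_fun setT (fun w => g (W x w)).
  by move=> ox; exact: (measurableT_comp mg (mW ox)).
have GM x : orthant x -> `|G x| <= M%:R.
  move=> ox; rewrite GE//.
  exact: (probability_Rintegral_le P (mgW x ox) (fun w => gM (W x w))).
have step N : \int[P]_w freeze N (fun x w => g (W x w)) w =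
    \int[P]_w freeze N (fun x _ => G x) w.
  rewrite /freeze !Rintegral_sum; last 2 first.
  - move=> f; apply: (bounded_integrable P (M := M%:R)).
      by apply: measurable_funM => //; apply: measurable_indic; exact: measurable_grid_cell.
    move=> w; rewrite normrM indicE (le_trans _ (GM _ (orthant_grid_point f)))//.
    by case: (_ \in _); rewrite ?normr1 ?normr0 ?mul1r ?mul0r.
  - move=> f; apply: (bounded_integrable P (M := M%:R)).
      apply: measurable_funM; first by apply: measurable_indic; exact: measurable_grid_cell.
      exact/mgW/orthant_grid_point.
    move=> w; rewrite normrM indicE (le_trans _ (gM (W (grid_point f) w)))//.
    by case: (_ \in _); rewrite ?normr1 ?normr0 ?mul1r ?mul0r.
  apply: eq_bigr => f _.
  (* The two factors carry the boolean index of the independence hypothesis; M + 1 bounds both [g]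
     and the indicator. *)
  pose Y (b : bool) w : R :=
    if b then g (W (grid_point f) w) else \1_(grid_cell f) w.
  transitivity (\int[P]_w \prod_b Y b w).
    by apply: eq_Rintegral => w _; rewrite big_bool /= mulrC.
  rewrite (@independent_Rintegral_prod _ _ _ P _ _ iWX Y M.+1); last 3 first.
  - case; first exact/mgW/orthant_grid_point.
    by apply: measurable_indic; exact: measurable_grid_cell.
  - case=> B mB.
      rewrite -[_ @^-1` _]/(W (grid_point f) @^-1` (g @^-1` B)).
      apply: GW_W; first exact: orthant_grid_point.
      by rewrite -[Z in measurable Z]setTI; exact: mg.
    rewrite -[_ @^-1` _]/(\1_(grid_cell f) @^-1` B) preimage_indic.
    have : @measurable _ (g_sigma_algebraType GX) (grid_cell f) := GX_cell f.
    move=> mc; change (@measurable _ (g_sigma_algebraType GX)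
      (if 1 \in B then if 0 \in B then setT else grid_cell f
       else if 0 \in B then ~` grid_cell f else set0)).
    case: ifP => _; case: ifP => _ //.
    exact: measurableC.
  - case=> w; first by rewrite (le_trans (gM _))// ler_nat.
    by rewrite /Y indicE; case: (_ \in _); rewrite ?normr1 ?normr0 ?ler1n.
  rewrite big_bool /= -GE; last exact: orthant_grid_point.
  have ic : P.-integrable setT (EFin \o (\1_(grid_cell f) : Omega -> R)).
    apply: (bounded_integrable P (M := 1)).
      by apply: measurable_indic; exact: measurable_grid_cell.
    by move=> w; rewrite indicE; case: (_ \in _); rewrite ?normr1 ?normr0.
  by rewrite (RintegralZr _ measurableT ic) mulrC.
have lim1 : \int[P]_w freeze N (fun x w => g (W x w)) w @[N --> \oo] -->
    \int[P]_w g (W (\row_k X k w) w).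
  apply: (bounded_cvg_Rintegral (M := M%:R)).
  - by move=> N; exact: measurable_freeze.
  - exact: (measurableT_comp mg mL).
  - by move=> N w; apply: freeze_norm_le => // x ox; exact: gM.
  - apply: filterS2 X_ge0 cW => w X0 cw.
    apply: (@cvg_freeze (fun x w => g (W x w)) w X0).
    by move=> x; exact: (continuous_comp (cw x) (cg _)).
have lim2 : \int[P]_w freeze N (fun x w => g (W x w)) w @[N --> \oo] -->
    \int[P]_w G (\row_k X k w).
  under eq_fun do rewrite step.
  apply: (bounded_cvg_Rintegral (M := M%:R)) => //.
  - by move=> N; apply: measurable_freeze => x _; exact: measurable_cst.
  - by move=> N w; apply: freeze_norm_le => // x ox; exact: GM.
  - by apply: filterS X_ge0 => w X0; exact: (@cvg_freeze (fun x _ => G x)).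
exact: (cvg_unique _ lim1 lim2).
Qed.

End freezing.

(** * Comparison of the two characteristic functions *)

Theorem corollary4p7 (R : realType) (disp : measure_display)
  (Omega : measurableType disp) (P : probability Omega R)
  (n : nat) (T : 'I_n -> R) (sigma : R)
  (W : 'rV[R]_n -> Omega -> R)
  (l ltilde : 'I_n -> R -> Omega -> R) (gamma : 'I_n -> R)
  (nu nusharp : 'I_n -> {measure set R -> \bar R})
  (P_complete : measure_is_complete P)
  (n_ge2 : (2 <= n)%N)
  (T_gt0 : forall k, 0 < T k)
  (sigma_gt0 : 0 < sigma)
  (W_measurable : jointly_measurable W)
  (W_gaussian : gaussian_field P (@orthant R n) W)
  (W_zero_mean : forall x, orthant x -> ('E_P[W x] = 0)%E)
  (W_continuous :
    \forall w \ae P, {within @orthant R n, continuous (fun x => W x w)})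
  (W_charfun : forall (xi : R) (x : 'rV[R]_n), orthant x ->
    charfun P (W x) xi =
    cexp (- (2^-1 * sigma ^+ 2 * xi ^+ 2 * \sum_(k < n) x 0 k))%:C)
  (l_subordinator : forall k, levy_subordinator P (T k) (l k))
  (l_triplet : forall k, subordinator_triplet P (T k) (l k) (gamma k) (nu k))
  (l_independent :
    independent P (fun k : 'I_n => sigma_gen `[0, T k]%classic (l k)))
  (l_W_independent : independent P (fun b : bool =>
    if b then sigma_gen (@orthant R n) W
    else sigma_gen [set kt : 'I_n * R | kt.2 \in `[0, T kt.1]]
                   (fun kt => l kt.1 kt.2)))
  (nusharpE : forall k (a b : R),
    nusharp k `[a, b]%classic =
    (\int[nu k]_(t in `]0%R, +oo[)
       \int[lebesgue_measure]_(x in `[a, b])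
         (gauss_density (sigma ^+ 2 * t) x)%:E)%E)
  (ltilde_levy : forall k, levy_process P (T k) (ltilde k))
  (* The Gaussian part of ltilde k has variance sigma^2 gamma_k per unit of
     time, i.e. it contributes - (sigma^2 gamma_k / 2) xi^2 to the exponent. *)
  (ltilde_triplet : forall k,
    levy_khinchin_triplet P (T k) (ltilde k)
      0 (sigma ^+ 2 * gamma k) (nusharp k))
  (ltilde_independent :
    independent P (fun k : 'I_n => sigma_gen `[0, T k]%classic (ltilde k))) :
  forall x : 'I_n -> R, (forall k, x k \in `[0, T k]) ->
    eq_in_law P (subordinated_field W l x)
                (fun w => \sum_(k < n) ltilde k (x k) w).
Proof.
move=> x xT.
pose X k w := l k (x k) w.
have mX k : measurable_fun setT (X k) by have [[+ _ _ _ _] _] := l_subordinator k; exact.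
have x0 k : 0 <= x k by have := xT k; rewrite in_itv/= => /andP[].
have X_ge0k k : \forall w \ae P, 0 <= X k w.
  have [[_ l0 _ _ _] lmono] := l_subordinator k.
  apply: filterS2 l0 lmono => w l0 /(_ 0 (x k) (lexx 0) (x0 k)).
  by have := xT k; rewrite in_itv/= => /andP[_ xk] /(_ xk); rewrite l0.
have X_ge0 : \forall w \ae P, forall k, 0 <= X k w.
  exact: filter_forall.
have mW y : orthant y -> measurable_fun setT (W y).
  (* Measurability of a single W(y) is the one-dimensional case of the Gaussian hypothesis, with
     coefficient 1. *)
  move=> oy; have [mWy _] := W_gaussian 1%N (fun=> y) (fun=> oy) (fun=> 1).
  have -> : W y = (fun w => \sum_(j < 1) 1 * W y w) by apply/funext => w; rewrite big_ord1 mul1r.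
  exact: mWy.
(* The generators are chosen so that [<<s GW>>] and [<<s GX>>] unfold to the two sigma-algebras of
   [l_W_independent]. *)
pose GW : set (set Omega) := \bigcup_(y in @orthant R n)
  preimage_set_system setT (W y) measurable.
pose GX : set (set Omega) := \bigcup_(kt in [set kt : 'I_n * R | kt.2 \in `[0, T kt.1]])
  preimage_set_system setT (l kt.1 kt.2) measurable.
have GW_W y (B : set R) : orthant y -> measurable B -> <<s GW >> (W y @^-1` B).
  move=> oy mB; apply: sub_sigma_algebra; exists y => //.
  by exists B => //; rewrite setTI.
have GX_X k (B : set R) : measurable B -> <<s GX >> (X k @^-1` B).
  move=> mB; apply: sub_sigma_algebra; exists (k, x k); first exact: xT.
  by exists B => //; rewrite setTI.
have mL : measurable_fun setT (subordinated_field W l x).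
  exact: (@measurable_subordinated _ _ _ P _ W X mW mX X_ge0 P_complete W_continuous).
have mlt k : measurable_fun setT (ltilde k (x k)).
  by have [+ _ _ _ _] := ltilde_levy k; apply.
have mS : measurable_fun setT (fun w => \sum_(k < n) ltilde k (x k) w).
  exact: measurable_sum.
(* The Laplace exponent of [l k]; both characteristic functions are brought to this common form. *)
pose psi (k : 'I_n) (s : R) := - (gamma k * s) +
  \int[nu k]_(y in `]0, +oo[%classic) (expR (- (s * y)) - 1).
have nu_min k : (\int[nu k]_(y in `]0%R, +oo[) (Num.min y 1)%:E < +oo)%E.
  by have [] := l_triplet k.
have charS xi : charfun P (fun w => \sum_(k < n) ltilde k (x k) w) xi =
    (\prod_(k < n) expR (x k * psi k (sigma ^+ 2 * xi ^+ 2 / 2)))%:C.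
  rewrite (@independent_charfun_sum _ _ _ P _ _ ltilde_independent (fun k => ltilde k (x k)))//.
    rewrite rmorph_prod; apply: eq_bigr => k _.
    exact: (symmetric_levy_charfun sigma_gt0 (nu_min k) (nusharpE k) (ltilde_triplet k) xi (xT k)).
  move=> k B mB; apply: sub_sigma_algebra; exists (x k); first exact: xT.
  by exists B => //; rewrite setTI.
have laplace s : 0 <= s -> \int[P]_w expR (- (s * \sum_(k < n) X k w)) =
    \prod_(k < n) expR (x k * psi k s).
  move=> s0.
  (* The positive part bounds each factor by 1 at every outcome, as the product formula asks, and
     changes it on a negligible event only. *)
  pose Y k w := expR (- (s * Num.max 0 (X k w))).
  have mphi : measurable_fun setT (fun z : R => expR (- (s * Num.max 0 z))).
    apply: measurableT_comp => //; apply: measurableT_comp => //.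
    by apply: measurable_funM => //; exact: measurable_maxr.
  have mY k : measurable_fun setT (Y k) by exact: (measurableT_comp mphi (mX k)).
  transitivity (\int[P]_w \prod_(k < n) Y k w).
    apply: ae_eq_Rintegral.
    - apply: measurableT_comp => //; apply: measurableT_comp => //.
      by apply: measurable_funM => //; exact: measurable_sum.
    - exact: measurable_prod.
    - apply: filterS X_ge0 => w Xw; rewrite mulr_sumr -sumrN expR_sum.
      by apply: eq_bigr => k _; rewrite /Y (max_idPr (Xw k)).
  rewrite (@independent_Rintegral_prod _ _ _ P _ _ l_independent Y 1)//; last 2 first.
  - move=> k B mB; rewrite -[_ @^-1` _]/(l k (x k) @^-1`
      ((fun z : R => expR (- (s * Num.max 0 z))) @^-1` B)).
    apply: sub_sigma_algebra; exists (x k); first exact: xT.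
    eexists; last by rewrite setTI.
    by rewrite -[Z in measurable Z]setTI; exact: mphi.
  - move=> k w; rewrite ger0_norm ?expR_ge0// expR_le1 oppr_le0 mulr_ge0//.
    by rewrite le_max lexx.
  apply: eq_bigr => k _; have [_ _ _ lE] := l_triplet k.
  rewrite -(subordinator_laplace (mX k) (X_ge0k k) (x0 k) (nu_min k) (fun xi => lE _ xi (xT k)) s0).
  apply: ae_eq_Rintegral => //.
    apply: measurableT_comp => //; apply: measurableT_comp => //.
    exact: measurable_funM.
  by apply: filterS (X_ge0k k) => w Xw; rewrite /Y (max_idPr Xw).
have Wcharfun xi y : orthant y ->
    \int[P]_w cos (xi * W y w) = expR (- (sigma ^+ 2 * xi ^+ 2 / 2 * \sum_(k < n) y 0 k)) /\
    \int[P]_w sin (xi * W y w) = 0.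
  move=> oy; have := W_charfun xi y oy.
  rewrite charfunE cexpE cos0 sin0 mulr1 mulr0 => -[-> ->]; split => //.
  by set S := \sum_(k < n) _; congr expR; field.
have mrow (G : R -> R) : measurable_fun setT G ->
    measurable_fun setT (fun w => G (\sum_(k < n) (\row_k X k w) 0 k)).
  move=> mG; apply: (measurableT_comp mG); apply: measurable_sum => k.
  by rewrite (_ : (fun w => _) = X k)//; apply/funext => w; rewrite mxE.
have freeze_cos xi : \int[P]_w cos (xi * subordinated_field W l x w) =
    \prod_(k < n) expR (x k * psi k (sigma ^+ 2 * xi ^+ 2 / 2)).
  set s := sigma ^+ 2 * xi ^+ 2 / 2.
  have s0 : 0 <= s by rewrite divr_ge0// mulr_ge0// sqr_ge0.
  have cexpN : continuous (fun z : R => expR (- (s * z))).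
    move=> z; apply: (@continuous_comp _ _ _ (fun z : R => - (s * z)) expR).
      by apply: (@cvgN _ R^o); exact: mulrl_continuous.
    exact: continuous_expR.
  rewrite -(laplace _ s0).
  (* Freezing with G equal to the characteristic function of W(y) at xi turns the mean into the
     joint Laplace transform of the subordinators at [s]. *)
  rewrite (@freezing_mean _ _ _ P _ W X GW GX l_W_independent mW mX GW_W GX_X X_ge0
    (fun z => cos (xi * z)) (fun y => expR (- (s * \sum_(k < n) y 0 k))) 1 mL W_continuous).
  - by apply: eq_Rintegral => w _; under eq_bigr do rewrite mxE.
  - move=> z; apply: (@continuous_comp _ _ _ (fun z : R => xi * z) cos).
      exact: mulrl_continuous.
    exact: continuous_cos.
  - by move=> z; exact: cos_max.
  - apply: continuous_subspaceT => y.
    have csum : continuous (fun y : 'rV[R]_n => \sum_(k < n) y 0 k).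
      move=> y'; have FF : Filter (nbhs y') by exact: nbhs_filter.
      apply: (@cvg_big R 'I_n +%R 0 xpredT) => [|k _].
        exact: add_continuous.
      exact: coord_continuous.
    exact: (@continuous_comp _ _ _ (fun y : 'rV[R]_n => \sum_(k < n) y 0 k)
      (fun z : R => expR (- (s * z))) y (csum y) (cexpN _)).
  - by move=> y oy; have [-> _] := Wcharfun xi y oy.
  - apply: (mrow (fun z => expR (- (s * z)))).
    exact: continuous_measurable_fun.
(* The characteristic function of W(y) is real, so its sine means vanish and freezing applies with G
   = 0. *)
have freeze_sin xi : \int[P]_w sin (xi * subordinated_field W l x w) = 0.
  rewrite (@freezing_mean _ _ _ P _ W X GW GX l_W_independent mW mX GW_W GX_X X_ge0
    (fun z => sin (xi * z)) (fun y => 0) 1 mL W_continuous).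
  - by rewrite probability_Rintegral_cst.
  - move=> z; apply: (@continuous_comp _ _ _ (fun z : R => xi * z) sin).
      exact: mulrl_continuous.
    exact: continuous_sin.
  - by move=> z; exact: sin_max.
  - by apply: continuous_subspaceT; exact: cst_continuous.
  - by move=> y oy; have [_ ->] := Wcharfun xi y oy.
  - exact: measurable_cst.
split => //; apply: charfun_eq_law => // u.
  by have := charS u; rewrite charfunE freeze_cos => -[-> _].
by have := charS u; rewrite charfunE freeze_sin => -[_ ->].
Qed.
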